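(* Let $\mathring z,\dot z>0$ and $\mu\in\mathcal G_{\mathring z,\dot z}$. Then the marginal $\mathring\mu$ of $\mu$ on sphere configurations belongs to $\mathcal G_{\mathring z}(\dot z\mathcal E)$, i.e. for every bounded $\Lambda\subset\mathbb R^d$ and every positive measurable $F$ on $\mathring{\mathcal M}$, $$\int F(\mathring{\mathbf x})\,\mathring\mu(d\mathring{\mathbf x})=\int\frac{1}{\mathring Z_\Lambda(\mathring{\mathbf y})}\int F(\mathring{\mathbf x}\mathring{\mathbf y}_{\Lambda^c})\,e^{-\dot z\,\mathcal E_\Lambda(\mathring{\mathbf x}\mathring{\mathbf y}_{\Lambda^c})}\mathbf 1_{\mathcal D}(\mathring{\mathbf y}_{\Lambda^c}\mathring{\mathbf x})\,\pi^{\mathring z}_\Lambda(d\mathring{\mathbf x})\,\mathring\mu(d\mathring{\mathbf y}),$$ where $\mathcal E_\Lambda(\mathring{\mathbf x}):=|\mathcal B(\mathring{\mathbf x}_\Lambda)\setminus\mathcal B(\mathring{\mathbf x}_{\Lambda^c})|$ (an interaction of range $2\hat r$). Moreover: (Low activity) there exists $\mathring z_{\mathrm c}>0$ such that for every $\mathring z<\mathring z_{\mathrm c}$ and every $\dot z>0$, $\mathring\mu$-almost surely there is no percolation of interacting hard spheres, i.e. no infinite connected cluster in the graph on sphere centres joining two centres at distance $<2\hat r$; (High activity) for every $\dot z>0$, any measure $\mathring\mu\in\mathcal G_{\mathring z}(\dot z\mathcal E)$ attains the closest-packing density as $\mathring z\to\infty$: writing $\Lambda_n=[-n,n)^d$ and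 $\rho_{\mathring z}(\dot z)=\lim_{n\to\infty}\frac1{|\Lambda_n|}\int\#\mathring{\mathbf x}_{\Lambda_n}\,\mathring\mu(d\mathring{\mathbf x})$, one has $\lim_{\mathring z\to\infty}\rho_{\mathring z}(\dot z)=\rho^*:=\lim_{n\to\infty}N_n/|\Lambda_n|$, where $N_n$ is the maximal number of mutually disjoint open balls of radius $\mathring r$ contained in $\Lambda_n$.
   Context: Fix $d\ge 2$, radii $0<\dot r<\mathring r$, $\hat r:=\mathring r+\dot r$. Configurations are locally finite point measures $\mathbf x=\mathring{\mathbf x}\dot{\mathbf x}$ on $\mathbb R^d\times\{\circ,\cdot\}$: sphere centres $\mathring x_i$ (radius $\mathring r$) and particle centres $\dot x_k$ (radius $\dot r$), identified with their supports; juxtaposition denotes union; $\mathbf x_\Lambda$ is the restriction to $\Lambda$; $\mathcal M$, $\mathring{\mathcal M}$, $\dot{\mathcal M}$ are the sets of configurations, sphere-only and particle-only configurations. Allowed configurations: $\mathcal D=\{|\mathring x_i-\mathring x_j|\ge2\mathring r\ (i\ne j),\ |\mathring x_i-\dot x_k|\ge\hat r\}$. For a sphere configuration, $\mathcal B(\mathring{\mathbf x}):=\bigcup_{\mathring x\in\mathring{\mathbf x}}B(\mathring x,\hat r)$ (open balls), and $|\cdot|$ is Lebesgue volume. $\pi^z_\Lambda$ is the Poisson point process on $\Lambda$ with intensity $z\,dx$. $\mathcal G_{\mathring z,\dot z}$ is the set of probability measures $\mu$ on $\mathcal M$ such that for every bounded $\Lambda$ and positive measurable $F$ on $\mathcal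 D$: $\int F\,d\mu=\int\frac{1}{Z_\Lambda(\mathbf y)}\iint F(\mathbf y_{\Lambda^c}\mathring{\mathbf x}\dot{\mathbf x})\mathbf 1_{\mathcal D}(\mathbf y_{\Lambda^c}\mathring{\mathbf x}\dot{\mathbf x})\pi^{\dot z}_\Lambda(d\dot{\mathbf x})\pi^{\mathring z}_\Lambda(d\mathring{\mathbf x})\mu(d\mathbf y)$, with $Z_\Lambda(\mathbf y)$ the corresponding normalisation. $\mathcal G_{\mathring z}(\dot z\mathcal E)$ is the set of probability measures $\mathring\mu$ on $\mathring{\mathcal M}$ satisfying the displayed equation for all bounded $\Lambda$ and positive measurable $F$, with $\mathring Z_\Lambda(\mathring{\mathbf y})=\int e^{-\dot z\mathcal E_\Lambda(\mathring{\mathbf x}\mathring{\mathbf y}_{\Lambda^c})}\mathbf 1_{\mathcal D}(\mathring{\mathbf y}_{\Lambda^c}\mathring{\mathbf x})\pi^{\mathring z}_\Lambda(d\mathring{\mathbf x})$. *)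

(* Defs.v *)
From HB Require Import structures.
From mathcomp Require Import all_boot all_order all_algebra.
From mathcomp Require Import all_classical all_reals all_analysis measurable_realfun.
Set Implicit Arguments. Unset Strict Implicit. Unset Printing Implicit Defensive.
Import Order.TTheory GRing.Theory Num.Theory.
Import numFieldNormedType.Exports.
Local Open Scope classical_set_scope.
Local Open Scope ring_scope.

Section Defs.
Context (R : realType) (d : nat).

Definition pt := 'rV[R]_d.
Definition edist (x y : pt) : R := Num.sqrt (\sum_(i < d) (x 0 i - y 0 i) ^+ 2).
Definition eball (x : pt) (r : R) : set pt := [set y | edist x y < r].
Definition ebounded (A : set pt) : Prop :=
  exists M : R, forall x, A x -> edist 0 x <= M.
Definition borel_pt (A : set pt) : Prop := <<s [set U : set pt | open U] >> A.
Definition bounded_borel (A : set pt) : Prop := borel_pt A /\ ebounded A.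

(** d-dimensional Lebesgue integral of nonnegative functions, as iterated
    one-dimensional Lebesgue integrals (Tonelli). *)
Definition ncons (t : R) (g : nat -> R) : nat -> R :=
  fun n => if n is m.+1 then g m else t.
Fixpoint iint (k : nat) (f : (nat -> R) -> \bar R) : \bar R :=
  match k with
  | 0 => f (fun _ => 0)
  | k.+1 => (\int[@lebesgue_measure R]_t iint k (fun g => f (ncons t g)))%E
  end.
Definition intRd (f : pt -> \bar R) : \bar R := iint d (fun g => f (\row_(i < d) g i)).
Definition vol (A : set pt) : \bar R := intRd (fun x => (\1_A x)%:E).

(** Poisson point process pi^z_Lambda with intensity z dx on Lambda,
    acting on nonnegative functions of finite point sets. *)
Fixpoint intn (Lam : set pt) (n : nat) (G : seq pt -> \bar R) : \bar R :=
  match n with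
  | 0 => G [::]
  | n.+1 => intRd (fun x => ((\1_Lam x)%:E * intn Lam n (fun s => G (x :: s)))%E)
  end.
Definition poisson (z : R) (Lam : set pt) (G : set pt -> \bar R) : \bar R :=
  ((expR (- z * fine (vol Lam)))%:E *
   \sum_(n <oo) ((z ^+ n / (n`!)%:R)%:E * intn Lam n (fun s => G [set` s])))%E.

(** Marked configurations (true = sphere, false = particle) and sphere configurations. *)
Definition mconf := set (pt * bool).
Definition sconf := set pt.
Definition mark (b : bool) (X : set pt) : mconf := X `*` [set b].
Definition spheres (x : mconf) : sconf := [set p | x (p, true)].
Definition restrM (x : mconf) (Lam : set pt) : mconf := x `&` (Lam `*` setT).
Definition restrS (X : sconf) (Lam : set pt) : sconf := X `&` Lam.

Definition locfinM (x : mconf) : Prop :=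
  forall B, ebounded B -> finite_set (restrM x B).
Definition locfinS (X : sconf) : Prop :=
  forall B, ebounded B -> finite_set (restrS X B).

Definition genM : set (set mconf) :=
  [set E | exists B b (n : nat), bounded_borel B /\
     E = [set x : mconf | @counting _ R (x `&` (B `*` [set b])) = n%:R%:E]].
Definition genS : set (set sconf) :=
  [set E | exists B (n : nat), bounded_borel B /\
     E = [set X : sconf | @counting _ R (X `&` B) = n%:R%:E]].
Local Notation MConf := (g_sigma_algebraType genM).
Local Notation SConf := (g_sigma_algebraType genS).

Variables (rs rp : R). (* sphere radius \mathring r, particle radius \dot r *)
Definition rhat := rs + rp.

Definition allowed (x : mconf) : Prop :=
  (forall p q, x (p, true) -> x (q, true) -> p <> q -> 2 * rs <= edist p q) /\
  (forall p q, x (p, true) -> x (q, false) -> rhat <= edist p q).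
Definition ind_allowed (x : mconf) : \bar R := (\1_allowed x)%:E.

Definition Bunion (X : sconf) : set pt := \bigcup_(p in X) eball p rhat.
Definition energy (Lam : set pt) (X : sconf) : \bar R :=
  vol (Bunion (restrS X Lam) `\` Bunion (restrS X (~` Lam))).

Definition Zmix (zs zp : R) (Lam : set pt) (y : mconf) : \bar R :=
  poisson zs Lam (fun xs => poisson zp Lam (fun xp =>
    ind_allowed (restrM y (~` Lam) `|` mark true xs `|` mark false xp))).
Definition gibbsM (zs zp : R) (mu : probability MConf R) : Prop :=
  mu [set x : MConf | locfinM x] = 1%E /\
  forall (Lam : set pt) (F : MConf -> \bar R),
    bounded_borel Lam -> measurable_fun [set: MConf] F -> (forall x, 0 <= F x)%E ->
    (\int[mu]_x F x =
     \int[mu]_y (((fine (Zmix zs zp Lam y))^-1)%:E *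
       poisson zs Lam (fun xs => poisson zp Lam (fun xp =>
         let c := restrM y (~` Lam) `|` mark true xs `|` mark false xp in
         F c * ind_allowed c))))%E.

Definition Zsph (zs zp : R) (Lam : set pt) (Y : sconf) : \bar R :=
  poisson zs Lam (fun xs =>
    expeR (- (zp%:E * energy Lam (xs `|` restrS Y (~` Lam)))) *
    ind_allowed (mark true (restrS Y (~` Lam) `|` xs)))%E.
Definition gibbsS (zs zp : R) (nu : probability SConf R) : Prop :=
  nu [set X : SConf | locfinS X] = 1%E /\
  forall (Lam : set pt) (F : SConf -> \bar R),
    bounded_borel Lam -> measurable_fun [set: SConf] F -> (forall X, 0 <= F X)%E ->
    (\int[nu]_X F X =
     \int[nu]_Y (((fine (Zsph zs zp Lam Y))^-1)%:E *
       poisson zs Lam (fun xs =>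
         F (xs `|` restrS Y (~` Lam)) *
         expeR (- (zp%:E * energy Lam (xs `|` restrS Y (~` Lam)))) *
         ind_allowed (mark true (restrS Y (~` Lam) `|` xs)))))%E.

Definition marginal (mu : probability MConf R) (nu : probability SConf R) : Prop :=
  forall A : set SConf, measurable A ->
    nu A = mu ((spheres : MConf -> SConf) @^-1` A).

Definition connected_in (X : sconf) (a b : pt) : Prop :=
  exists s : seq pt, (forall u, u \in s -> X u) /\
    path (fun u v => edist u v < 2 * rhat) a s /\ last a s = b.
Definition percolates (X : sconf) : Prop :=
  exists a, X a /\ infinite_set [set b | X b /\ connected_in X a b].

Definition box (n : nat) : set pt :=
  [set x | forall i : 'I_d, - n%:R <= x 0 i /\ x 0 i < n%:R].
Definition box_vol (n : nat) : R := (2 * n%:R) ^+ d.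
Definition dens_n (nu : probability SConf R) (n : nat) : \bar R :=
  ((box_vol n)^-1%:E * \int[nu]_X counting (restrS X (box n)))%E.
Definition dens_sup (nu : probability SConf R) : \bar R := limn_esup (dens_n nu).
Definition dens_inf (nu : probability SConf R) : \bar R := limn_einf (dens_n nu).
Definition packing_number (n : nat) : \bar R :=
  ereal_sup [set (k%:R)%:E | k in [set k : nat | exists s : seq pt,
    size s = k /\ (forall i, (i < k)%N -> eball (nth 0 s i) rs `<=` box n) /\
    (forall i j, (i < j < k)%N -> eball (nth 0 s i) rs `&` eball (nth 0 s j) rs = set0)]].

End Defs.

Notation MConf R d := (g_sigma_algebraType (@genM R d)).
Notation SConf R d := (g_sigma_algebraType (@genS R d)).

(* Main.v *)
(* Given the spheres, the particles of [mu] in a bounded set form a Poisson process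
   restricted to the complement of the balls of radius [rhat], so integrating them out
   over the [rhat]-neighbourhood of [Lam] leaves the factor [exp (- zp * energy)].

   Low activity: adding a sphere never raises the weight, so a given set of [n] unit
   cubes is entirely occupied with probability at most [zs ^ n]. An infinite cluster
   forces arbitrarily long self-avoiding paths of occupied cubes, and these are summed
   out when [zs] is small.

   High activity: a cell that contains a fixed near-optimal packing of [k] balls, with
   a margin and some slack, has partition function of order at least [zs ^ k], while
   configurations with fewer than [k] spheres in the cell contribute only
   [O (zs ^ (k - 1))]. Hence every cell holds at least [k] spheres with probability
   [1 - O (1 / zs)]; the upper bound on the density is the packing bound. *)

(* A particle outside [Lam] can still touch a sphere inside it, so the two-species equation is used
   on a box [Del] that contains the [rhat]-neighbourhood of [Lam]; independence of the Poisson
   process over disjoint sets then separates [Lam] from the rest of [Del]. The normalisations [Zmix]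
   and [Zsph] are never compared: both sides of the wanted identity become [mu]-integrals carrying
   the same factor [Zmix], so it is enough that their inner integrals over [Lam] agree.

   All estimates hold uniformly in the boundary condition, hence for every Gibbs measure. The
   occupation bound is a one-sided Mecke formula in which [zp] does not appear, so the threshold
   depends only on the dimension and the radii. The error constant of a cell does not depend on its
   position, so all cells of a large box share it.

   Configurations are plain sets, so a union can merge points and counts are not additive.
   Measurability is therefore reduced from counting events to hitting events, which are compatible
   with unions. *)
Require Import Defs.
From HB Require Import structures.
From mathcomp Require Import all_boot all_order all_algebra.
From mathcomp Require Import all_classical all_reals all_analysis measurable_realfun.
From mathcomp Require Import zify ring lra.
Import Order.TTheory GRing.Theory Num.Theory.
Import numFieldNormedType.Exports.
Set Implicit Arguments. Unset Strict Implicit. Unset Printing Implicit Defensive.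
Local Open Scope classical_set_scope.
Local Open Scope ring_scope.
Import Defs.

(** * Euclidean geometry and Borel sets *)

Section Geometry.
Context (R : realType) (d : nat).
Implicit Types x y z : pt R d.

Lemma edist_ge0 x y : 0 <= edist x y.
Proof. exact: sqrtr_ge0. Qed.

Lemma edistC x y : edist x y = edist y x.
Proof. by congr Num.sqrt; apply: eq_bigr => i _; rewrite -sqrrN opprB. Qed.

Lemma edistxx x : edist x x = 0.
Proof. by rewrite /edist big1 ?sqrtr0// => i _; rewrite subrr expr0n. Qed.

Lemma sqr_edist x y : edist x y ^+ 2 = \sum_(i < d) (x 0 i - y 0 i) ^+ 2.
Proof. by rewrite sqr_sqrtr// sumr_ge0// => i _; exact: sqr_ge0. Qed.

Lemma sum_CauchySchwarz (I : finType) (a b : I -> R) :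
  (\sum_i a i * b i) ^+ 2 <= (\sum_i a i ^+ 2) * (\sum_i b i ^+ 2).
Proof.
have : 0 <= \sum_i \sum_j (a i * b j - a j * b i) ^+ 2.
  by do 2!(apply: sumr_ge0 => ? _); exact: sqr_ge0.
under eq_bigr do under eq_bigr do rewrite sqrrB !exprMn.
have E (u v : I -> R) : \sum_i \sum_j u i * v j = (\sum_i u i) * (\sum_j v j).
  by rewrite mulr_suml; apply: eq_bigr => i _; rewrite mulr_sumr.
have -> : \sum_i \sum_j (a i ^+ 2 * b j ^+ 2 - a i * b j * (a j * b i) *+ 2 +
    a j ^+ 2 * b i ^+ 2) = \sum_i \sum_j a i ^+ 2 * b j ^+ 2 -
    (\sum_i \sum_j (a i * b i) * (a j * b j)) *+ 2 +
    \sum_j \sum_i a j ^+ 2 * b i ^+ 2.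
  rewrite [X in _ = _ + X]exchange_big -sumrMnl -sumrB -big_split/=.
  apply: eq_bigr => i _; rewrite -sumrMnl -sumrB -big_split/=.
  by apply: eq_bigr => j _; ring.
rewrite (E (fun i => a i ^+ 2) (fun i => b i ^+ 2)) E -expr2.
have -> (u v : R) : u - v *+ 2 + u = (u - v) *+ 2 by ring.
by rewrite pmulrn_lge0// subr_ge0.
Qed.

Lemma edist_triangle x y z : edist x z <= edist x y + edist y z.
Proof.
rewrite -(ler_pXn2r (_ : 0 < 2)%N) ?nnegrE ?addr_ge0 ?edist_ge0//.
rewrite sqrrD !sqr_edist.
have -> : \sum_i (x 0 i - z 0 i) ^+ 2 = \sum_i (x 0 i - y 0 i) ^+ 2 +
   (\sum_i (x 0 i - y 0 i) * (y 0 i - z 0 i)) *+ 2 + \sum_i (y 0 i - z 0 i) ^+ 2.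
  by rewrite -sumrMnl -!big_split/=; apply: eq_bigr => i _; ring.
rewrite lerD2r lerD2l lerMn2r/= (le_trans (ler_norm _))//.
rewrite -(ler_pXn2r (_ : 0 < 2)%N) ?nnegrE ?mulr_ge0 ?edist_ge0//.
by rewrite real_normK ?num_real// exprMn !sqr_edist sum_CauchySchwarz.
Qed.

Lemma coord_le_edist x y i : `|x 0 i - y 0 i| <= edist x y.
Proof.
rewrite -(ler_pXn2r (_ : 0 < 2)%N) ?nnegrE ?edist_ge0// sqr_edist.
rewrite real_normK ?num_real// (bigD1 i)//= lerDl sumr_ge0// => j _.
exact: sqr_ge0.
Qed.

Lemma edist_le x y (h : R) : (forall i, `|x 0 i - y 0 i| <= h) ->
  edist x y <= d%:R * h.
Proof.
move=> H; have [d0|/prednK d0] := posnP d.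
  rewrite /edist big1 ?sqrtr0; last by move=> i _; have := ltn_ord i; lia.
  by rewrite d0 mul0r.
have h0 : 0 <= h by apply: le_trans (H (cast_ord d0 ord0)); exact: normr_ge0.
rewrite -(ler_pXn2r (_ : 0 < 2)%N) ?nnegrE ?mulr_ge0 ?edist_ge0// sqr_edist.
rewrite (@le_trans _ _ (\sum_(i < d) h ^+ 2))//.
  apply: ler_sum => i _; rewrite -real_normK ?num_real//.
  by rewrite ler_pXn2r ?nnegrE.
rewrite sumr_const card_ord -[X in X <= _]mulr_natl exprMn ler_wpM2r ?sqr_ge0//.
by rewrite -natrX ler_nat -{1}[d]expn1 leq_pexp2l// -d0.
Qed.

Lemma ebounded_coord (A : set (pt R d)) (M : R) :
  (forall x i, A x -> `|x 0 i| <= M) -> ebounded A.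
Proof.
move=> H; exists (d%:R * M) => x Ax; apply: edist_le => i.
by rewrite mxE sub0r normrN H.
Qed.

Lemma ebounded_coordP (A : set (pt R d)) : ebounded A ->
  exists n : nat, forall x i, A x -> `|x 0 i| <= n%:R.
Proof.
move=> [M H]; exists (Num.truncn M).+1 => x i Ax.
rewrite (le_trans _ (ltW (truncnS_gt _)))// (le_trans _ (H x Ax))//.
by have := coord_le_edist 0 x i; rewrite mxE sub0r normrN.
Qed.

Lemma ebounded_sub (A B : set (pt R d)) : A `<=` B -> ebounded B -> ebounded A.
Proof. by move=> AB [M H]; exists M => x /AB/H. Qed.

Lemma ebounded_bigcup (I : choiceType) (s : seq I) (F : I -> set (pt R d)) :
  (forall i, i \in s -> ebounded (F i)) -> ebounded (\bigcup_(i in [set` s]) F i).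
Proof.
elim: s => [|i s IH] H; first by exists 0 => x [].
have [] := IH; first by move=> j js; apply: H; rewrite in_cons js orbT.
move=> M1 H1; have [] := H i; first by rewrite in_cons eqxx.
move=> M2 H2; exists (Num.max M1 M2) => x [j /=]; rewrite in_cons => /orP[/eqP->|js] Fx.
  by rewrite le_max (H2 x)// orbT.
by rewrite le_max (H1 x)//; exists j.
Qed.

Lemma openptP (U : set (pt R d)) : open U <-> (forall x, U x ->
  exists2 e : R, 0 < e & forall y, (forall i, `|x 0 i - y 0 i| < e) -> U y).
Proof.
rewrite openE; split => [+ x Ux|H x Ux].
  move=> /(_ _ Ux) /nbhs_ballP[e /= e0 He]; exists e => // y Hy; apply: He; split=> // i j.
  by rewrite ord1; exact: Hy.
have [e e0 He] := H x Ux; apply/nbhs_ballP; exists e => //= y Hy; apply: He => i.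
by have := Hy.2 0 i.
Qed.

Lemma open_eball x r : open (eball x r).
Proof.
apply/openptP => y xy; exists ((r - edist x y) / d.+1%:R).
  by rewrite divr_gt0// subr_gt0.
move=> z yz; rewrite /eball/= (le_lt_trans (edist_triangle _ y _))//.
have := @edist_le y z ((r - edist x y) / d.+1%:R) (fun i => ltW (yz i)).
have : 0 < r - edist x y by rewrite subr_gt0.
set u := r - _ => u0; suff H1 : d%:R * (u / d.+1%:R) < u.
  by move=> H2; have := le_lt_trans H2 H1; rewrite /u; lra.
by rewrite mulrCA gtr_pMr// ltr_pdivrMr// mul1r ltr_nat.
Qed.

(** Index of the cube of side [1/(k+1)] containing [x]. Large [k] serves to write events as
    countable combinations of cubes; [k = 0] is the unit grid of the percolation argument. *)
Definition cubeidx (k : nat) x : 'rV[int]_d :=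
  \row_i Num.floor (x 0 i * k.+1%:R).

Definition cube (k : nat) (c : 'rV[int]_d) : set (pt R d) :=
  [set x | cubeidx k x = c].

Lemma cube_coord k c x y i : cube k c x -> cube k c y ->
  `|x 0 i - y 0 i| < k.+1%:R^-1.
Proof.
move=> xc yc; have : cubeidx k x 0 i = cubeidx k y 0 i by rewrite xc yc.
rewrite !mxE => E; rewrite -[X in _ < X]mul1r ltr_pdivlMr//.
rewrite -{1}[k.+1%:R]ger0_norm// -normrM mulrBl.
have := @floor_itv R (x 0 i * k.+1%:R).
have := @floor_itv R (y 0 i * k.+1%:R).
rewrite -E intrD ltr_norml => /andP[a b] /andP[a' b'].
by apply/andP; split; lra.
Qed.

Lemma near_cube_coord (e : R) : 0 < e -> \forall k \near \oo,
  forall c x y, cube k c x -> cube k c y -> forall i, `|x 0 i - y 0 i| < e.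
Proof.
move=> e0; near=> k => c x y xc yc i.
rewrite (lt_trans (cube_coord i xc yc))//.
by near: k; exact: near_infty_natSinv_lt (PosNum e0).
Unshelve. all: end_near. Qed.

Lemma near_cube_edist (e : R) : 0 < e -> \forall k \near \oo,
  forall c x y, cube k c x -> cube k c y -> edist x y < e.
Proof.
move=> e0; have e0' : 0 < e / d.+1%:R by rewrite divr_gt0.
apply: filterS (near_cube_coord e0') => k H c x y xc yc.
apply: (@le_lt_trans _ _ (d%:R * (e / d.+1%:R))).
  by apply: edist_le => i; apply: ltW; exact: H xc yc i.
by rewrite mulrCA gtr_pMr// ltr_pdivrMr// mul1r ltr_nat.
Qed.

Lemma near_cubeidx_neq x y : x <> y ->
  \forall k \near \oo, cubeidx k x <> cubeidx k y.
Proof.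
move=> xy; have [i xyi] : exists i, x 0 i != y 0 i.
  apply: contrapT => /forallNP H; apply: xy; apply/rowP => i.
  by have /negP := H i; rewrite negbK => /eqP.
have e0 : 0 < `|x 0 i - y 0 i| by rewrite normr_gt0 subr_eq0.
apply: filterS (near_cube_coord e0) => k H E.
by have := H (cubeidx k x) x y erefl (esym E) i; rewrite ltxx.
Qed.

End Geometry.

Notation Bpt R d := (g_sigma_algebraType ([set U : set (pt R d) | open U])).

Lemma eq_measurable dT (T : sigmaRingType dT) (A B : set T) :
  A = B -> measurable B -> measurable A.
Proof. by move=> ->. Qed.

Section BorelSets.
Context (R : realType) (d : nat).
Implicit Types (x y : pt R d).

Lemma borel_open (U : set (pt R d)) : open U -> measurable (U : set (Bpt R d)).
Proof. exact: sub_sigma_algebra. Qed.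

Lemma measurable_coord i : measurable_fun [set: Bpt R d] (fun x : Bpt R d => x 0 i : R).
Proof.
apply: (measurability _ (RGenOInfty.measurableE R)) => _ [_ [a ->] <-].
rewrite setTI; apply: borel_open; apply/openptP => x; rewrite /= in_itv/= andbT => ax.
exists (x 0 i - a); first by rewrite subr_gt0.
move=> y /(_ i); rewrite /= in_itv/= andbT ltr_norml => /andP[_]; lra.
Qed.

Lemma borel_coord (A : 'I_d -> set R) : (forall i, measurable (A i)) ->
  measurable ([set x | forall i, A i (x 0 i)] : set (Bpt R d)).
Proof.
move=> mA; apply: (@eq_measurable _ _ _
    (\bigcap_(i in [set: 'I_d]) ((fun x : Bpt R d => x 0 i : R) @^-1` A i))).
  by apply/seteqP; split=> x /= H i; [move=> _; exact: H|exact: H i I].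
apply: fin_bigcap_measurable; first exact: finite_finset.
by move=> i _; rewrite -[X in measurable X]setTI; exact: measurable_coord.
Qed.

Lemma cubeE k c : @cube R d k c =
  [set x | forall i, `[(c 0 i)%:~R / k.+1%:R, (c 0 i + 1)%:~R / k.+1%:R[%classic (x 0 i)].
Proof.
apply/seteqP; split=> x /=.
  move=> <- i; rewrite in_itv/= !mxE ler_pdivrMr// ltr_pdivlMr//.
  exact: floor_itv.
move=> H; apply/rowP => i; rewrite mxE; have := H i.
by rewrite in_itv/= ler_pdivrMr// ltr_pdivlMr// => /floor_def.
Qed.

Lemma borel_cube k c : measurable (@cube R d k c : set (Bpt R d)).
Proof.
rewrite cubeE; exact: (borel_coord (A := fun i =>
  `[(c 0 i)%:~R / k.+1%:R, (c 0 i + 1)%:~R / k.+1%:R[%classic)).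
Qed.

Lemma cube_bounded k c : ebounded (@cube R d k c).
Proof.
apply: (@ebounded_coord _ _ _ (\sum_i `|(c 0 i)%:~R / k.+1%:R| + 1)) => x i.
rewrite cubeE => /(_ i)/=; rewrite in_itv/= intrD mulrDl.
have H1 : `|(c 0 i)%:~R / k.+1%:R : R| <= \sum_i `|(c 0 i)%:~R / k.+1%:R|.
  by rewrite (bigD1 i)//= lerDl sumr_ge0.
have : 1%:~R / k.+1%:R <= 1 :> R by rewrite ler_pdivrMr// mul1r ler1n.
move: (1%:~R / k.+1%:R : R) H1 => v.
move: (_ / _ : R) (\sum_i _) => u w uw v1 /andP[ux xv].
have := ler_norm u; have := ler_norm (- u); rewrite normrN => u1 u2.
by rewrite ler_norml; apply/andP; split; lra.
Qed.

Lemma open_bigcup_cube (U : set (pt R d)) : open U ->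
  U = \bigcup_k \bigcup_(c in [set c | cube k c `<=` U]) cube k c.
Proof.
move=> oU; apply/seteqP; split=> x; last by move=> [k _ [c /= cU]] /cU.
move=> /((openptP U).1 oU)[e e0 He].
have [k _ /(_ _ (leqnn k)) H] := near_cube_coord d e0.
exists k => //; exists (cubeidx k x) => //= y yc; apply: He => i.
exact: H yc i.
Qed.

(** Every open set is a countable union of grid cubes, and a cube is a finite intersection of
    conditions on coordinates. *)
Lemma measurable_to_pt dT (T : measurableType dT) (f : T -> Bpt R d) :
  (forall i, measurable_fun [set: T] (fun t => f t 0 i : R)) ->
  measurable_fun [set: T] f.
Proof.
move=> mf; apply: (@measurability _ _ T (Bpt R d) setT f [set U : set (pt R d) | open U]) => // _ [U oU <-].
rewrite setTI (open_bigcup_cube oU) preimage_bigcup.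
apply: bigcupT_measurable => k; rewrite bigcup_mkcond preimage_bigcup.
apply: countable_bigcupT_measurable => // c; case: ifP => _; last first.
  by rewrite preimage_set0.
rewrite cubeE (_ : _ @^-1` _ = \bigcap_(i in [set: 'I_d]) ((fun t => f t 0 i : R) @^-1`
   `[(c 0 i)%:~R / k.+1%:R, (c 0 i + 1)%:~R / k.+1%:R[%classic)).
  apply: fin_bigcap_measurable; first exact: finite_finset.
  by move=> i _; rewrite -[X in measurable X]setTI; exact: mf.
by apply/seteqP; split=> x /= H i; [move=> _; exact: H|exact: H i I].
Qed.

Lemma borel_box n : measurable (@box R d n : set (Bpt R d)).
Proof.
apply: (@eq_measurable _ _ _
    ([set x | forall i, `[- n%:R, n%:R[%classic (x 0 i)] : set (Bpt R d))).
  by apply/seteqP; split=> x /= H i; have := H i; rewrite in_itv/=; [case=> -> ->|move/andP].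
exact: (borel_coord (A := fun=> _)).
Qed.

Lemma box_bounded n : ebounded (@box R d n).
Proof.
apply: (@ebounded_coord _ _ _ n%:R) => x i /(_ i)[a b].
by rewrite ler_norml a ltW.
Qed.

Lemma bigcup_box : \bigcup_n @box R d n = setT.
Proof.
rewrite -subTset => x _.
have [|n Hn] := @ebounded_coordP R d [set x].
  by exists (edist 0 x) => _ ->.
exists n.+1 => // i; have := Hn x i erefl; rewrite ler_norml => /andP[a b].
by rewrite -natr1; split; lra.
Qed.

Lemma ebounded_box (A : set (pt R d)) : ebounded A -> exists n, A `<=` box n.
Proof.
move=> /ebounded_coordP[n Hn]; exists n.+1 => x Ax i.
have := Hn x i Ax; rewrite ler_norml => /andP[a b].
by rewrite -natr1; split; lra.
Qed.

End BorelSets.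

(** * Counting and measurability of configurations *)

Section Counting.
Context (R : realType) (T : choiceType).

(** Finite witnesses replace the values of [counting], so that inclusions and disjoint unions can be
    handled without a case distinction on [+oo]. *)
Definition atleast (n : nat) (Z : set T) :=
  exists s : seq T, [/\ uniq s, size s = n & [set` s] `<=` Z].

Lemma atleast_le m n Z : (m <= n)%N -> atleast n Z -> atleast m Z.
Proof.
move=> mn [s [us ss sZ]]; exists (take m s); split.
- exact: take_uniq.
- by rewrite size_takel// ss.
- by move=> x /= /mem_take /sZ.
Qed.

Lemma atleast_sub n Y Z : Y `<=` Z -> atleast n Y -> atleast n Z.
Proof. by move=> YZ [s [us ss sY]]; exists s; split=> // x /sY/YZ. Qed.

Lemma counting_ge (Z : set T) n : (n%:R%:E <= counting Z :> \bar R)%E <-> atleast n Z.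
Proof.
rewrite /counting; case: ifPn => [/asboolP fZ|/asboolPn iZ].
  rewrite lee_fin ler_nat; split=> [nZ|[s [us <- sZ]]].
    apply: (@atleast_le _ (size (finmap.enum_fset (fset_set Z)))) => //.
    exists (finmap.enum_fset (fset_set Z)); split=> //.
    by move=> x /=; rewrite in_fset_set// inE.
  apply: uniq_leq_size => // x xs; rewrite in_fset_set// inE; exact: sZ.
split=> // _; rewrite ?leey//.
have [B BZ nB] := infinite_set_fset n iZ.
apply: (@atleast_le _ _ _ nB); by exists (finmap.enum_fset B); split.
Qed.

Lemma counting_nat (Z : set T) : counting Z = +oo%E :> \bar R \/
  exists n : nat, counting Z = n%:R%:E :> \bar R.
Proof. by rewrite /counting; case: ifP => _; [right; eexists|left]. Qed.

Lemma counting_eqP (Z : set T) n : counting Z = n%:R%:E :> \bar R <->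
  atleast n Z /\ ~ atleast n.+1 Z.
Proof.
split=> [E|[H1 H2]].
  by split; [apply/counting_ge|move=> /counting_ge]; rewrite E// lee_fin ler_nat ltnn.
have [E|[m E]] := counting_nat Z.
  by exfalso; apply: H2; apply/counting_ge; rewrite E leey.
move: H1 => /counting_ge; rewrite E lee_fin ler_nat => nm.
have : (m < n.+1)%N.
  by rewrite ltnNge; apply/negP => mn; apply: H2; apply/counting_ge;
     rewrite E lee_fin ler_nat.
by rewrite ltnS => mn; congr (_%:R%:E); apply/eqP; rewrite eqn_leq nm mn.
Qed.

Lemma counting0P (Z : set T) : counting Z = 0 :> \bar R <-> Z = set0.
Proof.
rewrite (counting_eqP Z 0); split=> [[_ H]|->].
  by rewrite -subset0 => z Zz; apply: H; exists [:: z]; split=> // x /=;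
    rewrite inE => /eqP ->.
split; first by exists [::].
by move=> [s]; case: s => [|z s] [] // _ _ /(_ z); apply; rewrite /= in_cons eqxx.
Qed.

Lemma finite_counting (Z : set T) : finite_set Z <-> exists n : nat,
  counting Z = n%:R%:E :> \bar R.
Proof.
rewrite /counting; split; last by case: ifPn => [/asboolP//|_ [n]].
by move=> fZ; rewrite asboolT//; eexists.
Qed.

End Counting.

Section Hitting.
Context (R : realType) (d : nat).

(** Hitting a set commutes with unions, of configurations as well as of the sets hit; counts do
    not. *)
Definition hit (B : set (pt R d)) : set (sconf R d) := [set X | X `&` B !=set0].

(** Finitely many distinct points fall into distinct cubes of a fine enough grid; conversely one
    point is chosen in each cube. This turns a count into a countable union of hitting
    conditions. *)
Lemma atleast_cubes n (Z : set (pt R d)) : atleast n Z <->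
  exists k (cs : seq 'rV[int]_d), [/\ uniq cs, size cs = n &
    forall c, c \in cs -> Z `&` cube k c !=set0].
Proof.
split=> [[s [us ss sZ]]|[k [cs [ucs scs Hcs]]]]; last first.
  pose f c := xget 0 (Z `&` cube k c).
  have fP c : c \in cs -> (Z `&` cube k c) (f c) by move=> /Hcs; exact: xgetPex.
  exists (map f cs); split; last 2 first.
  - by rewrite size_map.
  - by move=> x /= /mapP[c /fP[+ _] ->].
  rewrite map_inj_in_uniq// => c c' /fP[_ E] /fP[_ E'] ff.
  by rewrite -[LHS]E ff.
have : \forall k \near \oo, forall x y, x \in s -> y \in s -> x != y ->
    cubeidx k x != cubeidx k y.
  suff : \forall k \near \oo, forall x, x \in s -> forall y, y \in s -> x != y ->
      cubeidx k x != cubeidx k y.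
    by apply: filterS => k H x y xs ys; exact: H.
  have Hall (P : nat -> pt R d -> Prop) (t : seq (pt R d)) :
      (forall x, x \in t -> \forall k \near \oo, P k x) ->
      \forall k \near \oo, forall x, x \in t -> P k x.
    elim: t => [|a t IH] H; first by near=> k => x.
    have Ha := H a (mem_head _ _).
    have Ht : \forall k \near \oo, forall x, x \in t -> P k x.
      by apply: IH => x xt; apply: H; rewrite in_cons xt orbT.
    by apply: filterS2 Ha Ht => k Pa Pt x; rewrite in_cons => /orP[/eqP->|/Pt].
  apply: (Hall _ s) => x xs; apply: (Hall _ s) => y ys.
  have [->|/eqP xy] := eqVneq x y; first by near=> k; rewrite eqxx.
  by apply: filterS (near_cubeidx_neq xy) => k /eqP.
move=> [k _ /(_ k (leqnn k)) Hk].
exists k, (map (@cubeidx R d k) s); split.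
- rewrite map_inj_in_uniq// => x y xs ys E; apply/eqP/negPn/negP => /(Hk _ _ xs ys).
  by rewrite E eqxx.
- by rewrite size_map.
- by move=> c /mapP[x xs ->]; exists x; split=> //; exact: sZ.
Unshelve. all: by end_near. Qed.

(** Hitting events generate the counting sigma-algebra, by [atleast_cubes]: there are countably many
    grids and countably many lists of cubes. Measurability of insertion, union and restriction of
    configurations is checked through this criterion. *)
Lemma measurable_to_SConf dT (T : measurableType dT) (f : T -> SConf R d) :
  (forall B, bounded_borel B -> measurable (f @^-1` hit B)) ->
  measurable_fun [set: T] f.
Proof.
move=> mf; apply: (@measurability _ _ T (SConf R d) setT f (@genS R d)) => // _ [_ [B [n [bB ->]]] <-].
rewrite setTI.
have mA m : measurable (f @^-1` [set X | atleast m (X `&` B)]).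
  rewrite (_ : _ @^-1` _ = \bigcup_k \bigcup_(cs in
      [set cs : seq 'rV[int]_d | uniq cs /\ size cs = m])
      \bigcap_(c in [set` cs]) f @^-1` hit (B `&` cube k c)); last first.
    apply/seteqP; split=> t /=.
      move=> /atleast_cubes[k [cs [ucs scs Hc]]]; exists k => //; exists cs => // c cs'.
      by rewrite /preimage/= /hit/= setIA; exact: Hc.
    move=> [k _ [cs [ucs scs] H]]; apply/atleast_cubes; exists k, cs; split=> // c ccs.
    by rewrite -setIA; exact: H ccs.
  apply: bigcupT_measurable => k; rewrite bigcup_mkcond.
  apply: countable_bigcupT_measurable => // cs; case: ifP => // _.
  apply: fin_bigcap_measurable; first exact: finite_seq.
  move=> c _; apply: mf; split; last by apply: ebounded_sub bB.2 => x [].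
  exact: (@measurableI _ (Bpt R d) _ _ bB.1 (borel_cube k c)).
rewrite (_ : _ @^-1` _ = f @^-1` [set X | atleast n (X `&` B)] `\`
  f @^-1` [set X | atleast n.+1 (X `&` B)]); first exact: measurableD.
by apply/seteqP; split=> t /= /counting_eqP.
Qed.

Lemma measurable_hit_bounded (B : set (pt R d)) : bounded_borel B ->
  measurable (hit B : set (SConf R d)).
Proof.
move=> bB; rewrite (_ : hit B = ~` [set X | @counting _ R (X `&` B) = 0%:R%:E]).
  by apply: measurableC; apply: sub_sigma_algebra; exists B, 0%N.
apply/seteqP; split=> X /=; first by move=> + /counting0P E; rewrite /hit/= E => -[].
by move=> H; apply/set0P/eqP => E; apply: H; apply/counting0P.
Qed.

Lemma hit_bigcup (I : Type) (D : set I) (F : I -> set (pt R d)) :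
  hit (\bigcup_(i in D) F i) = \bigcup_(i in D) hit (F i).
Proof.
apply/seteqP; split=> X; first by move=> [x [Xx [i Di Fx]]]; exists i => //; exists x.
by move=> [i Di [x [Xx Fx]]]; exists x; split=> //; exists i.
Qed.

Lemma bounded_borel_box (B : set (pt R d)) n : measurable (B : set (Bpt R d)) ->
  bounded_borel (B `&` box n).
Proof.
move=> mB; split; last by apply: ebounded_sub (@box_bounded R d n) => x [].
exact: (@measurableI _ (Bpt R d) _ _ mB (borel_box n)).
Qed.

Lemma measurable_hit (B : set (pt R d)) : measurable (B : set (Bpt R d)) ->
  measurable (hit B : set (SConf R d)).
Proof.
move=> mB; rewrite -[B]setIT -(bigcup_box R d) setI_bigcupr hit_bigcup.
by apply: bigcupT_measurable => n; apply: measurable_hit_bounded; exact: bounded_borel_box.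
Qed.

Lemma measurable_counting (B : set (pt R d)) : bounded_borel B ->
  measurable_fun [set: SConf R d] (fun X : SConf R d => @counting _ R (X `&` B)).
Proof.
move=> bB _ Y mY; rewrite setTI.
have mE m : measurable ([set X | @counting _ R (X `&` B) = m%:R%:E] : set (SConf R d)).
  by apply: sub_sigma_algebra; exists B, m.
have mE' : measurable ([set X | @counting _ R (X `&` B) = +oo%E] : set (SConf R d)).
  rewrite (_ : [set X | _] = ~` \bigcup_m [set X | @counting _ R (X `&` B) = m%:R%:E]).
    by apply: measurableC; exact: bigcupT_measurable.
  apply/seteqP; split=> X /=; first by move=> E [m _] /=; rewrite E.
  by move=> H; have [//|[m E]] := counting_nat R (X `&` B); exfalso; apply: H; exists m.
rewrite (_ : _ @^-1` _ =
   (\bigcup_(m in [set m : nat | Y m%:R%:E]) [set X | @counting _ R (X `&` B) = m%:R%:E])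
   `|` (if +oo%E \in Y then [set X | @counting _ R (X `&` B) = +oo%E] else set0)).
  apply: measurableU; last by case: ifP.
  by apply: bigcup_measurable => m _.
apply/seteqP; split=> X /=.
  have [E|[m E]] := counting_nat R (X `&` B); rewrite E => YX; last by left; exists m.
  by right; rewrite ifT ?inE.
move=> [[m /= Ym ->]//|]; case: ifP => //; rewrite inE => Yoo.
by move=> /= ->.
Qed.

End Hitting.

(** * Iterated integrals and Lebesgue volume *)

Section IntegralExtra.
Context dT (T : measurableType dT) (R : realType).
Local Open Scope ereal_scope.

(* [\int] of a nonnegative function is a supremum over simple functions below it,
   so monotonicity does not need measurability. *)
Lemma integral_mono (mu : {measure set T -> \bar R}) (f g : T -> \bar R) :
  (forall x, 0 <= f x) -> (forall x, f x <= g x) ->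
  \int[mu]_x f x <= \int[mu]_x g x.
Proof.
move=> f0 fg; have g0 x : 0 <= g x by exact: le_trans (fg x).
rewrite !ge0_integralE// !patch_setT.
apply: le_ereal_sup => _ [h /= hf <-]; exists h => //= x.
by rewrite (le_trans (hf x)).
Qed.

Lemma measurable_eindic (A : set T) : measurable A ->
  measurable_fun [set: T] (fun x => (\1_A x)%:E : \bar R).
Proof.
by move=> mA; apply: measurableT_comp => //; apply: (measurable_indicP R A).1.
Qed.

(** Bundles a known finiteness property into the structure on which product measures and
    Fubini-Tonelli are stated. *)
Lemma sigma_finite_measure_of (mu : {measure set T -> \bar R}) :
  sigma_finite setT mu ->
  exists m : {sigma_finite_measure set T -> \bar R}, forall A, m A = mu A.
Proof.
move=> smu; pose H1 := isSFinite.Build _ _ _ _ (sfinite_measure_sigma_finite smu).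
pose H2 := isSigmaFinite.Build _ _ _ _ smu.
pose m := HB.pack_for (SigmaFiniteMeasure.type T R) (Measure.sort mu) H1 H2.
by exists m.
Qed.

Lemma finite_measure_of (mu : {measure set T -> \bar R}) :
  mu setT < +oo ->
  exists m : {finite_measure set T -> \bar R}, forall A, m A = mu A.
Proof.
move=> smu; have fmu : fin_num_fun mu.
  by move=> A mA; rewrite ge0_fin_numE// (le_lt_trans _ smu)// le_measure ?inE.
pose H1 := isFinite.Build _ _ _ _ fmu.
have sfmu : sigma_finite setT mu.
  by apply: fin_num_fun_sigma_finite => //; rewrite measure0.
pose H2 := isSFinite.Build _ _ _ _ (sfinite_measure_sigma_finite sfmu).
pose H3 := isSigmaFinite.Build _ _ _ _ sfmu.
pose m := HB.pack_for (FiniteMeasure.type T R) (Measure.sort mu) H1 H2 H3.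
by exists m.
Qed.

Lemma pushforward_of dS (S : measurableType dS) (mu : {measure set T -> \bar R})
    (phi : T -> S) : measurable_fun [set: T] phi ->
  exists2 m : {measure set S -> \bar R}, forall A, m A = mu (phi @^-1` A) &
  forall f, measurable_fun [set: S] f -> (forall x, 0 <= f x) ->
    \int[m]_x f x = \int[mu]_x f (phi x).
Proof.
move=> mphi; unshelve eexists (pushforward mu phi) => //.
by move=> f mf f0; rewrite ge0_integral_pushforward.
Qed.

End IntegralExtra.

Lemma sigma_finite_prod d1 d2 (T1 : measurableType d1) (T2 : measurableType d2)
    (R : realType) (m1 : {sigma_finite_measure set T1 -> \bar R})
    (m2 : {sigma_finite_measure set T2 -> \bar R}) :
  sigma_finite [set: T1 * T2] (m1 \x m2)%E.
Proof.
have [F FT mF] := sigma_finiteT m1; have [G GT mG] := sigma_finiteT m2.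
pose p n : nat * nat := odflt (0, 0)%N (unpickle n).
exists (fun n => F (p n).1 `*` G (p n).2); last first.
  move=> n; split; first by apply: measurableX; [exact: (mF _).1|exact: (mG _).1].
  rewrite product_measure1E; [|exact: (mF _).1|exact: (mG _).1].
  rewrite lte_mul_pinfty//; last exact: (mG _).2.
  by rewrite ge0_fin_numE//; exact: (mF _).2.
apply/esym; rewrite -subTset => -[x y] _.
have : [set: T1] x by []; have : [set: T2] y by [].
rewrite {1}FT {1}GT => -[j _ Gy] [i _ Fx].
by exists (pickle (i, j)) => //; rewrite /p pickleK.
Qed.

Section IteratedIntegral.
Context (R : realType).
Local Open Scope ereal_scope.

Lemma iint_ge0 k f : (forall g, 0 <= f g) -> 0 <= @iint R k f.
Proof.
by elim: k f => [|k IH] f f0 //=; apply: integral_ge0 => t _; exact: IH.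
Qed.

Lemma iint_mono k f f' : (forall g, 0 <= f g) -> (forall g, f g <= f' g) ->
  @iint R k f <= @iint R k f'.
Proof.
elim: k f f' => [|k IH] f f' f0 ff' //=; apply: integral_mono => t.
  exact: iint_ge0.
exact: IH.
Qed.

Lemma iint_prod k (A : nat -> set R) : (forall i, measurable (A i)) ->
  @iint R k (fun g => (\prod_(i < k) (\1_(A i) (g i) : R))%:E) =
  \prod_(i < k) lebesgue_measure (A i).
Proof.
elim: k A => [|k IH] A mA /=; first by rewrite !big_ord0.
rewrite big_ord_recl -(IH (fun i => A i.+1))//.
have iint0 n : @iint R n (fun=> 0) = 0.
  by elim: n => //= n IHn; rewrite IHn integral0.
transitivity (\int[@lebesgue_measure R]_t ((\1_(A 0%N) t)%:E *
    @iint R k (fun g => (\prod_(i < k) (\1_(A i.+1) (g i) : R))%:E))).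
  apply: eq_integral => t _; rewrite [in RHS]indicE; have [tA|tA] := boolP (t \in A 0%N).
    rewrite mul1e; congr iint; apply/funext => g.
    by rewrite big_ord_recl/= [X in (X * _)%R]indicE tA mul1r.
  rewrite mul0e -[RHS](iint0 k); congr iint; apply/funext => g.
  by rewrite big_ord_recl/= [X in (X * _)%R]indicE (negbTE tA) mul0r.
rewrite ge0_integralZr//; last 2 first.
- by apply: measurable_eindic; exact: mA.
- by apply: iint_ge0 => g; rewrite lee_fin; apply: prodr_ge0.
by rewrite integral_indic ?setIT//; exact: mA.
Qed.

(** Generators of the product sigma-algebra on real sequences, the space on which all the [iint k]
    live at once, whatever [k] is. *)
Definition coordsys : set (set (nat -> R)) :=
  [set E | exists i (B : set R), measurable B /\ E = [set g | B (g i)]].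
Notation Rseq := (g_sigma_algebraType coordsys).

Lemma measurable_proj i : measurable_fun [set: Rseq] (fun g : Rseq => g i : R).
Proof.
move=> _ B mB; rewrite setTI; apply: sub_sigma_algebra; exists i, B; split=> //.
Qed.

Lemma measurable_to_Rseq dT (T : measurableType dT) (f : T -> Rseq) :
  (forall i, measurable_fun [set: T] (fun t => f t i : R)) -> measurable_fun [set: T] f.
Proof.
move=> mf; apply: (@measurability _ _ T Rseq setT f coordsys) => //.
by move=> _ [_ [i [B [mB ->]]] <-]; exact: mf.
Qed.

Lemma measurable_ncons :
  measurable_fun [set: R * Rseq] (fun p : R * Rseq => ncons p.1 p.2 : Rseq).
Proof.
apply: measurable_to_Rseq => -[|i] /=; first exact: measurable_fst.
exact: (measurableT_comp (measurable_proj i) measurable_snd).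
Qed.

Definition nuncons (g : Rseq) : R * Rseq := (g 0%N, fun i => g i.+1).

Lemma measurable_nuncons : measurable_fun [set: Rseq] nuncons.
Proof.
apply/measurable_fun_pairP; split; first exact: measurable_proj.
by apply: measurable_to_Rseq => i; exact: measurable_proj.
Qed.

(** Realises the iterated integral as one measure, so that Tonelli and monotone convergence become
    available. It starts from the Dirac mass at the zero sequence, and each step pushes Lebesgue
    measure times the previous measure through [ncons], whose inverse [nuncons] carries
    sigma-finiteness over. *)
Lemma iint_measure k : exists m : {sigma_finite_measure set Rseq -> \bar R},
  forall f, measurable_fun [set: Rseq] f -> (forall g, 0 <= f g) ->
    iint k f = \int[m]_g f g.
Proof.
elim: k => [|k [m IH]].
  exists (\d_((fun=> 0%R) : Rseq)) => f mf f0.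
  by rewrite /= integral_dirac// diracE in_setT mul1e.
have [m' m'E m'I] := pushforward_of (@lebesgue_measure R \x m) measurable_ncons.
have sm' : sigma_finite setT m'.
  have [F FT mF] := sigma_finite_prod (@lebesgue_measure R) m.
  exists (fun n => nuncons @^-1` F n).
    by rewrite -preimage_bigcup -FT preimage_setT.
  move=> n; have [mFn Fn] := mF n; split.
    by rewrite -[X in measurable X]setTI; exact: measurable_nuncons.
  by rewrite m'E -comp_preimage (_ : _ \o _ = id)//; apply/funext => -[].
have [m'' m''E] := sigma_finite_measure_of sm'.
exists m'' => f mf f0.
rewrite (eq_measure_integral m'); last by move=> A _ _; exact: m''E.
rewrite m'I//=.
have mf' : measurable_fun [set: R * Rseq] (fun p => f (ncons p.1 p.2)).
  exact: (measurableT_comp mf measurable_ncons).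
rewrite fubini_tonelli1//.
apply: eq_integral => t _; rewrite /fubini_F IH//=.
apply: (measurableT_comp mf); apply: measurable_to_Rseq => -[|i] /=.
  exact: measurable_cst.
exact: measurable_proj.
Qed.

End IteratedIntegral.

Notation Rseq R := (g_sigma_algebraType (@coordsys R)).

Section Restriction.
Context dT (T : measurableType dT) (R : realType) (mu : {measure set T -> \bar R}).
Local Open Scope ereal_scope.

Lemma integral_indic_mul (D : set T) (f : T -> \bar R) :
  \int[mu]_x ((\1_D x)%:E * f x) = \int[mu]_(x in D) f x.
Proof.
rewrite [RHS]integral_mkcond; apply: eq_integral => x _.
by rewrite patchE indicE; case: ifP => _; rewrite ?mul1e ?mul0e.
Qed.

Lemma integral_mrestr (D : set T) (mD : measurable D) (f : T -> \bar R) :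
  measurable_fun [set: T] f -> (forall x, 0 <= f x) ->
  \int[mrestr mu mD]_x f x = \int[mu]_(x in D) f x.
Proof.
move=> mf f0; rewrite (@ge0_negligible_integral _ _ _ (mrestr mu mD) setT (~` D))//.
- rewrite setTD setCK; apply: eq_measure_integral => A mA AD.
  by transitivity (mu (A `&` D)) => //; rewrite setIidl.
- exact: measurableC.
- by transitivity (mu (~` D `&` D)) => //; rewrite setICl measure0.
Qed.

End Restriction.

Section Volume.
Context (R : realType) (d : nat).
Local Open Scope ereal_scope.

Lemma intRd_ge0 (f : pt R d -> \bar R) : (forall x, 0 <= f x) -> 0 <= intRd f.
Proof. by move=> f0; exact: iint_ge0. Qed.

Lemma intRd_mono (f g : pt R d -> \bar R) : (forall x, 0 <= f x) ->
  (forall x, f x <= g x) -> intRd f <= intRd g.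
Proof. by move=> f0 fg; exact: iint_mono. Qed.

Lemma vol_ge0 (A : set (pt R d)) : 0 <= vol A.
Proof. by apply: intRd_ge0 => x; rewrite lee_fin. Qed.

Lemma vol_mono (A B : set (pt R d)) : A `<=` B -> vol A <= vol B.
Proof.
move=> AB; apply: intRd_mono => x; rewrite lee_fin// !indicE.
have [xA|] := boolP (x \in A); last by rewrite ler0n.
by rewrite ler_nat (_ : x \in B)//; apply/mem_set/AB/set_mem.
Qed.

Lemma vol_prod (A : 'I_d -> set R) : (forall i, measurable (A i)) ->
  vol [set x | forall i, A i (x 0%R i)] = \prod_(i < d) lebesgue_measure (A i).
Proof.
move=> mA; pose A' i := if insub i is Some j then A j else setT : set R.
have A'E (i : 'I_d) : A' i = A i by rewrite /A' valK.
have mA' i : measurable (A' i) by rewrite /A'; case: insubP.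
under eq_bigr do rewrite -A'E.
rewrite -iint_prod// /vol /intRd; congr iint; apply/funext => g; congr EFin.
rewrite indicE; have [|] := boolP (_ \in _).
  rewrite inE /= => H; rewrite big1// => i _.
  by rewrite indicE mem_set// A'E; have := H i; rewrite mxE.
move=> /negP; rewrite inE /= => /existsNP[i]; rewrite mxE -A'E => H.
by rewrite (bigD1 i)//= indicE memNset// mul0r.
Qed.

Lemma vol_rect (a b : 'I_d -> R) : (forall i, a i <= b i)%R ->
  vol [set x : pt R d | forall i, (a i <= x 0%R i < b i)%R] =
  (\prod_(i < d) (b i - a i))%:E.
Proof.
move=> ab; transitivity (\prod_(i < d) lebesgue_measure `[a i, b i[%classic).
  exact: (@vol_prod (fun i => `[a i, b i[%classic)).
rewrite -prodEFin; apply: eq_bigr => i _.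
rewrite lebesgue_measure_itv/= lte_fin; case: ltP => // ba.
by rewrite (le_anti (introT andP (conj (ab i) ba))) subrr.
Qed.

Lemma vol_box n : vol (@box R d n) = (box_vol R d n)%:E.
Proof.
rewrite (_ : box n = [set x : pt R d | forall i, (- n%:R <= x 0%R i < n%:R)%R]).
  rewrite vol_rect; last by move=> i; rewrite lerNl (le_trans (y := 0%R))// oppr_le0.
  by rewrite prodr_const card_ord /box_vol; congr ((_ ^+ _)%:E); ring.
by apply/seteqP; split=> x /= H i; have := H i; [case=> -> ->|move/andP].
Qed.

Lemma vol_bounded (A : set (pt R d)) : ebounded A -> vol A < +oo.
Proof.
by move=> /ebounded_box[n /vol_mono/le_lt_trans]; apply; rewrite vol_box ltry.
Qed.

Lemma vol_fin (A : set (pt R d)) : ebounded A -> (fine (vol A))%:E = vol A.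
Proof. by move=> /vol_bounded ?; rewrite fineK// ge0_fin_numE ?vol_ge0. Qed.

Lemma measurable_torow :
  measurable_fun [set: Rseq R] (fun g : Rseq R => \row_(i < d) g i : Bpt R d).
Proof.
apply: measurable_to_pt => i; rewrite (_ : (fun g => _) = (fun g : Rseq R => g i)).
  exact: measurable_proj.
by apply/funext => g; rewrite mxE.
Qed.

(** Pushes the measure of [iint_measure] to row vectors; sigma-finiteness comes from the boxes,
    whose volume is computed explicitly. *)
Lemma lam_exists : exists lam : {sigma_finite_measure set (Bpt R d) -> \bar R},
  forall f, measurable_fun [set: Bpt R d] f -> (forall x, 0 <= f x) ->
    intRd f = \int[lam]_x f x.
Proof.
have [m mE] := @iint_measure R d.
have [m' m'E m'I] := pushforward_of m measurable_torow.
have IE f : measurable_fun [set: Bpt R d] f -> (forall x, 0 <= f x) ->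
    intRd f = \int[m']_x f x.
  move=> mf f0; rewrite m'I// /intRd mE//.
  exact: (measurableT_comp mf measurable_torow).
have [m'' m''E] : exists m'' : {sigma_finite_measure set (Bpt R d) -> \bar R},
    forall A, m'' A = m' A.
  apply: sigma_finite_measure_of; exists (@box R d); first by rewrite bigcup_box.
  move=> n; split; first exact: borel_box.
  have <- : \int[m']_x (\1_(@box R d n) x)%:E = m' (box n).
    by rewrite integral_indic ?setIT//; exact: borel_box.
  rewrite -IE//; last by apply: measurable_eindic; exact: borel_box.
  by apply: vol_bounded; exact: box_bounded.
exists m'' => f mf f0; rewrite IE//.
by apply: eq_measure_integral => A _ _; exact: esym (m''E A).
Qed.

Definition lam : {sigma_finite_measure set (Bpt R d) -> \bar R} := projT1 (cid lam_exists).

Lemma intRdE f : measurable_fun [set: Bpt R d] f -> (forall x, 0 <= f x) ->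
  intRd f = \int[lam]_x f x.
Proof. exact: (projT2 (cid lam_exists)). Qed.

Lemma volE (A : set (Bpt R d)) : measurable A -> vol A = lam A.
Proof.
move=> mA; rewrite /vol intRdE//; last exact: measurable_eindic.
by rewrite integral_indic ?setIT.
Qed.

Lemma vol1 (x : pt R d) : (0 < d)%N -> vol [set x] = 0.
Proof.
move=> d0; have -> : [set x] = [set y : pt R d | forall i, [set x 0%R i] (y 0%R i)].
  by apply/seteqP; split=> y /=; [move=> ->|move=> H; apply/rowP => i; exact: H].
rewrite (vol_prod (A := fun i => [set x 0%R i]))//.
by rewrite (bigD1 (Ordinal d0))//= lebesgue_measure_set1 mul0e.
Qed.

End Volume.

Lemma set_seq_cons (T : eqType) (x : T) (s : seq T) : [set` x :: s] = x |` [set` s].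
Proof.
apply/seteqP; split=> y /=; rewrite in_cons; first by move=> /orP[/eqP->|]; [left|right].
by move=> [->|ys]; rewrite ?eqxx// ys orbT.
Qed.

Lemma set_seq_nil (T : eqType) : [set` [::]] = set0 :> set T.
Proof. by apply/seteqP; split. Qed.

(** * Poisson integrals *)

Section PoissonBasics.
Context (R : realType) (d : nat).
Local Open Scope ereal_scope.
Implicit Types (Lam : set (pt R d)) (z : R).

Lemma measurable_insert : measurable_fun [set: Bpt R d * SConf R d]
  (fun p : Bpt R d * SConf R d => (p.1 : pt R d) |` (p.2 : set (pt R d)) : SConf R d).
Proof.
apply: measurable_to_SConf => B bB.
apply: (@eq_measurable _ _ _ ((B : set (Bpt R d)) `*` [set: SConf R d] `|`
  [set: Bpt R d] `*` (hit B : set (SConf R d)))).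
  apply/seteqP; split=> -[x X] /=.
    by move=> [y [[/= ->|/= Xy] By]]; [left|right; split=> //; exists y].
  by move=> [[Bx _]|[_ [y [Xy By]]]]; [exists x; split=> //; left|exists y; split=> //; right].
apply: measurableU; apply: measurableX => //; first exact: bB.1.
exact: measurable_hit_bounded.
Qed.

Lemma measurable_setU_conf : measurable_fun [set: SConf R d * SConf R d]
  (fun p : SConf R d * SConf R d =>
    (p.1 : set (pt R d)) `|` (p.2 : set (pt R d)) : SConf R d).
Proof.
apply: measurable_to_SConf => B bB.
apply: (@eq_measurable _ _ _ ((hit B : set (SConf R d)) `*` [set: SConf R d] `|`
  [set: SConf R d] `*` (hit B : set (SConf R d)))).
  apply/seteqP; split=> -[X Y] /=.
    by move=> [y [[/= Xy|/= Yy] By]]; [left|right]; split=> //; exists y.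
  by move=> [[[y [Xy By]] _]|[_ [y [Yy By]]]]; exists y; split=> //; [left|right].
by apply: measurableU; apply: measurableX => //; exact: measurable_hit_bounded.
Qed.

Lemma intn_ge0 Lam n (G : seq (pt R d) -> \bar R) :
  (forall s, 0 <= G s) -> 0 <= intn Lam n G.
Proof.
elim: n G => [|n IH] G G0 //=; apply: intRd_ge0 => x.
by rewrite mule_ge0 ?lee_fin// IH.
Qed.

Lemma intn_mono Lam n (G G' : seq (pt R d) -> \bar R) : (forall s, 0 <= G s) ->
  (forall s, size s = n -> (forall x, x \in s -> Lam x) -> G s <= G' s) ->
  intn Lam n G <= intn Lam n G'.
Proof.
elim: n G G' => [|n IH] G G' G0 GG' /=; first exact: GG'.
apply: intRd_mono => x; first by rewrite mule_ge0 ?lee_fin// intn_ge0.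
rewrite indicE; have [xL|xL] := boolP (x \in Lam); last by rewrite !mul0e.
rewrite !mul1e; apply: IH => // s sn sL; apply: GG'; first by rewrite /= sn.
by move=> y; rewrite in_cons => /orP[/eqP->|/sL//]; exact: set_mem.
Qed.

Lemma intn_cst Lam n : bounded_borel Lam ->
  intn Lam n (fun=> 1) = ((fine (vol Lam)) ^+ n)%:E.
Proof.
move=> [mL bL]; elim: n => [|n IH] //=.
rewrite intRdE; last 2 first.
- by rewrite IH; apply: emeasurable_funM => //; exact: measurable_eindic.
- by move=> x; rewrite IH -EFinM lee_fin mulr_ge0 ?exprn_ge0// fine_ge0 ?vol_ge0.
rewrite ge0_integralZr//; last 2 first.
- exact: measurable_eindic.
- by rewrite intn_ge0.
rewrite integral_indic// setIT IH exprS EFinM vol_fin//.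
by congr (_ * _); exact/esym/volE.
Qed.

Lemma lam_restr Lam : bounded_borel Lam ->
  exists l : {finite_measure set (Bpt R d) -> \bar R},
  forall f, measurable_fun [set: Bpt R d] f -> (forall x, 0 <= f x) ->
    \int[l]_x f x = \int[@lam R d]_(x in Lam) f x.
Proof.
move=> [mL fL]; have [|l lE] := @finite_measure_of _ _ _ (mrestr (@lam R d) mL).
  apply: le_lt_trans (vol_bounded fL); rewrite volE//.
  have : mrestr (@lam R d) mL setT = @lam R d (setT `&` Lam) by [].
  by rewrite setTI => <-.
exists l => f mf f0; rewrite -(integral_mrestr (@lam R d) mL mf f0).
by apply: eq_measure_integral => A _ _; exact: lE.
Qed.

(** An integrand that sees only the set of sampled points is integrated against a finite measure on
    configurations, built by inserting the points one at a time. [poisson_measure] does the same for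
    the weighted series, and linearity and measurability of Poisson integrals follow from these
    two. *)
Lemma intn_measure Lam n : bounded_borel Lam ->
  exists q : {finite_measure set (SConf R d) -> \bar R},
  forall G : SConf R d -> \bar R, measurable_fun [set: SConf R d] G ->
    (forall X, 0 <= G X) -> intn Lam n (fun s => G [set` s]) = \int[q]_X G X.
Proof.
move=> bL; have [mL fL] := bL; elim: n => [|n [q IH]].
  exists (\d_(set0 : SConf R d)) => G mG G0.
  by rewrite /= integral_dirac// diracE in_setT mul1e set_seq_nil.
have [l lI] := lam_restr bL.
have [m mE mI] := pushforward_of (l \x q)%E measurable_insert.
have IE (G : SConf R d -> \bar R) : measurable_fun [set: SConf R d] G ->
    (forall X, 0 <= G X) -> intn Lam n.+1 (fun s => G [set` s]) = \int[m]_X G X.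
  move=> mG G0; rewrite mI//.
  have mG' : measurable_fun [set: Bpt R d * SConf R d]
      (fun p : Bpt R d * SConf R d => G ((p.1 : pt R d) |` (p.2 : set (pt R d)))).
    exact: (measurableT_comp mG measurable_insert).
  rewrite fubini_tonelli1//.
  rewrite lI; last 2 first.
  - exact: (measurable_fun_fubini_tonelli_F _ mG').
  - by move=> x; exact: integral_ge0.
  rewrite -integral_indic_mul/=.
  have E x : intn Lam n (fun s => G [set` x :: s]) = \int[q]_X G (x |` X).
    rewrite -(IH (fun X => G (x |` X)))//.
      by congr intn; apply/funext => s; rewrite set_seq_cons.
    exact: (measurableT_comp mG' (@pair1_measurable _ _ (Bpt R d) (SConf R d) x)).
  rewrite intRdE.
  - by apply: eq_integral => x _; congr (_ * _); exact: E.
  - rewrite (_ : (fun x => _) = (fun x => (\1_Lam x)%:E * \int[q]_X G (x |` X))).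
      apply: emeasurable_funM; first exact: measurable_eindic.
      exact: (measurable_fun_fubini_tonelli_F _ mG').
    by apply/funext => x; congr (_ * _); exact: E.
  - by move=> x; rewrite mule_ge0 ?lee_fin// intn_ge0.
have [m' m'E] : exists m' : {finite_measure set (SConf R d) -> \bar R}, forall A, m' A = m A.
  apply: finite_measure_of; have := IE (fun=> 1) (measurable_cst _) (fun=> lee01).
  by rewrite intn_cst// integral_cst// mul1e => <-; rewrite ltry.
exists m' => G mG G0; rewrite IE//.
by apply: eq_measure_integral => A _ _; exact: esym (m'E A).
Qed.

Lemma exp_nneseries (x : R) : \sum_(n <oo) (x ^+ n / (n`!)%:R)%:E = (expR x)%:E.
Proof.
rewrite /expR -EFin_lim; last exact: is_cvg_series_exp_coeff.
by apply/congr_lim/funext => n /=; rewrite /series/= -sumEFin.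
Qed.

Lemma poisson_weight_ge0 z n : (0 <= z)%R -> (0 <= z ^+ n / (n`!)%:R)%R.
Proof. by move=> z0; rewrite divr_ge0// exprn_ge0. Qed.

Lemma poisson_ge0 z Lam (G : sconf R d -> \bar R) : (0 <= z)%R ->
  (forall X, 0 <= G X) -> 0 <= poisson z Lam G.
Proof.
move=> z0 G0; rewrite mule_ge0 ?lee_fin ?expR_ge0//.
by apply: nneseries_ge0 => n _ _; rewrite mule_ge0 ?intn_ge0// lee_fin poisson_weight_ge0.
Qed.

Lemma poisson_mono z Lam (G G' : sconf R d -> \bar R) : (0 <= z)%R ->
  (forall X, 0 <= G X) ->
  (forall X, finite_set X -> X `<=` Lam -> G X <= G' X) ->
  poisson z Lam G <= poisson z Lam G'.
Proof.
move=> z0 G0 GG'; apply: lee_wpmul2l; first by rewrite lee_fin expR_ge0.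
apply: lee_nneseries => n _ ; first by rewrite mule_ge0 ?intn_ge0// lee_fin poisson_weight_ge0.
apply: lee_wpmul2l; first by rewrite lee_fin poisson_weight_ge0.
by apply: intn_mono => // s _ sL; apply: GG' => //; exact: finite_seq.
Qed.

Lemma eq_poisson z Lam (G G' : sconf R d -> \bar R) : (0 <= z)%R ->
  (forall X, 0 <= G X) -> (forall X, 0 <= G' X) ->
  (forall X, finite_set X -> X `<=` Lam -> G X = G' X) ->
  poisson z Lam G = poisson z Lam G'.
Proof.
by move=> z0 G0 G'0 E; apply/eqP; rewrite eq_le; apply/andP; split;
  apply: poisson_mono => // s ss sL; rewrite E.
Qed.

Lemma poisson_cst z Lam : (0 <= z)%R -> bounded_borel Lam ->
  poisson z Lam (fun=> 1) = 1.
Proof.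
move=> z0 bL; rewrite /poisson.
under eq_eseriesr do rewrite intn_cst// -EFinM mulrAC -exprMn.
by rewrite exp_nneseries -EFinM -expRD mulNr addrC subrr expR0.
Qed.

Lemma poisson_measure z Lam : (0 <= z)%R -> bounded_borel Lam ->
  exists P : {finite_measure set (SConf R d) -> \bar R},
  forall G : SConf R d -> \bar R, measurable_fun [set: SConf R d] G ->
    (forall X, 0 <= G X) -> poisson z Lam G = \int[P]_X G X.
Proof.
move=> z0 bL; have [q qE] := choice (fun n => @intn_measure Lam n bL).
pose a n : {nonneg R} := NngNum (poisson_weight_ge0 n z0).
pose c : {nonneg R} := NngNum (expR_ge0 (- z * fine (vol Lam))).
pose P := mscale c (mseries (fun n => mscale (a n) (q n)) 0).
have PE (G : SConf R d -> \bar R) : measurable_fun [set: SConf R d] G ->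
    (forall X, 0 <= G X) -> poisson z Lam G = \int[P]_X G X.
  move=> mG G0; rewrite ge0_integral_mscale// ge0_integral_measure_series//.
  congr (_ * _); apply: eq_eseriesr => n _.
  by rewrite ge0_integral_mscale// -qE.
have [P' P'E] : exists P' : {finite_measure set (SConf R d) -> \bar R}, forall A, P' A = P A.
  apply: finite_measure_of; have := PE (fun=> 1) (measurable_cst _) (fun=> lee01).
  by rewrite poisson_cst// integral_cst// mul1e => <-; rewrite ltry.
exists P' => G mG G0; rewrite PE//.
by apply: eq_measure_integral => A _ _; exact: esym (P'E A).
Qed.

Lemma measurable_intn dT (T : measurableType dT) Lam n (H : T -> SConf R d -> \bar R) :
  bounded_borel Lam ->
  measurable_fun [set: T * SConf R d] (fun p : T * SConf R d => H p.1 p.2) ->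
  (forall t X, 0 <= H t X) ->
  measurable_fun [set: T] (fun t => intn Lam n (fun s => H t [set` s])).
Proof.
move=> bL mH H0; have [q qE] := intn_measure n bL.
rewrite (_ : (fun t => _) = (fun t => \int[q]_X H t X)).
  exact: (measurable_fun_fubini_tonelli_F _ mH).
apply/funext => t; rewrite qE//.
exact: (measurableT_comp mH (measurable_pair1 t)).
Qed.

Lemma measurable_poisson dT (T : measurableType dT) z Lam (H : T -> SConf R d -> \bar R) :
  (0 <= z)%R -> bounded_borel Lam ->
  measurable_fun [set: T * SConf R d] (fun p : T * SConf R d => H p.1 p.2) ->
  (forall t X, 0 <= H t X) ->
  measurable_fun [set: T] (fun t => poisson z Lam (H t)).
Proof.
move=> z0 bL mH H0; have [q qE] := poisson_measure z0 bL.
rewrite (_ : (fun t => _) = (fun t => \int[q]_X H t X)).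
  exact: (measurable_fun_fubini_tonelli_F _ mH).
apply/funext => t; rewrite qE//.
exact: (measurableT_comp mH (measurable_pair1 t)).
Qed.

Lemma poissonZl z Lam (c : \bar R) (G : SConf R d -> \bar R) : (0 <= z)%R ->
  bounded_borel Lam -> 0 <= c -> measurable_fun [set: SConf R d] G ->
  (forall X, 0 <= G X) -> poisson z Lam (fun X => c * G X) = c * poisson z Lam G.
Proof.
move=> z0 bL c0 mG G0; have [q qE] := poisson_measure z0 bL.
rewrite !qE// ?ge0_integralZl//; last by move=> X; rewrite mule_ge0.
by apply: emeasurable_funM => //; exact: measurable_cst.
Qed.

End PoissonBasics.

(** * Double series and Pascal's rule *)

Section EsumExtra.
Context (R : realType).
Local Open Scope ereal_scope.

Lemma nneseries_cauchy (b : nat -> nat -> \bar R) : (forall i j, 0 <= b i j) ->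
  \sum_(n <oo) \sum_(k < n.+1) b k (n - k)%N = \sum_(k <oo) \sum_(j <oo) b k j.
Proof.
move=> b0; pose f k n := if (k <= n)%N then b k (n - k)%N else 0.
have f0 k n : 0 <= f k n by rewrite /f; case: ifP.
transitivity (\sum_(n <oo) \sum_(k <oo) f k n).
  apply: eq_eseriesr => n _.
  rewrite (@nneseries_split _ _ 0 n.+1)// add0n [X in _ + X]eseries0.
    rewrite adde0 big_mkord; apply: eq_bigr => k _.
    by rewrite /f -ltnS ltn_ord.
  by move=> k nk _; rewrite /f leqNgt nk.
rewrite nneseries_interchange//; apply: eq_eseriesr => k _.
rewrite (@nneseries_split _ _ 0 k)// add0n [X in X + _]big1_seq ?add0e.
  rewrite -nneseries_addn//; apply: eq_eseriesr => j _.
  by rewrite /f leq_addl addnK.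
by move=> i /andP[_]; rewrite mem_index_iota => /andP[_ ik]; rewrite /f leqNgt ik.
Qed.

(** Pascal's rule in the form produced by one more sampled point, which raises either the first or
    the second index. *)
Lemma sum_pascal (a : nat -> nat -> \bar R) n : (forall i j, 0 <= a i j) ->
  \sum_(k < n.+1) ('C(n, k)%:R%:E * (a k.+1 (n - k)%N + a k (n - k).+1)) =
  \sum_(k < n.+2) ('C(n.+1, k)%:R%:E * a k (n.+1 - k)%N).
Proof.
move=> a0; under eq_bigr do rewrite ge0_muleDr//.
rewrite big_split/= [in RHS]big_ord_recl/= bin0 mul1e subn0.
under [in RHS]eq_bigr => i _.
  rewrite /bump leq0n add1n binS natrD EFinD ge0_muleDl ?lee_fin// subSS.
  over.
rewrite [in RHS]big_split/=.
have -> : \sum_(k < n.+1) 'C(n, k)%:R%:E * a k (n - k).+1 =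
    a 0%N n.+1 + \sum_(i < n.+1) 'C(n, i.+1)%:R%:E * a i.+1 (n - i)%N.
  rewrite big_ord_recl/= bin0 mul1e subn0; congr (_ + _).
  rewrite [in RHS]big_ord_recr/= bin_small// mul0e adde0.
  by apply: eq_bigr => i _; rewrite /bump leq0n add1n subnSK.
by rewrite [LHS]addeC -[LHS]addeA.
Qed.

Lemma measurable_nneseries dT (T : measurableType dT) (f : nat -> T -> \bar R) :
  (forall n, measurable_fun [set: T] (f n)) -> (forall n x, 0 <= f n x) ->
  measurable_fun [set: T] (fun x => \sum_(n <oo) f n x).
Proof.
move=> mf f0.
exact: (@ge0_emeasurable_sum _ _ _ setT f xpredT (fun n x _ _ => f0 n x) (fun n _ => mf n)).
Qed.

End EsumExtra.

(** * Independence of the Poisson process over disjoint sets *)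

Section PoissonTools.
Context (R : realType) (d : nat).
Local Open Scope ereal_scope.
Implicit Types (Lam : set (pt R d)) (z : R).

Lemma intnS Lam n (G : sconf R d -> \bar R) :
  intn Lam n.+1 (fun s => G [set` s]) =
  intRd (fun x => (\1_Lam x)%:E * intn Lam n (fun s => G (x |` [set` s]))).
Proof.
rewrite /=; congr intRd; apply/funext => x; congr (_ * intn _ _ _).
by apply/funext => s; rewrite set_seq_cons.
Qed.

Lemma measurable_comp_insert (G : SConf R d -> \bar R) :
  measurable_fun [set: SConf R d] G ->
  measurable_fun [set: Bpt R d * SConf R d]
    (fun p : Bpt R d * SConf R d => G ((p.1 : pt R d) |` (p.2 : set (pt R d)))).
Proof. by move=> mG; exact: (measurableT_comp mG (@measurable_insert R d)). Qed.

Lemma measurable_comp_insert1 (G : SConf R d -> \bar R) (x : pt R d) :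
  measurable_fun [set: SConf R d] G ->
  measurable_fun [set: SConf R d] (fun X : SConf R d => G (x |` (X : set (pt R d)))).
Proof.
move=> /measurable_comp_insert mG.
exact: (measurableT_comp mG (@pair1_measurable _ _ (Bpt R d) (SConf R d) x)).
Qed.

Lemma measurable_comp_setU (G : SConf R d -> \bar R) :
  measurable_fun [set: SConf R d] G ->
  measurable_fun [set: SConf R d * SConf R d]
    (fun p : SConf R d * SConf R d => G ((p.1 : set (pt R d)) `|` (p.2 : set (pt R d)))).
Proof. by move=> mG; exact: (measurableT_comp mG (@measurable_setU_conf R d)). Qed.

Lemma measurable_comp_setU1 (G : SConf R d -> \bar R) (X : set (pt R d)) :
  measurable_fun [set: SConf R d] G ->
  measurable_fun [set: SConf R d] (fun Y : SConf R d => G (X `|` (Y : set (pt R d)))).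
Proof.
move=> /measurable_comp_setU mG.
exact: (measurableT_comp mG (@pair1_measurable _ _ (SConf R d) (SConf R d) X)).
Qed.

Section Split.
Variables (L1 L2 : set (pt R d)).
Hypotheses (bL1 : bounded_borel L1) (bL2 : bounded_borel L2).

Let a (G : sconf R d -> \bar R) k j :=
  intn L1 k (fun s => intn L2 j (fun t => G ([set` s] `|` [set` t]))).

Let a_ge0 G k j : (forall X, 0 <= G X) -> 0 <= a G k j.
Proof. by move=> G0; do 2 (apply: intn_ge0 => ?). Qed.

Let measurable_inner (G : SConf R d -> \bar R) j : measurable_fun [set: SConf R d] G ->
  (forall X, 0 <= G X) -> measurable_fun [set: SConf R d]
    (fun X : SConf R d => intn L2 j (fun t => G ((X : set (pt R d)) `|` [set` t]))).
Proof.
move=> mG G0; apply: (measurable_intn (H := fun X Y : SConf R d =>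
  G ((X : set (pt R d)) `|` (Y : set (pt R d)))) j bL2) => //.
exact: measurable_comp_setU.
Qed.

Let aSl (G : SConf R d -> \bar R) k j :
  a G k.+1 j = intRd (fun x => (\1_L1 x)%:E * a (fun X => G (x |` X)) k j).
Proof.
rewrite /a (intnS L1 k (fun X => intn L2 j (fun t => G (X `|` [set` t])))).
congr intRd; apply/funext => x; congr (_ * intn _ _ _).
apply/funext => s; congr intn; apply/funext => t.
by rewrite setUA.
Qed.

(** Unlike in [aSl], the point peeled off is integrated inside the [L1] variables, so Tonelli is
    needed to bring it to the front. *)
Let aSr (G : SConf R d -> \bar R) k j : measurable_fun [set: SConf R d] G ->
  (forall X, 0 <= G X) ->
  a G k j.+1 = intRd (fun x => (\1_L2 x)%:E * a (fun X => G (x |` X)) k j).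
Proof.
move=> mG G0; have [q qE] := intn_measure k bL1.
pose h (x : pt R d) (X : SConf R d) : \bar R :=
  (\1_L2 x)%:E * intn L2 j (fun t => G (x |` ((X : set (pt R d)) `|` [set` t]))).
have h0 x X : 0 <= h x X by rewrite mule_ge0 ?lee_fin// intn_ge0.
have mh : measurable_fun [set: Bpt R d * SConf R d]
    (fun p : Bpt R d * SConf R d => h p.1 p.2).
  apply: emeasurable_funM.
    exact: (measurableT_comp (@measurable_eindic _ (Bpt R d) R L2 bL2.1) measurable_fst).
  apply: (measurable_intn (H := fun (p : Bpt R d * SConf R d) (Y : SConf R d) =>
    G ((p.1 : pt R d) |` ((p.2 : set (pt R d)) `|` (Y : set (pt R d))))) j bL2) => //.
  have m2 : measurable_fun [set: (Bpt R d * SConf R d) * SConf R d]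
      (fun p : (Bpt R d * SConf R d) * SConf R d =>
        (p.1.2 : set (pt R d)) `|` (p.2 : set (pt R d)) : SConf R d).
    have m3 : measurable_fun [set: (Bpt R d * SConf R d) * SConf R d]
        (fun p : (Bpt R d * SConf R d) * SConf R d => (p.1.2, p.2)).
      apply/measurable_fun_pairP; split; last exact: measurable_snd.
      exact: (measurableT_comp measurable_snd measurable_fst).
    exact: (measurableT_comp (@measurable_setU_conf R d) m3).
  have m1 : measurable_fun [set: (Bpt R d * SConf R d) * SConf R d]
      (fun p : (Bpt R d * SConf R d) * SConf R d =>
        (p.1.1, (p.1.2 : set (pt R d)) `|` (p.2 : set (pt R d)) : SConf R d)).
    apply/measurable_fun_pairP; split; last exact: m2.
    exact: (measurableT_comp measurable_fst measurable_fst).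
  exact: (measurableT_comp (measurable_comp_insert mG) m1).
transitivity (\int[q]_X \int[@lam R d]_x h x X).
  rewrite /a (qE (fun X => intn L2 j.+1 (fun t => G ((X : set (pt R d)) `|` [set` t])))).
  - apply: eq_integral => X _.
    rewrite (intnS L2 j (fun Y => G ((X : set (pt R d)) `|` Y))) -intRdE.
    + congr intRd; apply/funext => x; congr (_ * intn _ _ _); apply/funext => t.
      by rewrite setUCA.
    + exact: (measurableT_comp mh (@pair2_measurable _ _ (Bpt R d) (SConf R d) X)).
    + by move=> x; exact: h0.
  - exact: measurable_inner.
  - by move=> X; exact: intn_ge0.
rewrite -(fubini_tonelli (fun p : Bpt R d * SConf R d => h p.1 p.2) mh)//.
have E x : (\1_L2 x)%:E * a (fun X => G (x |` X)) k j = \int[q]_X h x X.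
  have mG1 := measurable_inner j (measurable_comp_insert1 x mG) (fun=> G0 _).
  by rewrite /h ge0_integralZl// -?qE// => X; rewrite ?intn_ge0// => _; exact: intn_ge0.
rewrite intRdE.
- by apply: eq_integral => x _ /=; rewrite -E.
- rewrite (_ : (fun x => _) = (fun x : Bpt R d => \int[q]_X h x X)).
    exact: (measurable_fun_fubini_tonelli_F _ mh).
  by apply/funext => x; rewrite E.
- by move=> x; rewrite mule_ge0 ?lee_fin// a_ge0.
Qed.

Let a_fin_measurable (G : SConf R d -> \bar R) k j : measurable_fun [set: SConf R d] G ->
  (forall X, 0 <= G X) ->
  measurable_fun [set: Bpt R d] (fun x : Bpt R d => a (fun X => G ((x : pt R d) |` X)) k j).
Proof.
move=> mG G0.
apply: (measurable_intn (H := fun (x : Bpt R d) (X : SConf R d) =>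
  intn L2 j (fun t => G ((x : pt R d) |` ((X : set (pt R d)) `|` [set` t])))) k bL1) => //.
  apply: (measurable_intn (H := fun (p : Bpt R d * SConf R d) (Y : SConf R d) =>
    G ((p.1 : pt R d) |` ((p.2 : set (pt R d)) `|` (Y : set (pt R d))))) j bL2) => //.
  have m2 : measurable_fun [set: (Bpt R d * SConf R d) * SConf R d]
      (fun p : (Bpt R d * SConf R d) * SConf R d =>
        (p.1.2 : set (pt R d)) `|` (p.2 : set (pt R d)) : SConf R d).
    have m3 : measurable_fun [set: (Bpt R d * SConf R d) * SConf R d]
        (fun p : (Bpt R d * SConf R d) * SConf R d => (p.1.2, p.2)).
      apply/measurable_fun_pairP; split; last exact: measurable_snd.
      exact: (measurableT_comp measurable_snd measurable_fst).
    exact: (measurableT_comp (@measurable_setU_conf R d) m3).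
  have m1 : measurable_fun [set: (Bpt R d * SConf R d) * SConf R d]
      (fun p : (Bpt R d * SConf R d) * SConf R d =>
        (p.1.1, (p.1.2 : set (pt R d)) `|` (p.2 : set (pt R d)) : SConf R d)).
    apply/measurable_fun_pairP; split; last exact: m2.
    exact: (measurableT_comp measurable_fst measurable_fst).
  exact: (measurableT_comp (measurable_comp_insert mG) m1).
by move=> x X; exact: intn_ge0.
Qed.

Hypothesis L12 : L1 `&` L2 = set0.

(** Binomial formula, by induction on the first point: disjointness puts it in exactly one of the
    two sets. *)
Lemma intn_setU (G : SConf R d -> \bar R) n : measurable_fun [set: SConf R d] G ->
  (forall X, 0 <= G X) ->
  intn (L1 `|` L2) n (fun s => G [set` s]) =
  \sum_(k < n.+1) ('C(n, k)%:R%:E * a G k (n - k)).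
Proof.
elim: n G => [|n IH] G mG G0.
  by rewrite big_ord1 bin0 mul1e /a/= set_seq_nil setU0.
rewrite intnS -(sum_pascal n (a := a G)); last by move=> i j; exact: a_ge0.
have mGx x := measurable_comp_insert1 x mG.
pose b x k := a (fun X => G (x |` X)) k (n - k)%N.
have b0 x k : 0 <= b x k by apply: a_ge0.
have mb k : measurable_fun [set: Bpt R d] (fun x : Bpt R d => b x k).
  exact: a_fin_measurable.
pose c1 k (x : Bpt R d) := 'C(n, k)%:R%:E * ((\1_L1 x)%:E * b x k).
pose c2 k (x : Bpt R d) := 'C(n, k)%:R%:E * ((\1_L2 x)%:E * b x k).
have m1 (L : set (pt R d)) k : bounded_borel L ->
    measurable_fun [set: Bpt R d] (fun x : Bpt R d => (\1_L x)%:E * b x k).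
  by move=> [mL _]; apply: emeasurable_funM; [exact: (@measurable_eindic _ (Bpt R d))|].
have I0 (L : set (pt R d)) k x : 0 <= (\1_L x)%:E * b x k by rewrite mule_ge0 ?lee_fin.
rewrite (_ : (fun x => _) = (fun x => \sum_(k < n.+1) (c1 k x + c2 k x))); last first.
  apply/funext => x; rewrite (IH (fun X => G (x |` X)))//.
  rewrite ge0_sume_distrr; last first.
    by move=> i _; rewrite mule_ge0 ?lee_fin// b0.
  apply: eq_bigr => k _; rewrite /c1 /c2 -ge0_muleDr// -ge0_muleDl ?lee_fin//.
  rewrite muleCA -EFinD; congr (_ * (_%:E * _)).
  rewrite !indicE in_setU.
  have [x1|x1] := boolP (x \in L1); last by rewrite add0r.
  have [x2|x2] := boolP (x \in L2); last by rewrite addr0.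
  by have : (L1 `&` L2) x; [split; exact: set_mem|rewrite L12].
have mc1 k : measurable_fun [set: Bpt R d] (c1 k).
  by apply: emeasurable_funM; [exact: measurable_cst|exact: m1].
have mc2 k : measurable_fun [set: Bpt R d] (c2 k).
  by apply: emeasurable_funM; [exact: measurable_cst|exact: m1].
have c10 k x : 0 <= c1 k x by rewrite mule_ge0 ?lee_fin.
have c20 k x : 0 <= c2 k x by rewrite mule_ge0 ?lee_fin.
rewrite intRdE; last 2 first.
- by apply: emeasurable_sum => k _; apply: emeasurable_funD.
- by move=> x; apply: sume_ge0 => k _; rewrite adde_ge0.
rewrite ge0_integral_sum//; last 2 first.
- by move=> k; apply: emeasurable_funD.
- by move=> k x _; rewrite adde_ge0.
apply: eq_bigr => k _; rewrite ge0_integralD//.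
rewrite ge0_muleDr ?a_ge0//; congr (_ + _).
  rewrite aSl intRdE; [|exact: m1|by move=> x; exact: I0].
  by rewrite /c1 ge0_integralZl ?lee_fin//; exact: m1.
rewrite aSr// intRdE; [|exact: m1|by move=> x; exact: I0].
by rewrite /c2 ge0_integralZl ?lee_fin//; exact: m1.
Qed.

Let setU_bounded : bounded_borel (L1 `|` L2).
Proof.
split; first by apply: (@measurableU _ (Bpt R d)); [exact: bL1.1|exact: bL2.1].
have [[_ [M1 H1]] [_ [M2 H2]]] := (bL1, bL2).
by exists (Num.max M1 M2) => x [/H1|/H2] xM; rewrite le_max xM ?orbT.
Qed.

Lemma vol_setU : vol (L1 `|` L2) = vol L1 + vol L2.
Proof.
rewrite !volE; [|exact: bL2.1|exact: bL1.1|exact: setU_bounded.1].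
by rewrite measureU//; [exact: bL1.1|exact: bL2.1].
Qed.

(** The binomial coefficient turns [1/n!] into [1/(k! (n-k)!)], so the series is a Cauchy product;
    additivity of the volume factors the exponential. *)
Lemma poisson_setU z (G : SConf R d -> \bar R) : (0 <= z)%R ->
  measurable_fun [set: SConf R d] G -> (forall X, 0 <= G X) ->
  poisson z (L1 `|` L2) G = poisson z L1 (fun X => poisson z L2 (fun Y => G (X `|` Y))).
Proof.
move=> z0 mG G0.
have w0 n : (0 <= z ^+ n / (n`!)%:R)%R by exact: poisson_weight_ge0.
pose w n : \bar R := (z ^+ n / (n`!)%:R)%:E.
have wE n : 0 <= w n by rewrite lee_fin.
pose b k j := w k * (w j * a G k j).
have b0 k j : 0 <= b k j by rewrite /b !mule_ge0// a_ge0.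
transitivity ((expR (- z * fine (vol (L1 `|` L2))))%:E *
    \sum_(k <oo) \sum_(j <oo) b k j).
  congr (_ * _); rewrite -nneseries_cauchy//; apply: eq_eseriesr => n _.
  rewrite intn_setU// ge0_sume_distrr; last by move=> k _; rewrite mule_ge0 ?lee_fin// a_ge0.
  apply: eq_bigr => -[k /=]; rewrite ltnS => kn _; rewrite /b !muleA -!EFinM.
  congr (_%:E * _); rewrite -(bin_fact kn) -{1}(subnKC kn) exprD !natrM.
  have f0 m : ((m`!)%:R != 0 :> R)%R by rewrite pnatr_eq0 -lt0n fact_gt0.
  have c0 : ('C(n, k)%:R != 0 :> R)%R by rewrite pnatr_eq0 -lt0n bin_gt0.
  by field; rewrite c0 !f0.
rewrite vol_setU -(vol_fin bL1.2) -(vol_fin bL2.2) -EFinD/= mulrDr expRD EFinM -muleA.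
congr (_ * _); rewrite -nneseriesZl; last by move=> k _; rewrite nneseries_ge0.
apply: eq_eseriesr => k _.
have [q qE] := intn_measure k bL1.
have mP : measurable_fun [set: SConf R d] (fun X : SConf R d =>
    poisson z L2 (fun Y => G ((X : set (pt R d)) `|` Y))).
  apply: (measurable_poisson (H := fun X Y : SConf R d =>
    G ((X : set (pt R d)) `|` (Y : set (pt R d)))) z0 bL2) => //.
  exact: measurable_comp_setU.
rewrite (qE _ mP); last by move=> X; exact: poisson_ge0.
have minner n : measurable_fun [set: SConf R d] (fun X : SConf R d =>
    (z ^+ n / (n`!)%:R)%:E * intn L2 n (fun t => G ((X : set (pt R d)) `|` [set` t]))).
  by apply: emeasurable_funM; [exact: measurable_cst|exact: measurable_inner].
have inner0 n (X : SConf R d) : 0 <=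
    (z ^+ n / (n`!)%:R)%:E * intn L2 n (fun t => G ((X : set (pt R d)) `|` [set` t])).
  by rewrite mule_ge0 ?intn_ge0// lee_fin.
rewrite /poisson ge0_integralZl//; last 2 first.
- exact: measurable_nneseries.
- by move=> X _; exact: nneseries_ge0.
rewrite muleCA; congr (_ * _).
rewrite integral_nneseries//.
rewrite -nneseriesZl; last by move=> n _; exact: integral_ge0.
apply: eq_eseriesr => n _; rewrite ge0_integralZl//; last 3 first.
- exact: measurable_inner.
- by move=> X _; rewrite intn_ge0.
- by rewrite lee_fin.
congr (_ * (_ * _)); rewrite -qE//; first exact: measurable_inner.
by move=> X; exact: intn_ge0.
Qed.

End Split.
End PoissonTools.

(** * Upper and lower bounds for Poisson integrals *)

Section PoissonBounds.
Context (R : realType) (d : nat).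
Local Open Scope ereal_scope.
Implicit Types (Lam Q : set (pt R d)) (z : R).

Lemma intRd_indicZ Q (k : \bar R) : measurable (Q : set (Bpt R d)) -> 0 <= k ->
  intRd (fun x => (\1_Q x)%:E * k) = vol Q * k.
Proof.
move=> mQ k0; have mi := @measurable_eindic _ (Bpt R d) R Q mQ.
rewrite intRdE.
- rewrite ge0_integralZr// integral_indic// setIT; congr (_ * _).
  exact/esym/volE.
- by apply: emeasurable_funM => //; exact: measurable_cst.
- by move=> x; rewrite mule_ge0 ?lee_fin.
Qed.

Lemma intn_add Lam n (F G : SConf R d -> \bar R) : bounded_borel Lam ->
  measurable_fun [set: SConf R d] F -> (forall X, 0 <= F X) ->
  measurable_fun [set: SConf R d] G -> (forall X, 0 <= G X) ->
  intn Lam n (fun s => F [set` s] + G [set` s]) =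
  intn Lam n (fun s => F [set` s]) + intn Lam n (fun s => G [set` s]).
Proof.
move=> bL mF F0 mG G0; have [q qE] := intn_measure n bL.
rewrite (qE (fun X => F X + G X)) ?qE ?ge0_integralD//.
- exact: emeasurable_funD.
- by move=> X; rewrite adde_ge0.
Qed.

Lemma intnZl Lam n (c : \bar R) (G : SConf R d -> \bar R) : bounded_borel Lam ->
  0 <= c -> measurable_fun [set: SConf R d] G -> (forall X, 0 <= G X) ->
  intn Lam n (fun s => c * G [set` s]) = c * intn Lam n (fun s => G [set` s]).
Proof.
move=> bL c0 mG G0; have [q qE] := intn_measure n bL.
rewrite (qE (fun X => c * G X)) ?qE ?ge0_integralZl//.
- by apply: emeasurable_funM => //; exact: measurable_cst.
- by move=> X; rewrite mule_ge0.
Qed.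

Lemma measurable_intn_insert Lam n (G : SConf R d -> \bar R) : bounded_borel Lam ->
  measurable_fun [set: SConf R d] G -> (forall X, 0 <= G X) ->
  measurable_fun [set: Bpt R d]
    (fun x : Bpt R d => intn Lam n (fun s => G ((x : pt R d) |` [set` s]))).
Proof.
move=> bL mG G0; apply: (measurable_intn (H := fun (x : Bpt R d) (X : SConf R d) =>
  G ((x : pt R d) |` (X : set (pt R d)))) n bL) => //.
exact: measurable_comp_insert.
Qed.

Lemma measurable_hit_indic (B : set (pt R d)) : measurable (B : set (Bpt R d)) ->
  measurable_fun [set: SConf R d] (fun X : SConf R d => (\1_(hit B) X)%:E : \bar R).
Proof. by move=> mB; apply: measurable_eindic; exact: measurable_hit. Qed.

(** Union bound over which of the [n] points lies in [Q]: dropping that point does not decrease [G],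
    and integrating it out yields [vol Q]. In the induction either the first point is in [Q] or the
    remaining ones hit [Q]. For [n = 0] the truncated predecessor is harmless, since the factor [n]
    vanishes. *)
Lemma intn_hit Lam Q n (G : SConf R d -> \bar R) : bounded_borel Lam ->
  measurable (Q : set (Bpt R d)) ->
  measurable_fun [set: SConf R d] G -> (forall X, 0 <= G X) ->
  (forall x X, Q x -> Lam x -> X `<=` Lam -> G (x |` X) <= G X) ->
  intn Lam n (fun s => (\1_(hit Q) [set` s])%:E * G [set` s]) <=
  n%:R%:E * (vol Q * intn Lam n.-1 (fun s => G [set` s])).
Proof.
move=> bL mQ; elim: n G => [|n IH] G mG G0 Gdec.
  by rewrite mul0e /= indicE memNset ?mul0e//; move=> -[x [/=]].
have mh := measurable_hit_indic mQ.
have mGx x := measurable_comp_insert1 x mG.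
rewrite (intnS Lam n (fun X => (\1_(hit Q) X)%:E * G X)).
pose I := fun x : pt R d => intn Lam n (fun s => G (x |` [set` s])).
have I0 x : 0 <= I x by exact: intn_ge0.
have mI : measurable_fun [set: Bpt R d] I by exact: measurable_intn_insert.
pose J := fun x : pt R d => intn Lam n.-1 (fun s => G (x |` [set` s])).
have J0 x : 0 <= J x by exact: intn_ge0.
have mJ : measurable_fun [set: Bpt R d] J by exact: measurable_intn_insert.
have v0 := vol_ge0 Q.
have mL : measurable_fun [set: Bpt R d] (fun x : Bpt R d => (\1_Lam x)%:E : \bar R).
  exact: (@measurable_eindic _ (Bpt R d) R Lam bL.1).
have mQi : measurable_fun [set: Bpt R d] (fun x : Bpt R d => (\1_Q x)%:E : \bar R).
  exact: (@measurable_eindic _ (Bpt R d) R Q mQ).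
pose K := intn Lam n (fun s => G [set` s]).
have K0 : 0 <= K by exact: intn_ge0.
apply: (@le_trans _ _ (intRd (fun x => (\1_Q x)%:E * K +
    n%:R%:E * vol Q * ((\1_Lam x)%:E * J x)))).
  apply: intRd_mono => x.
    by rewrite mule_ge0 ?lee_fin// intn_ge0// => s; rewrite mule_ge0 ?lee_fin.
  rewrite [X in X%:E * _]indicE; have [xL|xL] := boolP (x \in Lam); last first.
    by rewrite mul0e adde_ge0// !mule_ge0 ?lee_fin.
  rewrite mul1e [\1_Lam x]indicE xL mul1e.
  apply: (@le_trans _ _ (intn Lam n (fun s => (\1_Q x)%:E * G (x |` [set` s]) +
      (\1_(hit Q) [set` s])%:E * G (x |` [set` s])))).
    apply: intn_mono => s; first by rewrite mule_ge0 ?lee_fin.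
    move=> _ _; rewrite -ge0_muleDl ?lee_fin//; apply: lee_wpmul2r => //.
    rewrite -EFinD lee_fin !indicE; have [|_] := boolP (_ \in hit Q); last by rewrite addr_ge0.
    rewrite inE => -[y [[/= ->|/= ys] Qy]].
      by rewrite (mem_set Qy) lerDl.
    by rewrite (_ : [set` s] \in hit Q) ?lerDr//; apply/mem_set; exists y.
  rewrite (@intn_add Lam n (fun X => (\1_Q x)%:E * G (x |` X))
      (fun X => (\1_(hit Q) X)%:E * G (x |` X)))//; first last.
  - by move=> X; rewrite mule_ge0 ?lee_fin.
  - by apply: emeasurable_funM.
  - by move=> X; rewrite mule_ge0 ?lee_fin.
  - by apply: emeasurable_funM => //; exact: measurable_cst.
  apply: leeD.
    rewrite (intnZl n (G := fun X => G (x |` X))) ?lee_fin//.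
    rewrite !indicE; have [xQ|_] := boolP (x \in Q); last by rewrite !mul0e.
    rewrite !mul1e; apply: intn_mono => // s _ sL; apply: Gdec => //; exact: set_mem.
  apply: le_trans (IH (fun X => G (x |` X)) (mGx x) (fun=> G0 _) _) _.
    move=> y X Qy Ly XL; rewrite setUCA; apply: Gdec => //.
    by move=> w [/= ->|/XL//]; exact: set_mem.
  by rewrite muleA.
rewrite intRdE; last 2 first.
- apply: emeasurable_funD; first by apply: emeasurable_funM => //; exact: measurable_cst.
  by apply: emeasurable_funM; [exact: measurable_cst|exact: emeasurable_funM].
- by move=> x; rewrite adde_ge0// !mule_ge0 ?lee_fin.
rewrite ge0_integralD//; last 4 first.
- by move=> x _; rewrite mule_ge0 ?lee_fin.
- by apply: emeasurable_funM => //; exact: measurable_cst.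
- by move=> x _; rewrite !mule_ge0 ?lee_fin.
- by apply: emeasurable_funM; [exact: measurable_cst|exact: emeasurable_funM].
rewrite ge0_integralZr ?lee_fin// ge0_integralZl//; last 3 first.
- exact: emeasurable_funM.
- by move=> x _; rewrite mule_ge0 ?lee_fin.
- by rewrite mule_ge0 ?lee_fin.
have -> : \int[@lam R d]_x (\1_Q x)%:E = vol Q.
  by rewrite integral_indic// setIT; exact/esym/volE.
rewrite -intRdE; [|exact: emeasurable_funM|by move=> x; rewrite mule_ge0 ?lee_fin].
rewrite -[n.+1]add1n natrD EFinD ge0_muleDl ?lee_fin// mul1e leeD2l//.
(* For [n = 0] the second term is zero; otherwise the integral of [J] over [Lam] is [K] with its
   first point peeled off. *)
rewrite -muleA; case: n @K @J {IH I I0 mI J0 mJ K0} => [|n] K J; first by rewrite !mul0e.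
by rewrite /K (intnS Lam n G).
Qed.

(** The factor [n] of [intn_hit] cancels against [n!] and shifts the series by one, releasing a
    factor [z]: a one-sided Mecke formula. *)
Lemma poisson_hit z Lam Q (G : SConf R d -> \bar R) : (0 <= z)%R -> bounded_borel Lam ->
  bounded_borel Q ->
  measurable_fun [set: SConf R d] G -> (forall X, 0 <= G X) ->
  (forall x X, Q x -> Lam x -> X `<=` Lam -> G (x |` X) <= G X) ->
  poisson z Lam (fun X => (\1_(hit Q) X)%:E * G X) <=
  (z * fine (vol Q))%:E * poisson z Lam G.
Proof.
move=> z0 bL [mQ bQ] mG G0 Gdec; rewrite /poisson [leRHS]muleCA.
apply: lee_wpmul2l; first by rewrite lee_fin expR_ge0.
have w0 n : (0 <= z ^+ n / (n`!)%:R)%R by exact: poisson_weight_ge0.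
rewrite nneseries_recl//=; last first.
  by move=> n _; rewrite mule_ge0 ?lee_fin// intn_ge0// => s; rewrite mule_ge0 ?lee_fin.
rewrite indicE memNset ?mul0e ?mule0 ?add0e; last by move=> -[x [/=]].
rewrite -nneseries_addn; last first.
  by move=> n; rewrite mule_ge0 ?lee_fin// intn_ge0// => s; rewrite mule_ge0 ?lee_fin.
rewrite -nneseriesZl; last by move=> n _; rewrite mule_ge0 ?lee_fin// intn_ge0.
apply: lee_nneseries => n _.
  by rewrite mule_ge0 ?lee_fin// intn_ge0// => s; rewrite mule_ge0 ?lee_fin.
rewrite addn1; apply: le_trans.
  by apply: lee_wpmul2l; [rewrite lee_fin|exact: intn_hit].
rewrite -(vol_fin bQ) le_eqVlt; apply/orP; left; apply/eqP.
rewrite !muleA -!EFinM; congr (_%:E * _).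
by rewrite factS natrM exprS; field; rewrite nat1r !pnatr_eq0 -lt0n fact_gt0.
Qed.

Lemma measurable_atleast n (B : set (pt R d)) : bounded_borel B ->
  measurable ([set X | atleast n (X `&` B)] : set (SConf R d)).
Proof.
move=> bB; apply: (@eq_measurable _ _ _
    ((fun X : SConf R d => @counting _ R (X `&` B)) @^-1` `[n%:R%:E, +oo[%classic)).
  apply/seteqP; split=> X /=; rewrite in_itv/= andbT; first by move=> ?; exact: (counting_ge R _ _).2.
  exact: (counting_ge R _ _).1.
rewrite -[X in measurable X]setTI; apply: measurable_counting => //.
exact: emeasurable_itv.
Qed.

(* Sequences of sampled points with a repetition are null; this matters because a
   configuration is the set of values of the sequence. *)
Lemma intn_repeat Lam n : (0 < d)%N -> bounded_borel Lam ->
  intn Lam n (fun s => (\1_[set X | ~ atleast n (X `&` Lam)] [set` s])%:E) = 0.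
Proof.
move=> d0 bL; have mN m : measurable
    ([set X | ~ atleast m (X `&` Lam)] : set (SConf R d)).
  exact: (measurableC (measurable_atleast m bL)).
apply/eqP; rewrite eq_le; apply/andP; split; last first.
  by apply: intn_ge0 => s; rewrite lee_fin.
elim: n => [|n IH].
  rewrite /= indicE memNset// => H; apply: H; by exists [::]; split.
rewrite (intnS Lam n (fun X => (\1_[set X | ~ atleast n.+1 (X `&` Lam)] X)%:E)).
apply: (@le_trans _ _ (intRd (fun x => (\1_Lam x)%:E * 0))); last first.
  by rewrite intRd_indicZ ?mule0//; exact: bL.1.
apply: intRd_mono => x.
  by rewrite mule_ge0 ?lee_fin// intn_ge0// => s; rewrite lee_fin.
rewrite [X in X%:E * _]indicE; have [xL|xL] := boolP (x \in Lam); last by rewrite mul0e mule0.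
rewrite mul1e mule0.
have m1 : measurable ([set x] : set (Bpt R d)).
  apply: (@eq_measurable _ _ _
     ([set y | forall i, [set x 0%R i] (y 0%R i)] : set (Bpt R d))).
    by apply/seteqP; split=> y /=; [move=> ->|move=> H; apply/rowP => i; exact: H].
  exact: (borel_coord (A := fun i => [set x 0%R i])).
apply: (@le_trans _ _ (intn Lam n (fun s => (\1_(hit [set x]) [set` s])%:E * 1 +
    (\1_[set X | ~ atleast n (X `&` Lam)] [set` s])%:E))).
  apply: intn_mono => s; first by rewrite lee_fin.
  move=> _ sL; rewrite mule1 -EFinD lee_fin !indicE.
  have [xs|xs] := boolP (x \in s).
    have -> : ([set` s] \in hit [set x]) = true by apply/mem_set; exists x.
    by apply: (@le_trans _ _ 1%R); [case: (_ \in _)|rewrite lerDl].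
  have [|_] := boolP ((x |` [set` s]) \in
      [set X : set (pt R d) | ~ atleast n.+1 (X `&` Lam)]); last by rewrite addr_ge0.
  rewrite inE /= => H.
  have -> : ([set` s] \in [set X | ~ atleast n (X `&` Lam)]) = true; last by rewrite lerDr.
  apply/mem_set => -[t [ut st tsub]].
  apply: H; exists (x :: t); split => //=; rewrite ?st// ?ut ?andbT.
    by apply/negP => /tsub[/= xs' _]; rewrite xs' in xs.
  move=> y; rewrite /= in_cons => /orP[/eqP->|/tsub[? ?]].
    by split; [left|exact: set_mem].
  by split=> //; right.
have mF : measurable_fun [set: SConf R d] (fun X : SConf R d => (\1_(hit [set x]) X)%:E * 1 : \bar R).
  by apply: emeasurable_funM; [exact: measurable_hit_indic|exact: measurable_cst].
have mG : measurable_fun [set: SConf R d] (fun X : SConf R d =>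
    (\1_[set X : set (pt R d) | ~ atleast n (X `&` Lam)] X)%:E : \bar R).
  exact: measurable_eindic.
rewrite (intn_add n bL mF _ mG)//.
rewrite -[leRHS]adde0; apply: leeD => //.
apply: le_trans (intn_hit n (G := fun=> 1) bL m1 (measurable_cst _) (fun=> lee01) _) _.
  by [].
by rewrite vol1// mul0e mule0.
Qed.

(** Restricts the [i]-th variable to the [i]-th set of [C]. It bounds the partition function below
    by placing each sphere near its site in a packing. *)
Lemma intn_cubes Lam (C : seq (set (pt R d))) (c : R) (G : seq (pt R d) -> \bar R) :
  (0 <= c)%R -> (forall s, 0 <= G s) ->
  (forall i, (i < size C)%N -> measurable (nth set0 C i : set (Bpt R d)) /\
    nth set0 C i `<=` Lam) ->
  (forall s, size s = size C ->
     (forall i, (i < size C)%N -> nth set0 C i (nth 0%R s i)) -> c%:E <= G s) ->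
  c%:E * \prod_(A <- C) vol A <= intn Lam (size C) G.
Proof.
move=> c0; elim: C G => [|A C IH] G G0 HC HG /=.
  by rewrite big_nil mule1; exact: HG.
have [mA AL] := HC 0%N isT.
have p0 : 0 <= c%:E * \prod_(A <- C) vol A.
  rewrite mule_ge0 ?lee_fin//; elim: (C) => [|B D]; first by rewrite big_nil.
  by rewrite big_cons => H; rewrite mule_ge0// vol_ge0.
rewrite big_cons muleCA -intRd_indicZ//.
apply: intRd_mono => x; first by rewrite mule_ge0 ?lee_fin.
rewrite [\1_A x]indicE; have [xA|_] := boolP (x \in A); last first.
  by rewrite mul0e mule_ge0 ?lee_fin// intn_ge0.
rewrite indicE (_ : x \in Lam) ?mul1e; last exact/mem_set/AL/set_mem.
apply: IH => //; first by move=> i iC; exact: HC i.+1 iC.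
move=> s ss Hs; apply: HG => /=; first by rewrite ss.
by case=> [_|i iC]; [exact: set_mem|exact: Hs].
Qed.

End PoissonBounds.

(** * Hard-core weight and energy *)

Section Energy.
Context (R : realType) (d : nat) (rs rp : R).
Local Open Scope ereal_scope.
Implicit Types (Lam : set (pt R d)) (X : sconf R d).

Notation Bunion := (@Bunion R d rs rp).
Notation rhat := (rhat rs rp).

Lemma Bunion_open X : open (Bunion X).
Proof. by apply: bigcup_open => p _; exact: open_eball. Qed.

Lemma Bunion_borel X : measurable (Bunion X : set (Bpt R d)).
Proof. by apply: borel_open; exact: Bunion_open. Qed.

Lemma Bunion_sub X Y : X `<=` Y -> Bunion X `<=` Bunion Y.
Proof. by move=> XY x [p /XY Yp px]; exists p. Qed.

Lemma Bunion_setU X Y : Bunion (X `|` Y) = Bunion X `|` Bunion Y.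
Proof. by rewrite /Bunion bigcup_setU. Qed.

Lemma Bunion_bounded X : ebounded X -> ebounded (Bunion X).
Proof.
move=> [M HM]; exists (M + rhat)%R => x [p /HM pM px].
rewrite (le_trans (edist_triangle _ p _))// lerD// ltW//.
Qed.

(* The balls covering [x] are detected on a fine grid: [x] and the centre may be
   replaced by grid cubes all of whose points are at distance less than [rhat]. *)
Lemma measurable_Bunion_mem (A : set (pt R d)) : measurable (A : set (Bpt R d)) ->
  measurable ([set q : Bpt R d * SConf R d |
    Bunion ((q.2 : set (pt R d)) `&` A) q.1] : set (Bpt R d * SConf R d)).
Proof.
move=> mA.
pose near_cubes k (c c' : 'rV[int]_d) := forall p y : pt R d,
  cube k c p -> cube k c' y -> (edist p y < rhat)%R.
apply: (@eq_measurable _ _ _ (\bigcup_k \bigcup_(c : 'rV[int]_d) \bigcup_(c' : 'rV[int]_d)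
  if `[< near_cubes k c c' >] then
    (cube k c' : set (Bpt R d)) `*` (hit (A `&` cube k c) : set (SConf R d)) else set0)).
  apply/seteqP; split=> -[x X] /=; last first.
    move=> [k _ [c _ [c' _]]]; case: ifP => // /asboolP H [/= xc' [p [Xp [Ap pc]]]].
    by exists p => //; exact: H pc xc'.
  move=> [p [Xp Ap] px]; have e0 : (0 < (rhat - edist p x) / 2)%R.
    by rewrite divr_gt0// subr_gt0.
  have [k _ /(_ _ (leqnn k)) Hk] := near_cube_edist d e0.
  exists k => //; exists (cubeidx k p) => //; exists (cubeidx k x) => //.
  rewrite ifT; last first.
    apply/asboolP => p' y pp' xy.
    have H1 := Hk (cubeidx k p) p' p pp' erefl.
    have H2 := Hk (cubeidx k x) x y erefl xy.
    have H3 := edist_triangle p' p y; have H4 := edist_triangle p x y.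
    by lra.
  by split=> //=; exists p.
apply: bigcupT_measurable => k.
do 2 (apply: countable_bigcupT_measurable => // ?).
case: ifP => // _; apply: measurableX; first exact: borel_cube.
by apply: measurable_hit; apply: (@measurableI _ (Bpt R d)) => //; exact: borel_cube.
Qed.

Lemma measurable_vol_section (D : set (Bpt R d * SConf R d)) : measurable D ->
  measurable_fun [set: SConf R d] (fun X : SConf R d => vol [set x : pt R d | D (x, X)]).
Proof.
move=> mD.
have mf : measurable_fun [set: Bpt R d * SConf R d] (fun q => (\1_D q)%:E : \bar R).
  exact: measurable_eindic.
have f0 (q : Bpt R d * SConf R d) : 0 <= (\1_D q)%:E :> \bar R by rewrite lee_fin.
rewrite (_ : (fun X => _) = (fun X : SConf R d => \int[@lam R d]_x (\1_D (x, X))%:E)).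
  exact: (measurable_fun_fubini_tonelli_G (m1 := @lam R d) _ mf f0).
apply/funext => X; rewrite /vol intRdE//.
exact: (measurableT_comp mf (@pair2_measurable _ _ (Bpt R d) (SConf R d) X)).
Qed.

Lemma measurable_energy Lam : measurable (Lam : set (Bpt R d)) ->
  measurable_fun [set: SConf R d] (fun X : SConf R d => energy rs rp Lam X).
Proof.
move=> mL; apply: (@measurable_vol_section ([set q : Bpt R d * SConf R d |
    Bunion ((q.2 : set (pt R d)) `&` Lam) q.1] `\` [set q : Bpt R d * SConf R d |
    Bunion ((q.2 : set (pt R d)) `&` ~` Lam) q.1])).
apply: measurableD; apply: measurable_Bunion_mem => //.
exact: (@measurableC _ (Bpt R d)).
Qed.

Lemma measurable_vol_Bunion (D : set (pt R d)) : measurable (D : set (Bpt R d)) ->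
  measurable_fun [set: SConf R d] (fun X : SConf R d => vol (D `&` Bunion X)).
Proof.
move=> mD; rewrite (_ : (fun X => _) = (fun X : SConf R d =>
   vol [set x : pt R d | ((D : set (Bpt R d)) `*` [set: SConf R d] `&`
     [set q : Bpt R d * SConf R d | Bunion ((q.2 : set (pt R d)) `&` setT) q.1]) (x, X)])).
  apply: measurable_vol_section; apply: measurableI; first exact: measurableX.
  by apply: measurable_Bunion_mem; exact: (@measurableT _ (Bpt R d)).
apply/funext => X; congr vol; apply/seteqP.
by split=> x /=; rewrite setIT; [move=> [? ?]|move=> [[? _] ?]].
Qed.

Lemma energy_ge0 Lam X : 0 <= energy rs rp Lam X.
Proof. exact: vol_ge0. Qed.

Lemma energy_fin Lam X : ebounded Lam -> (fine (energy rs rp Lam X))%:E = energy rs rp Lam X.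
Proof.
move=> bL; apply: vol_fin; apply: (@ebounded_sub _ _ _ (Bunion Lam)).
  by move=> x [+ _]; apply: Bunion_sub => y [].
exact: Bunion_bounded.
Qed.

Definition sallowed (X : set (pt R d)) :=
  forall p q, X p -> X q -> p <> q -> (2 * rs <= edist p q)%R.

Lemma sallowed_sub X Y : X `<=` Y -> sallowed Y -> sallowed X.
Proof. by move=> XY aY p q /XY Yp /XY Yq; exact: aY. Qed.

Lemma allowed_mark X : allowed rs rp (mark true X) <-> sallowed X.
Proof.
split=> [[H _] p q Xp Xq|H]; first by apply: H.
by split=> [p q [/= Xp _] [/= Xq _]|p q _ [_ /=]//]; exact: H.
Qed.

Lemma ind_allowed_mark X : ind_allowed rs rp (mark true X) = (\1_sallowed X)%:E.
Proof.
rewrite /ind_allowed !indicE; have [aX|aX] := pselect (sallowed X).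
  by rewrite !mem_set//; exact/allowed_mark.
by rewrite !memNset// => /allowed_mark.
Qed.

(** A violation is visible on a fine grid: two distinct cubes are hit, and any point of one is
    closer than [2 * rs] to any point of the other. Distinctness of the cubes guarantees that two
    different centres are involved. *)
Lemma measurable_sallowed : measurable (sallowed : set (SConf R d)).
Proof.
pose close_cubes k (c c' : 'rV[int]_d) := c <> c' /\ forall p q : pt R d,
  cube k c p -> cube k c' q -> (edist p q < 2 * rs)%R.
apply: (@eq_measurable _ _ _ (~` (\bigcup_k \bigcup_(c : 'rV[int]_d) \bigcup_(c' : 'rV[int]_d)
  if `[< close_cubes k c c' >] then
    (hit (cube k c) `&` hit (cube k c') : set (SConf R d)) else set0))); last first.
  apply: measurableC; apply: bigcupT_measurable => k.
  do 2 (apply: countable_bigcupT_measurable => // ?).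
  by case: ifP => // _; apply: measurableI; apply: measurable_hit; exact: borel_cube.
apply/seteqP; split=> X /=.
  move=> aX [k _ [c _ [c' _]]]; case: ifP => // /asboolP[cc' H].
  move=> [[p [Xp pc]] [q [Xq qc']]].
  have pq : p <> q by move=> pq; apply: cc'; rewrite -pc -qc' pq.
  by have := aX p q Xp Xq pq; rewrite leNgt (H _ _ pc qc').
move=> H p q Xp Xq pq; rewrite leNgt; apply/negP => pqr; apply: H.
have e0 : (0 < (2 * rs - edist p q) / 2)%R by rewrite divr_gt0// subr_gt0.
have [k [Hk Hpq]] : exists k, (forall (c : 'rV[int]_d) (x y : pt R d),
    cube k c x -> cube k c y -> (edist x y < (2 * rs - edist p q) / 2)%R) /\
    cubeidx k p <> cubeidx k q.
  have [k1 _ Hk1] := near_cube_edist d e0; have [k2 _ Hk2] := near_cubeidx_neq pq.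
  by exists (maxn k1 k2); split; [exact: Hk1 (leq_maxl _ _)|exact: Hk2 (leq_maxr _ _)].
exists k => //; exists (cubeidx k p) => //; exists (cubeidx k q) => //.
rewrite ifT; first by split; [exists p|exists q].
apply/asboolP; split=> // p' q' pp' qq'.
have H1 := Hk (cubeidx k p) p' p pp' erefl.
have H2 := Hk (cubeidx k q) q q' erefl qq'.
have H3 := edist_triangle p' p q'; have H4 := edist_triangle p q q'.
by lra.
Qed.

Definition weight (zp : R) Lam X : \bar R :=
  expeR (- (zp%:E * energy rs rp Lam X)) * (\1_sallowed X)%:E.

Lemma weightE zp Lam X : ebounded Lam -> weight zp Lam X =
  (expR (- (zp * fine (energy rs rp Lam X))))%:E * (\1_sallowed X)%:E.
Proof. by move=> bL; rewrite /weight -energy_fin. Qed.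

Lemma weight_ge0 zp Lam X : 0 <= weight zp Lam X.
Proof. by rewrite mule_ge0 ?expeR_ge0// lee_fin. Qed.

Lemma weight_le1 zp Lam X : (0 <= zp)%R -> ebounded Lam -> weight zp Lam X <= 1.
Proof.
move=> zp0 bL; rewrite weightE// -EFinM lee_fin.
rewrite -[leRHS]mulr1 ler_pM ?expR_ge0//.
by rewrite -expR0 ler_expR oppr_le0 mulr_ge0// fine_ge0// energy_ge0.
Qed.

Lemma measurable_weight zp Lam : bounded_borel Lam ->
  measurable_fun [set: SConf R d] (fun X : SConf R d => weight zp Lam X).
Proof.
move=> [mL bL]; rewrite (_ : weight zp Lam = (fun X : SConf R d =>
    (expR (- (zp * fine (energy rs rp Lam X))))%:E * (\1_sallowed X)%:E)); last first.
  by apply/funext => X; exact: weightE.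
apply: emeasurable_funM.
  apply: measurableT_comp => //; apply: measurableT_comp => //.
  apply: measurableT_comp => //; apply: measurable_funM => //.
  exact: (measurableT_comp (fine_measurable measurableT) (measurable_energy mL)).
by apply: measurable_eindic; exact: measurable_sallowed.
Qed.

Lemma ZsphE zs zp Lam (Y : sconf R d) : Zsph rs rp zs zp Lam Y =
  poisson zs Lam (fun X => weight zp Lam (X `|` restrS Y (~` Lam))).
Proof.
rewrite /Zsph; congr poisson; apply/funext => X.
by rewrite ind_allowed_mark setUC.
Qed.

End Energy.

(** * The sphere marginal *)

Section Marginal.
Context (R : realType) (d : nat) (rs rp : R).
Local Open Scope ereal_scope.
Implicit Types (Lam : set (pt R d)) (z : R).

Notation Bunion := (@Bunion R d rs rp).
Notation rhat := (rhat rs rp).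

Lemma measurable_comp_setU2 (G : SConf R d -> \bar R) (X : set (pt R d)) :
  measurable_fun [set: SConf R d] G ->
  measurable_fun [set: SConf R d] (fun Y : SConf R d => G ((Y : set (pt R d)) `|` X)).
Proof.
move=> mG; rewrite (_ : (fun Y => _) =
    (fun Y : SConf R d => G (X `|` (Y : set (pt R d))))).
  exact: measurable_comp_setU1.
by apply/funext => Y; rewrite setUC.
Qed.

Lemma measurable_not_hit (B : set (pt R d)) : measurable (B : set (Bpt R d)) ->
  measurable ([set X | ~ hit B X] : set (SConf R d)).
Proof. by move=> mB; exact: (measurableC (measurable_hit mB)). Qed.

Lemma bounded_borelD Lam (B : set (pt R d)) : bounded_borel Lam ->
  measurable (B : set (Bpt R d)) -> bounded_borel (Lam `\` B).
Proof.
move=> [mL bL] mB; split; first exact: (@measurableD _ (Bpt R d)).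
by apply: ebounded_sub bL => x [].
Qed.

Lemma bounded_borelI Lam (B : set (pt R d)) : bounded_borel Lam ->
  measurable (B : set (Bpt R d)) -> bounded_borel (Lam `&` B).
Proof.
move=> [mL bL] mB; split; first exact: (@measurableI _ (Bpt R d)).
by apply: ebounded_sub bL => x [].
Qed.

Lemma intn_avoid Lam (B : set (pt R d)) n : bounded_borel Lam ->
  measurable (B : set (Bpt R d)) ->
  intn Lam n (fun s => (\1_[set X | ~ hit B X] [set` s])%:E) =
  (fine (vol (Lam `\` B)) ^+ n)%:E.
Proof.
move=> bL mB; have bLB := bounded_borelD bL mB.
elim: n => [|n IH].
  by rewrite /= indicE mem_set ?expr0// => -[x [/=]].
rewrite (intnS Lam n (fun X => (\1_[set X | ~ hit B X] X)%:E)).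
rewrite (_ : (fun x => _) = (fun x =>
  (\1_(Lam `\` B) x)%:E * (fine (vol (Lam `\` B)) ^+ n)%:E)).
  rewrite intRd_indicZ; first by rewrite exprS EFinM vol_fin//; exact: bLB.2.
    exact: bLB.1.
  by rewrite lee_fin exprn_ge0// fine_ge0// vol_ge0.
apply/funext => x; rewrite !indicE in_setD.
have [xL|xL] := boolP (x \in Lam); last by rewrite !mul0e.
have [xB|xB] /= := boolP (x \in B).
  rewrite mul0e mul1e; apply/eqP; rewrite eq_le; apply/andP; split; last first.
    by apply: intn_ge0 => s; rewrite lee_fin.
  apply: (@le_trans _ _ (intn Lam n (fun s => 0 * (\1_[set X | ~ hit B X] [set` s])%:E))).
    apply: intn_mono => s; first by rewrite lee_fin.
    move=> _ _; rewrite mul0e indicE memNset//= => H; apply: H.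
    by exists x; split; [left|exact: set_mem].
  rewrite (intnZl n (G := fun X => (\1_[set X | ~ hit B X] X)%:E))//.
  - by rewrite mul0e.
  - by apply: measurable_eindic; exact: measurable_not_hit.
rewrite !mul1e -IH; congr intn; apply/funext => s; rewrite !indicE.
have [H|H] := pselect (hit B [set` s]).
  by rewrite !memNset//= => nH; apply: nH => //; case: H => y [ys By]; exists y; split; [right|].
rewrite !mem_set//= => -[y [[/= ->|ys] By]]; first by move: xB; rewrite (mem_set By).
by apply: H; exists y.
Qed.

(** Void probability of the Poisson process. With [B] the union of the balls around the spheres,
    this is where the volume in the energy comes from. *)
Lemma poisson_avoid z Lam (B : set (pt R d)) : bounded_borel Lam ->
  measurable (B : set (Bpt R d)) ->
  poisson z Lam (fun X => (\1_[set X | ~ hit B X] X)%:E) =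
  (expR (- (z * fine (vol (Lam `&` B)))))%:E.
Proof.
move=> bL mB; rewrite /poisson.
under eq_eseriesr do rewrite intn_avoid// -EFinM mulrAC -exprMn.
rewrite exp_nneseries -EFinM -expRD.
have bI := bounded_borelI bL mB; have bD := bounded_borelD bL mB.
have -> : fine (vol Lam) = (fine (vol (Lam `&` B)) + fine (vol (Lam `\` B)))%R.
  have <- : vol (Lam `&` B) + vol (Lam `\` B) = vol Lam.
    rewrite -vol_setU//; last by rewrite setIACA setICr setI0.
    by rewrite -setIUr setUv setIT.
  by rewrite -(vol_fin bI.2) -(vol_fin bD.2).
by congr (expR _)%:E; ring.
Qed.

Definition particles (y : mconf R d) (D : set (pt R d)) : set (pt R d) :=
  [set q | y (q, false) /\ D q].

(** Separates the constraints by what they involve: spheres alone, spheres against the fixed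
    particles, spheres against the new particles. Only the last one mentions [P], and it is a void
    event. Symmetry of the distance lets [Bunion] be taken around particles as well. *)
Lemma allowed_mix (y : mconf R d) (D X P : set (pt R d)) :
  allowed rs rp (restrM y D `|` mark true X `|` mark false P) <->
  [/\ sallowed rs (restrS (spheres y) D `|` X),
      ~ hit (Bunion (particles y D)) (restrS (spheres y) D `|` X) &
      ~ hit (Bunion (restrS (spheres y) D `|` X)) P].
Proof.
have sph p : (restrM y D `|` mark true X `|` mark false P) (p, true) <->
    (restrS (spheres y) D `|` X) p.
  split; first by move=> [[[yp [/= Dp _]]|[/= Xp _]]|[/= _ ]//]; [left|right].
  by move=> [[yp Dp]|Xp]; left; [left|right].
have par p : (restrM y D `|` mark true X `|` mark false P) (p, false) <->
    (particles y D `|` P) p.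
  split; first by move=> [[[yp [/= Dp _]]|[/= _ ]//]|[/= Pp _]]; [left|right].
  by move=> [[yp Dp]|Pp]; [left; left|right].
split.
  move=> [H1 H2]; split.
  - by move=> p q /sph Up /sph Uq; exact: H1.
  - move=> [p [/sph Up [q qP pq]]].
    have /par Hq : (particles y D `|` P) q by left.
    by have := H2 _ _ Up Hq; rewrite leNgt edistC pq.
  - move=> [q [qP [p /sph Up pq]]].
    have /par Hq : (particles y D `|` P) q by right.
    by have := H2 _ _ Up Hq; rewrite leNgt pq.
move=> [H1 H2 H3]; split=> p q; first by move=> /sph Up /sph Uq; exact: H1.
move=> /sph Up /par [qP|qP]; rewrite leNgt; apply/negP => pq.
  by apply: H2; exists p; split=> //; exists q => //; rewrite /eball/= edistC.
by apply: H3; exists q; split=> //; exists p.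
Qed.

Lemma spheres_mix (y : mconf R d) (D X P : set (pt R d)) :
  spheres (restrM y D `|` mark true X `|` mark false P) = restrS (spheres y) D `|` X.
Proof.
apply/seteqP; split=> p /=.
  by move=> [[[yp [/= Dp _]]|[/= Xp _]]|[/= _ ]//]; [left|right].
by move=> [[yp Dp]|Xp]; left; [left|right].
Qed.

(* Weight of the spheres once the particles of [Del] have been integrated out, the
   particles of [P] outside [Del] being kept. *)
Definition dressed zp (Del P X : set (pt R d)) : \bar R :=
  (\1_(sallowed rs `&` [set X | ~ hit (Bunion P) X]) X)%:E *
  (expR (- (zp * fine (vol (Del `&` Bunion X)))))%:E.

Lemma dressed_ge0 zp Del P X : 0 <= dressed zp Del P X.
Proof. by rewrite mule_ge0 ?lee_fin ?expR_ge0. Qed.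

Lemma measurable_dressed zp (Del P : set (pt R d)) : bounded_borel Del ->
  measurable_fun [set: SConf R d] (fun X : SConf R d => dressed zp Del P X).
Proof.
move=> [mD bD]; apply: emeasurable_funM.
  apply: measurable_eindic; apply: measurableI; first exact: measurable_sallowed.
  by apply: measurable_not_hit; exact: Bunion_borel.
apply: measurableT_comp => //; apply: measurableT_comp => //.
apply: measurableT_comp => //; apply: measurable_funM => //.
exact: (measurableT_comp (fine_measurable measurableT) (measurable_vol_Bunion rs rp mD)).
Qed.

Lemma poisson_particles zp (Del : set (pt R d)) (y : mconf R d) (X : set (pt R d))
    (Phi : sconf R d -> \bar R) : (0 <= zp)%R -> bounded_borel Del ->
  (forall Y, 0 <= Phi Y) ->
  let U := restrS (spheres y) (~` Del) `|` X in
  poisson zp Del (fun P =>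
    let c := restrM y (~` Del) `|` mark true X `|` mark false P in
    Phi (spheres c) * ind_allowed rs rp c) =
  Phi U * dressed zp Del (particles y (~` Del)) U.
Proof.
move=> zp0 bD Phi0 U; have mU := Bunion_borel rs rp U.
rewrite /dressed -(poisson_avoid zp bD mU).
have mh : measurable_fun [set: SConf R d]
    (fun P : SConf R d => (\1_[set P | ~ hit (Bunion U) P] P)%:E : \bar R).
  by apply: measurable_eindic; exact: measurable_not_hit.
rewrite muleA -poissonZl//; last by rewrite mule_ge0// lee_fin.
congr poisson; apply/funext => P /=; rewrite spheres_mix -/U -muleA; congr (_ * _).
rewrite /ind_allowed !indicE -EFinM -natrM mulnb; congr ((nat_of_bool _)%:R%:E).
apply/idP/idP.
  by move=> /set_mem/allowed_mix[H1 H2 H3]; apply/andP; split; apply/mem_set.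
by move=> /andP[/set_mem[H1 H2] /set_mem H3]; apply/mem_set/allowed_mix; split.
Qed.

(* Spheres in [Lam], whose balls lie in [Del], shift the covered volume of [Del] by
   exactly the energy. *)
Lemma dressed_split zp Lam (Del P V S : set (pt R d)) : bounded_borel Lam ->
  bounded_borel Del -> (forall x, Lam x -> eball x rhat `<=` Del) ->
  Bunion P `&` Lam = set0 -> V `&` Lam = set0 -> S `<=` Lam ->
  dressed zp Del P (V `|` S) = dressed zp Del P V * weight rs rp zp Lam (S `|` V).
Proof.
move=> bL bD LD PL VL SL; rewrite weightE ?bL.2//; last exact: bL.2.
have E1 : restrS (S `|` V) Lam = S.
  apply/seteqP; split=> x; last by move=> Sx; split; [left|exact: SL].
  by move=> [[//|Vx] Lx]; have : (V `&` Lam) x by []; rewrite VL.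
have E2 : restrS (S `|` V) (~` Lam) = V.
  apply/seteqP; split=> x; first by move=> [[Sx|//] nL]; case: nL; exact: SL.
  by move=> Vx; split; [right|move=> Lx; have : (V `&` Lam) x by []; rewrite VL].
rewrite /energy E1 E2 /dressed.
have mS := Bunion_borel rs rp S; have mV := Bunion_borel rs rp V.
have BS : Bunion S `<=` Del by move=> x [p /SL/LD]; exact.
have bA := bounded_borelI bD mV.
have bS : bounded_borel (Bunion S).
  by split; [exact: mS|exact: ebounded_sub bD.2].
have bB := bounded_borelD bS mV.
have -> : fine (vol (Del `&` Bunion (V `|` S))) =
    (fine (vol (Del `&` Bunion V)) + fine (vol (Bunion S `\` Bunion V)))%R.
  have -> : Del `&` Bunion (V `|` S) = (Del `&` Bunion V) `|` (Bunion S `\` Bunion V).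
    rewrite Bunion_setU; apply/seteqP; split=> x.
      move=> [Dx [Vx|Sx]]; first by left.
      by have [Vx|Vx] := pselect (Bunion V x); [left|right].
    by move=> [[Dx Vx]|[Sx _]]; split=> //; [left|exact: BS|right].
  rewrite vol_setU//; last first.
    by apply/seteqP; split=> // x [[_ ?] []].
  by rewrite -(vol_fin bA.2) -(vol_fin bB.2).
rewrite mulrDr opprD expRD -!EFinM; congr EFin.
set A := sallowed rs `&` _.
suff -> : (\1_A (V `|` S) = \1_A V * \1_(sallowed rs) (S `|` V) :> R)%R by ring.
rewrite !indicE -natrM mulnb; congr ((nat_of_bool _)%:R); rewrite [in RHS]setUC.
apply/idP/idP.
  move=> /set_mem[aU nU]; apply/andP; split; apply/mem_set => //; split.
    by apply: sallowed_sub aU => x; left.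
  by move=> [x [Vx Px]]; apply: nU; exists x; split=> //; left.
move=> /andP[/set_mem[aV nV] /set_mem aU]; apply/mem_set; split=> // -[x [[Vx|Sx] Px]].
  by apply: nV; exists x.
by have : (Bunion P `&` Lam) x by [split=> //; exact: SL]; rewrite PL.
Qed.

Section Kernel.
Variables (zs zp : R) (mu : probability (MConf R d) R).
Hypotheses (zs0 : (0 < zs)%R) (zp0 : (0 < zp)%R).

Lemma measurable_spheres :
  measurable_fun [set: MConf R d] (fun y : MConf R d => spheres y : SConf R d).
Proof.
apply: (@measurability _ _ (MConf R d) (SConf R d) setT _ (@genS R d)) => //.
move=> _ [_ [B [n [bB ->]]] <-]; rewrite setTI.
apply: sub_sigma_algebra; exists B, true, n; split=> //; apply/seteqP.
have E (x : mconf R d) m :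
    atleast m (x `&` (B `*` [set true])) <-> atleast m (spheres x `&` B).
  split=> -[s [us ss sx]].
    exists (map fst s); split; last 2 first.
    - by rewrite size_map.
    - by move=> p /= /mapP[[q b] /sx[/= xq [/= Bq bt]] ->]; rewrite bt in xq; split.
    by rewrite map_inj_in_uniq// => -[q b] [q' b'] /sx[_ [_ /= ->]] /sx[_ [_ /= ->]] /= ->.
  exists (map (fun p => (p, true)) s); split; last 2 first.
  - by rewrite size_map.
  - by move=> p /= /mapP[q /sx[/= xq Bq] ->].
  by rewrite map_inj_uniq// => q q' [].
split=> x /=.
  by move=> /counting_eqP[/E H1 H2]; apply/counting_eqP; split=> // /E.
by move=> /counting_eqP[/E H1 H2]; apply/counting_eqP; split=> // /E.
Qed.

(** Sphere observables that the [Lam]-kernel with the energy weight cannot tell apart have the same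
    expectation under [mu]. Stated as a congruence, it leaves the unknown factor [Zmix] on both
    sides, where it is never evaluated. *)
Lemma gibbsM_congr Lam (F1 F2 : SConf R d -> \bar R) : bounded_borel Lam ->
  gibbsM rs rp zs zp mu ->
  measurable_fun [set: SConf R d] F1 -> (forall X, 0 <= F1 X) ->
  measurable_fun [set: SConf R d] F2 -> (forall X, 0 <= F2 X) ->
  (forall V, V `&` Lam = set0 -> sallowed rs V ->
    poisson zs Lam (fun S => F1 (S `|` V) * weight rs rp zp Lam (S `|` V)) =
    poisson zs Lam (fun S => F2 (S `|` V) * weight rs rp zp Lam (S `|` V))) ->
  \int[mu]_y F1 (spheres y) = \int[mu]_y F2 (spheres y).
Proof.
move=> bL [_ dlr] mF1 F10 mF2 F20 E.
(* The box must contain [Lam] and every ball of radius [rhat] centred in it. *)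
have [n Hn] : exists n, Lam `<=` @box R d n /\ forall x, Lam x -> eball x rhat `<=` box n.
  have bU : ebounded (Lam `|` Bunion Lam).
    have [[_ [M1 H1]] [M2 H2]] := (bL, Bunion_bounded rs rp bL.2).
    by exists (Num.max M1 M2) => x [/H1|/H2] xM; rewrite le_max xM ?orbT.
  have [n Hn] := ebounded_box bU; exists n; split; first by move=> x Lx; apply: Hn; left.
  by move=> x Lx y xy; apply: Hn; right; exists x.
pose Del := @box R d n; have [LD BD] := Hn.
have bD : bounded_borel Del by split; [exact: borel_box|exact: box_bounded].
have bDL : bounded_borel (Del `\` Lam) by apply: bounded_borelD => //; exact: bL.1.
have Fdlr (F : SConf R d -> \bar R) : measurable_fun [set: SConf R d] F ->
    (forall X, 0 <= F X) -> \int[mu]_y F (spheres y) =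
    \int[mu]_y (((fine (Zmix rs rp zs zp Del y))^-1)%:E *
      poisson zs Del (fun X => F (restrS (spheres y) (~` Del) `|` X) *
        dressed zp Del (particles y (~` Del)) (restrS (spheres y) (~` Del) `|` X))).
  move=> mF F0; rewrite (dlr Del (fun y => F (spheres y)) bD).
  - apply: eq_integral => y _; congr (_ * poisson _ _ _); apply/funext => X.
    exact: (poisson_particles y X (ltW zp0) bD F0).
  - exact: (measurableT_comp mF measurable_spheres).
  - by move=> y; exact: F0.
rewrite (Fdlr F1 mF1 F10) (Fdlr F2 mF2 F20); apply: eq_integral => y _; congr (_ * _).
pose V0 := restrS (spheres y) (~` Del); pose P := particles y (~` Del).
rewrite -/V0 -/P.
(* The particles left outside [Del] are too far away to constrain spheres centred in [Lam]. *)
have PL : Bunion P `&` Lam = set0.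
  apply/seteqP; split=> // x [[q [_ nDq] qx] Lx]; apply: nDq; apply: (BD x Lx).
  by rewrite /eball/= edistC.
have split_poisson (F : SConf R d -> \bar R) : measurable_fun [set: SConf R d] F ->
    (forall X, 0 <= F X) ->
    poisson zs Del (fun X => F (V0 `|` X) * dressed zp Del P (V0 `|` X)) =
    poisson zs (Del `\` Lam) (fun T => dressed zp Del P (V0 `|` T) *
      poisson zs Lam (fun S => F (S `|` (V0 `|` T)) *
                               weight rs rp zp Lam (S `|` (V0 `|` T)))).
  move=> mF F0; have DE : Del = (Del `\` Lam) `|` Lam.
    apply/seteqP; split=> x; last by move=> [[]//|/LD].
    by move=> Dx; have [Lx|Lx] := pselect (Lam x); [right|left].
  have mFw : measurable_fun [set: SConf R d]
      (fun X : SConf R d => F X * weight rs rp zp Lam X).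
    by apply: emeasurable_funM => //; exact: measurable_weight.
  have Fw0 X : 0 <= F X * weight rs rp zp Lam X by rewrite mule_ge0// weight_ge0.
  rewrite {1}DE poisson_setU ?(ltW zs0)//; last 3 first.
  - by rewrite setDE -setIA setICl setI0.
  - apply: (measurable_comp_setU1 V0 (G := fun X => F X * dressed zp Del P X)).
    by apply: emeasurable_funM => //; exact: measurable_dressed.
  - by move=> X; rewrite mule_ge0// dressed_ge0.
  apply: eq_poisson; first exact: ltW.
  - by move=> T; apply: poisson_ge0; [exact: ltW|move=> X; rewrite mule_ge0// dressed_ge0].
  - by move=> T; rewrite mule_ge0 ?dressed_ge0// poisson_ge0// ltW.
  move=> T _ TD; rewrite -poissonZl ?(ltW zs0) ?dressed_ge0//; last first.
    exact: (measurable_comp_setU2 (V0 `|` T) mFw).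
  apply: eq_poisson; first exact: ltW.
  - by move=> S; rewrite mule_ge0// dressed_ge0.
  - by move=> S; rewrite mule_ge0 ?dressed_ge0.
  move=> S _ SL; rewrite setUA (dressed_split _ bL bD BD PL _ SL).
    by rewrite muleCA (setUC _ S).
  apply/seteqP; split=> // x [[[_ nDx]|/TD[_ nLx]] Lx]; last exact: nLx.
  by apply: nDx; exact: LD.
have I0 (F : SConf R d -> \bar R) T : (forall X, 0 <= F X) ->
    0 <= dressed zp Del P (V0 `|` T) *
      poisson zs Lam (fun S => F (S `|` (V0 `|` T)) *
                               weight rs rp zp Lam (S `|` (V0 `|` T))).
  move=> F0; rewrite mule_ge0 ?dressed_ge0//; apply: poisson_ge0; first exact: ltW.
  by move=> S; rewrite mule_ge0 ?weight_ge0.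
rewrite (split_poisson F1 mF1 F10) (split_poisson F2 mF2 F20).
apply: eq_poisson; [exact: ltW|by move=> T; exact: I0|by move=> T; exact: I0|].
(* If the spheres outside [Lam] already overlap, [dressed] vanishes; this is why the hypothesis on
   [F1] and [F2] can be restricted to allowed [V]. *)
move=> T _ TD; have [aV|naV] := pselect (sallowed rs (V0 `|` T)); last first.
  by rewrite /dressed indicE memNset ?mul0e// => -[].
congr (_ * _); apply: E => //.
apply/seteqP; split=> // x [[[_ nDx]|/TD[_ nLx]] Lx]; last exact: nLx.
by apply: nDx; exact: LD.
Qed.

End Kernel.

End Marginal.

(** * The Gibbs equation for the sphere marginal *)

Section MarginalGibbs.
Context (R : realType) (d : nat) (rs rp zs zp : R).
Hypotheses (zs0 : (0 < zs)%R) (zp0 : (0 < zp)%R).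
Local Open Scope ereal_scope.
Implicit Types (Lam : set (pt R d)).

(** Reduced to the measurable power function with exponent [-1], with a change of sign for negative
    arguments; at [0] both conventions give [0]. *)
Lemma measurable_inv : measurable_fun [set: R] (fun x : R => x^-1)%R.
Proof.
rewrite (_ : (fun x => _) = (fun x : R => if x < 0 then - ((- x) `^ (-1)) else x `^ (-1))%R).
  apply: measurable_fun_if => //; first exact: measurable_fun_ltr.
    apply: measurable_funTS; apply: measurableT_comp => //.
    by apply: (measurableT_comp (measurable_powR (-1))).
  by apply: measurable_funTS; exact: measurable_powR.
apply/funext => x; case: ltP => x0; last by rewrite powR_inv1.
by rewrite powR_inv1 ?oppr_ge0 ?(ltW x0)// invrN opprK.
Qed.

Lemma measurable_restrS (A : set (pt R d)) : measurable (A : set (Bpt R d)) ->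
  measurable_fun [set: SConf R d] (fun X : SConf R d => restrS X A : SConf R d).
Proof.
move=> mA; apply: measurable_to_SConf => B bB.
apply: (@eq_measurable _ _ _ (hit (A `&` B) : set (SConf R d))).
  by apply/seteqP; split=> X [x]; rewrite /restrS => Xx; exists x; move: Xx => /=; tauto.
apply: measurable_hit_bounded; rewrite setIC; exact: bounded_borelI.
Qed.

Definition gibbs_int Lam (F : sconf R d -> \bar R) (Y : sconf R d) : \bar R :=
  poisson zs Lam (fun X => F (X `|` restrS Y (~` Lam)) *
    weight rs rp zp Lam (X `|` restrS Y (~` Lam))).

Lemma gibbs_int_ge0 Lam F Y : (forall X, 0 <= F X) -> 0 <= gibbs_int Lam F Y.
Proof.
by move=> F0; apply: poisson_ge0 => [|X]; [exact: ltW|rewrite mule_ge0 ?weight_ge0].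
Qed.

Lemma measurable_gibbs_int Lam (F : SConf R d -> \bar R) : bounded_borel Lam ->
  measurable_fun [set: SConf R d] F -> (forall X, 0 <= F X) ->
  measurable_fun [set: SConf R d] (fun Y : SConf R d => gibbs_int Lam F Y).
Proof.
move=> bL mF F0; apply: (measurable_poisson (H := fun Y X : SConf R d =>
  F ((X : set (pt R d)) `|` restrS Y (~` Lam)) *
    weight rs rp zp Lam ((X : set (pt R d)) `|` restrS Y (~` Lam))) (ltW zs0) bL).
  have mp : measurable_fun [set: SConf R d * SConf R d]
      (fun p : SConf R d * SConf R d =>
        ((p.2 : set (pt R d)) `|` restrS p.1 (~` Lam) : SConf R d)).
    have m1 : measurable_fun [set: SConf R d * SConf R d]
        (fun p : SConf R d * SConf R d => (p.2, restrS p.1 (~` Lam) : SConf R d)).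
      apply/measurable_fun_pairP; split; first exact: measurable_snd.
      apply: (measurableT_comp (measurable_restrS _) measurable_fst).
      by apply: (@measurableC _ (Bpt R d)); exact: bL.1.
    exact: (measurableT_comp (@measurable_setU_conf R d) m1).
  apply: emeasurable_funM; first exact: (measurableT_comp mF mp).
  exact: (measurableT_comp (measurable_weight rs rp zp bL) mp).
by move=> Y X; rewrite mule_ge0 ?weight_ge0.
Qed.

Lemma gibbs_intE Lam (F : sconf R d -> \bar R) (Y : sconf R d) :
  poisson zs Lam (fun xs => F (xs `|` restrS Y (~` Lam)) *
    expeR (- (zp%:E * energy rs rp Lam (xs `|` restrS Y (~` Lam)))) *
    ind_allowed rs rp (mark true (restrS Y (~` Lam) `|` xs))) = gibbs_int Lam F Y.
Proof.
congr poisson; apply/funext => X.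
by rewrite ind_allowed_mark -muleA (setUC (restrS _ _)).
Qed.

Lemma Zsph_gibbs_int Lam Y : Zsph rs rp zs zp Lam Y = gibbs_int Lam (fun=> 1) Y.
Proof. by rewrite ZsphE; congr poisson; apply/funext => X; rewrite mul1e. Qed.

Lemma measurable_gibbs_kernel Lam (F : SConf R d -> \bar R) : bounded_borel Lam ->
  measurable_fun [set: SConf R d] F -> (forall X, 0 <= F X) ->
  measurable_fun [set: SConf R d] (fun Y : SConf R d =>
    ((fine (Zsph rs rp zs zp Lam Y))^-1)%:E * gibbs_int Lam F Y).
Proof.
move=> bL mF F0; apply: emeasurable_funM; last exact: measurable_gibbs_int.
apply: measurableT_comp => //; apply: (measurableT_comp measurable_inv).
apply: (measurableT_comp (fine_measurable measurableT)).
rewrite (_ : Zsph rs rp zs zp Lam = (fun Y : SConf R d => gibbs_int Lam (fun=> 1) Y)).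
  exact: measurable_gibbs_int.
by apply/funext => Y; exact: Zsph_gibbs_int.
Qed.

Lemma Zsph_ge0 Lam Y : 0 <= Zsph rs rp zs zp Lam Y.
Proof. by rewrite Zsph_gibbs_int gibbs_int_ge0. Qed.

Lemma Zsph_le1 Lam Y : bounded_borel Lam -> Zsph rs rp zs zp Lam Y <= 1.
Proof.
move=> bL; rewrite ZsphE -(poisson_cst (ltW zs0) bL); apply: poisson_mono; first exact: ltW.
  by move=> X; exact: weight_ge0.
by move=> X _ _; apply: weight_le1; [exact: ltW|exact: bL.2].
Qed.

Lemma Zsph_fin Lam Y : bounded_borel Lam ->
  (fine (Zsph rs rp zs zp Lam Y))%:E = Zsph rs rp zs zp Lam Y.
Proof.
move=> bL; rewrite fineK// ge0_fin_numE ?Zsph_ge0//.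
by rewrite (le_lt_trans (Zsph_le1 Y bL))// ltry.
Qed.

Lemma inv_Zsph_ge0 Lam Y : 0 <= ((fine (Zsph rs rp zs zp Lam Y))^-1)%:E :> \bar R.
Proof. by rewrite lee_fin invr_ge0 fine_ge0// Zsph_ge0. Qed.

(** The empty configuration in [Lam] has positive Poisson mass, and with it only the allowed
    boundary remains. *)
Lemma Zsph_gt0 Lam Y : bounded_borel Lam -> sallowed rs (restrS Y (~` Lam)) ->
  0 < Zsph rs rp zs zp Lam Y.
Proof.
move=> bL aY; rewrite ZsphE; set V := restrS _ _.
have mT : measurable ([set: pt R d] : set (Bpt R d)) by exact: (@measurableT _ (Bpt R d)).
have m1 : measurable_fun [set: SConf R d]
    (fun X : SConf R d => (\1_[set X : set (pt R d) | ~ hit setT X] X)%:E : \bar R).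
  by apply: measurable_eindic; exact: measurable_not_hit.
apply: (@lt_le_trans _ _ (weight rs rp zp Lam V *
    poisson zs Lam (fun X => (\1_[set X | ~ hit setT X] X)%:E))).
  rewrite poisson_avoid// weightE ?bL.2//; last exact: bL.2.
  by rewrite indicE mem_set// -!EFinM lte_fin !mulr_gt0 ?expR_gt0.
rewrite -poissonZl ?(ltW zs0) ?weight_ge0//.
apply: poisson_mono; first exact: ltW.
  by move=> X; rewrite mule_ge0 ?weight_ge0// lee_fin.
move=> X _ _; rewrite indicE; have [|_] := boolP (X \in _); last by rewrite mule0 weight_ge0.
rewrite inE mule1 /= => nX; rewrite (_ : X = set0) ?set0U//.
by rewrite -subset0 => x Xx; apply: nX; exists x.
Qed.

(* At [Z = 0] the inverse is [0]. *)
Lemma inv_Zsph_mul_le1 Lam Y : bounded_borel Lam ->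
  ((fine (Zsph rs rp zs zp Lam Y))^-1)%:E * Zsph rs rp zs zp Lam Y <= 1.
Proof.
move=> bL; rewrite -[X in _ * X](Zsph_fin Y bL) -EFinM lee_fin.
have [->|Z0] := eqVneq (fine (Zsph rs rp zs zp Lam Y)) 0%R; first by rewrite mulr0.
by rewrite mulVf.
Qed.

Lemma integral_marginal (mu : probability (MConf R d) R) (nu : probability (SConf R d) R)
    (F : SConf R d -> \bar R) : marginal mu nu ->
  measurable_fun [set: SConf R d] F -> (forall X, 0 <= F X) ->
  \int[nu]_X F X = \int[mu]_y F (spheres y).
Proof.
move=> munu mF F0; have [m mE mI] := pushforward_of mu (@measurable_spheres R d).
rewrite -mI//; apply: eq_measure_integral => A mA _.
exact: etrans (munu A mA) (esym (mE A)).
Qed.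

Lemma measurable_locfinS : measurable ([set X | locfinS X] : set (SConf R d)).
Proof.
apply: (@eq_measurable _ _ _ (\bigcap_n \bigcup_m
    [set X : SConf R d | @counting _ R (X `&` box n) = m%:R%:E])); last first.
  apply: bigcapT_measurable => n; apply: bigcupT_measurable => m.
  apply: sub_sigma_algebra; exists (box n), m; split=> //.
  by split; [exact: borel_box|exact: box_bounded].
apply/seteqP; split=> X /=.
  move=> H n _; have [m Hm] := (finite_counting R _).1 (H _ (@box_bounded R d n)).
  by exists m.
move=> H B /ebounded_box[n Bn]; apply: (@sub_finite_set _ _ (X `&` box n)).
  by apply: setIS.
by have [m _ Hm] := H n I; apply/(finite_counting R); exists m.
Qed.

Lemma measurable_locfinM : measurable ([set x | locfinM x] : set (MConf R d)).
Proof.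
apply: (@eq_measurable _ _ _ (\bigcap_n \bigcap_(b in [set: bool]) \bigcup_m
    [set x : MConf R d | @counting _ R (x `&` (box n `*` [set b])) = m%:R%:E])); last first.
  apply: bigcapT_measurable => n; apply: fin_bigcap_measurable; first exact: finite_finset.
  move=> b _; apply: bigcupT_measurable => m.
  apply: sub_sigma_algebra; exists (box n), b, m; split=> //.
  by split; [exact: borel_box|exact: box_bounded].
apply/seteqP; split=> x /=.
  move=> H n _ b _; have fx : finite_set (x `&` (box n `*` [set b])).
    apply: (@sub_finite_set _ _ (restrM x (box n))); last exact/H/box_bounded.
    by move=> [p c] [xp [bp _]].
  by have [m Hm] := (finite_counting R _).1 fx; exists m.
move=> H B /ebounded_box[n Bn].
apply: (@sub_finite_set _ _ ((x `&` (box n `*` [set true])) `|` (x `&` (box n `*` [set false])))).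
  by move=> [p []] [xp [/Bn bp _]]; [left|right].
by rewrite finite_setU; split; apply/(finite_counting R);
  [have [m _ Hm] := H n I true I|have [m _ Hm] := H n I false I]; exists m.
Qed.

Lemma locfin_spheres (x : mconf R d) : locfinM x -> locfinS (spheres x).
Proof.
move=> H B /H fx; apply: (@sub_finite_set _ _ (fst @` restrM x B)).
  by move=> p [xp Bp]; exists (p, true).
exact: finite_image.
Qed.

(** Apply [gibbsM_congr] to [F] and to its Gibbs kernel. The kernel depends only on the spheres
    outside [Lam], so it comes out of the integral over [Lam] as a constant; the integral left over
    is [Zsph], which is positive for an allowed boundary and cancels its inverse. *)
Lemma marginal_gibbs (mu : probability (MConf R d) R) (nu : probability (SConf R d) R) :
  gibbsM rs rp zs zp mu -> marginal mu nu -> gibbsS rs rp zs zp nu.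
Proof.
move=> gmu munu; split.
  have mS := measurable_locfinS.
  apply/eqP; rewrite eq_le (probability_le1 nu mS)/= (munu _ mS).
  rewrite -gmu.1; apply: le_measure; rewrite ?inE.
  - exact: measurable_locfinM.
  - rewrite -[X in measurable X]setTI.
    by apply: measurable_spheres => //; exact: measurable_locfinS.
  - by move=> x; exact: locfin_spheres.
move=> Lam F bL mF F0.
under [RHS]eq_integral do rewrite gibbs_intE.
have mK := measurable_gibbs_kernel bL mF F0.
have K0 Y : 0 <= ((fine (Zsph rs rp zs zp Lam Y))^-1)%:E * gibbs_int Lam F Y.
  by rewrite mule_ge0 ?inv_Zsph_ge0 ?gibbs_int_ge0.
rewrite (integral_marginal munu mF F0) (integral_marginal munu mK K0).
apply: (gibbsM_congr zs0 zp0 bL gmu mF F0 mK K0) => V VL aV.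
have VE : restrS V (~` Lam) = V.
  apply/seteqP; split=> x; first by case.
  by move=> Vx; split=> // Lx; have : (V `&` Lam) x by []; rewrite VL.
have SVE S : S `<=` Lam -> restrS (S `|` V) (~` Lam) = V.
  move=> SL; apply/seteqP; split=> x; first by move=> [[/SL|]].
  by rewrite -{1}VE => -[Vx nLx]; split=> //; right.
pose c := ((fine (Zsph rs rp zs zp Lam V))^-1)%:E * gibbs_int Lam F V.
have mw : measurable_fun [set: SConf R d] (fun X : SConf R d => weight rs rp zp Lam X).
  exact: measurable_weight.
(* Here [c] is the value of the kernel at any configuration that agrees with [V] outside [Lam]. *)
transitivity (poisson zs Lam (fun S => c * weight rs rp zp Lam (S `|` V))); last first.
  apply: eq_poisson; first exact: ltW.
  - by move=> S; rewrite mule_ge0 ?weight_ge0 ?K0.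
  - by move=> S; rewrite mule_ge0 ?weight_ge0 ?K0.
  move=> S _ SL; have gE G : gibbs_int Lam G (S `|` V) = gibbs_int Lam G V.
    by rewrite /gibbs_int (SVE S SL) VE.
  by rewrite /c !Zsph_gibbs_int !gE.
rewrite poissonZl ?(ltW zs0) ?K0//; last 2 first.
- exact: measurable_comp_setU2.
- by move=> S; exact: weight_ge0.
have -> : poisson zs Lam (fun S => weight rs rp zp Lam (S `|` V)) = Zsph rs rp zs zp Lam V.
  by rewrite ZsphE VE.
rewrite /c muleAC -[X in _ * X * _](Zsph_fin V bL) -EFinM mulVf ?mul1e; last first.
  have := Zsph_gt0 bL (Y := V); rewrite VE => /(_ aV).
  by rewrite -(Zsph_fin V bL) lte_fin => /gt_eqF ->.
by rewrite /gibbs_int VE.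
Qed.

Lemma marginal_exists (mu : probability (MConf R d) R) :
  exists nu : probability (SConf R d) R, marginal mu nu.
Proof.
pose H := isMeasurableFun.Build _ _ _ _ _ (@measurable_spheres R d).
pose p : {mfun (MConf R d) >-> (SConf R d)} := HB.pack (@spheres R d : MConf R d -> SConf R d) H.
by exists (distribution mu p).
Qed.

End MarginalGibbs.

(** * Absence of percolation *)

Section Occupation.
Context (R : realType) (d : nat) (rs rp zs zp : R).
Hypotheses (zs0 : (0 < zs)%R) (zp0 : (0 < zp)%R).
Local Open Scope ereal_scope.
Notation ucube := (@cube R d 0).

Lemma gibbsS_int (nu : probability (SConf R d) R) Lam (F : SConf R d -> \bar R) :
  gibbsS rs rp zs zp nu -> bounded_borel Lam ->
  measurable_fun [set: SConf R d] F -> (forall X, 0 <= F X) ->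
  \int[nu]_X F X = \int[nu]_Y (((fine (Zsph rs rp zs zp Lam Y))^-1)%:E *
                                gibbs_int rs rp zs zp Lam F Y).
Proof.
move=> [_ dlr] bL mF F0; rewrite (dlr Lam F bL mF F0).
by apply: eq_integral => Y _; congr (_ * _); exact: gibbs_intE.
Qed.

Lemma vol_ucube c : vol (ucube c) = 1.
Proof.
rewrite cubeE; pose a i : R := ((c 0 i)%:~R / 1%:R)%R; pose b i : R := ((c 0 i + 1)%:~R / 1%:R)%R.
have ab i : (a i <= b i)%R by rewrite /a /b !divr1 ler_int lerDl.
transitivity ((\prod_(i < d) (b i - a i))%R%:E : \bar R); first exact: vol_rect ab.
by rewrite big1// => i _; rewrite /a /b !divr1 intrD addrC addKr.
Qed.

Lemma weight_insert Lam x (U : sconf R d) : ebounded Lam -> Lam x ->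
  weight rs rp zp Lam (x |` U) <= weight rs rp zp Lam U.
Proof.
move=> bL Lx; rewrite !weightE// -!EFinM lee_fin.
apply: ler_pM; rewrite ?expR_ge0//.
  rewrite ler_expR lerN2 ler_pM2l// fine_le//.
  - by rewrite -energy_fin.
  - by rewrite -energy_fin.
  apply: vol_mono => y [UL nUL]; split.
    by apply: Bunion_sub UL => w [Uw Lw]; split=> //; right.
  move=> H; apply: nUL; apply: Bunion_sub H => w [[->|Uw] nLw]; last by split.
  by case: nLw.
rewrite !indicE; have [aU|] := boolP (_ \in _); last by rewrite ler0n.
rewrite mem_set//; apply: (sallowed_sub (Y := x |` U)); last exact: set_mem.
by move=> w; right.
Qed.

Definition occupied (l : seq 'rV[int]_d) : set (sconf R d) :=
  [set X | forall c, c \in l -> hit (ucube c) X].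

Lemma measurable_occupied l : measurable (occupied l : set (SConf R d)).
Proof.
apply: (@eq_measurable _ (SConf R d) _ (\bigcap_(c in [set` l]) hit (ucube c))).
  by apply/seteqP; split=> X.
apply: fin_bigcap_measurable; first exact: finite_seq.
by move=> c _; apply: measurable_hit; exact: borel_cube.
Qed.

Lemma occupied_setU l (X V : sconf R d) :
  (forall c, c \in l -> V `&` ucube c = set0) ->
  occupied l (X `|` V) <-> occupied l X.
Proof.
move=> H; split=> oX c cl; have [x [Xx cx]] := oX c cl; last by exists x; split=> //; left.
case: Xx => [Xx|Vx]; first by exists x.
by have : (V `&` ucube c) x by []; rewrite H.
Qed.

Lemma indic_occupied_setU l (X V : sconf R d) :
  (forall c, c \in l -> V `&` ucube c = set0) ->
  \1_(occupied l) (X `|` V) = \1_(occupied l) X :> R.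
Proof.
move=> H; rewrite !indicE; have [oX|oX] := pselect (occupied l X).
  by rewrite !mem_set//; exact/(occupied_setU X H).
by rewrite !memNset// => /(occupied_setU X H).
Qed.

(** Each unit cube costs one application of [poisson_hit], with volume 1. Its monotonicity
    hypothesis holds because a point added in the cube [c] lowers the weight and, [c] being absent
    from [l], does not change which cubes of [l] are occupied. *)
Lemma poisson_occupied Lam l (V : set (pt R d)) : bounded_borel Lam -> uniq l ->
  (forall c, c \in l -> ucube c `<=` Lam) ->
  poisson zs Lam (fun X => (\1_(occupied l) X)%:E * weight rs rp zp Lam (X `|` V)) <=
  (zs ^+ size l)%:E * poisson zs Lam (fun X => weight rs rp zp Lam (X `|` V)).
Proof.
move=> bL.
have mw : measurable_fun [set: SConf R d]
    (fun X : SConf R d => weight rs rp zp Lam ((X : set (pt R d)) `|` V)).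
  exact: (measurable_comp_setU2 V (measurable_weight rs rp zp bL)).
elim: l => [|c l IH] /=.
  move=> _ _; rewrite expr0 mul1e; apply: poisson_mono; first exact: ltW.
    by move=> X; rewrite mule_ge0 ?weight_ge0// lee_fin.
  move=> X _ _; rewrite -[leRHS]mul1e; apply: lee_wpmul2r; first exact: weight_ge0.
  by rewrite lee_fin.
move=> /andP[cl ul] lL; have cL : ucube c `<=` Lam by apply: lL; rewrite mem_head.
have {}IH := IH ul (fun c' c'l => lL c' (mem_behead (s := c :: l) c'l)).
pose G (X : SConf R d) := (\1_(occupied l) X)%:E * weight rs rp zp Lam (X `|` V).
have G0 X : 0 <= G X by rewrite mule_ge0 ?weight_ge0// lee_fin.
have mG : measurable_fun [set: SConf R d] G.
  apply: emeasurable_funM => //; apply: measurable_eindic; exact: measurable_occupied.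
have bc : bounded_borel (ucube c) by split; [exact: borel_cube|exact: cube_bounded].
apply: (@le_trans _ _ (poisson zs Lam (fun X => (\1_(hit (ucube c)) X)%:E * G X))).
  apply: poisson_mono; first exact: ltW.
    by move=> X; rewrite mule_ge0 ?weight_ge0// lee_fin.
  move=> X _ _; rewrite /G [leRHS]muleA; apply: lee_wpmul2r; first exact: weight_ge0.
  rewrite -EFinM lee_fin !indicE -natrM mulnb ler_nat.
  have [/set_mem o|//] := boolP (X \in occupied (c :: l)).
  rewrite (_ : _ && _)//; apply/andP; split; apply/mem_set.
    by apply: o; rewrite mem_head.
  by move=> c' c'l; apply: o; rewrite in_cons c'l orbT.
apply: le_trans (poisson_hit (ltW zs0) bL bc mG G0 _) _; last first.
  rewrite vol_ucube mulr1 exprS EFinM -muleA.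
  by apply: lee_wpmul2l => //; rewrite lee_fin ltW.
move=> x X cx Lx XL; rewrite /G; apply: lee_pmul; rewrite ?weight_ge0 ?lee_fin//.
  rewrite setUC indic_occupied_setU// => c' c'l; apply/seteqP; split=> // y [/= -> c'y].
  by move: cl; rewrite -cx c'y c'l.
by rewrite -setUA weight_insert//; exact: bL.2.
Qed.

(** The Gibbs equation is used on the union of the cubes themselves, so the boundary spheres
    contribute nothing to their occupation. *)
Lemma gibbs_occupied (nu : probability (SConf R d) R) l : gibbsS rs rp zs zp nu ->
  uniq l -> nu (occupied l) <= (zs ^+ size l)%:E.
Proof.
move=> gnu ul; pose Lam : set (pt R d) := \bigcup_(c in [set` l]) ucube c.
have cL c : c \in l -> ucube c `<=` Lam by move=> cl x cx; exists c.
have bL : bounded_borel Lam.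
  split; last by apply: ebounded_bigcup => c _; exact: cube_bounded.
  by apply: (@fin_bigcup_measurable _ (Bpt R d)); [exact: finite_seq|move=> c _; exact: borel_cube].
have mo := measurable_occupied l.
have mF : measurable_fun [set: SConf R d] (fun X : SConf R d => (\1_(occupied l) X)%:E : \bar R).
  exact: measurable_eindic.
have -> : nu (occupied l) = \int[nu]_X (\1_(occupied l) X)%:E.
  by rewrite integral_indic// setIT.
rewrite (gibbsS_int gnu bL mF); last by move=> X; rewrite lee_fin.
apply: (@le_trans _ _ (\int[nu]_X (zs ^+ size l)%:E)); last first.
  rewrite integral_cst// [X in _ * X](_ : _ = 1) ?mule1//.
  exact: probability_setT.
apply: integral_mono => Y.
  by rewrite mule_ge0 ?inv_Zsph_ge0 ?gibbs_int_ge0// => X; rewrite lee_fin.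
apply: (@le_trans _ _ (((fine (Zsph rs rp zs zp Lam Y))^-1)%:E *
    ((zs ^+ size l)%:E * Zsph rs rp zs zp Lam Y))).
  apply: lee_wpmul2l; first exact: inv_Zsph_ge0.
  rewrite ZsphE; apply: le_trans (poisson_occupied _ bL ul cL).
  rewrite /gibbs_int; set V := restrS _ _.
  rewrite (_ : (fun X => _) = (fun X : set (pt R d) =>
    (\1_(occupied l) X)%:E * weight rs rp zp Lam (X `|` V)))//.
  apply/funext => X; rewrite indic_occupied_setU// => c /cL cLam.
  by apply/seteqP; split=> // x [[_ nLx] /cLam].
rewrite muleCA -[leRHS]mule1; apply: lee_wpmul2l; first by rewrite lee_fin exprn_ge0// ltW.
exact: inv_Zsph_mul_le1.
Qed.

End Occupation.

(** * Counting paths on the grid *)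

Section GridPaths.
Context (d L : nat).
Implicit Types (c : 'rV[int]_d).

Definition grid_adj c c' := [forall i, (`|(c 0 i - c' 0 i)%R|%N <= L)%N].

(** The displacements with all coordinates between [-L] and [L], shifted by [L] so that finite
    functions enumerate them. *)
Definition offsets : seq 'rV[int]_d :=
  [seq \row_i ((f i : nat)%:Z - L%:Z) | f : {ffun 'I_d -> 'I_(L + L).+1}].

Definition grid_nbrs c := [seq c + e | e <- offsets].

Lemma mem_grid_nbrs c c' : grid_adj c c' -> c' \in grid_nbrs c.
Proof.
move=> /forallP adj; apply/mapP; exists (c' - c); last by rewrite addrC subrK.
apply/mapP; exists [ffun i => inord `|(c' 0 i - c 0 i + L%:Z)%R|%N]; first exact: mem_enum.
apply/rowP => i; have := adj i; rewrite !mxE ffunE.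
move: (c 0 i) (c' 0 i) => u v uv.
have lt : (`|(v - u + L%:Z)%R|%N < (L + L).+1)%N by lia.
by rewrite (inordK lt); lia.
Qed.

(** Continuations of [c] by [n] steps, without [c] itself. Self-intersections are kept, which makes
    the number of paths an exact power. *)
Fixpoint grid_paths (n : nat) c : seq (seq 'rV[int]_d) :=
  if n is m.+1 then [seq c' :: p | c' <- grid_nbrs c, p <- grid_paths m c'] else [:: [::]].

Lemma mem_grid_paths n c p : path grid_adj c p -> size p = n -> p \in grid_paths n c.
Proof.
elim: n c p => [|n IH] c [|c' p] //= /andP[/mem_grid_nbrs cc' pp] [sp].
by apply: allpairs_f_dep => //; exact: IH.
Qed.

Lemma size_grid_paths n c : size (grid_paths n c) = (size offsets ^ n)%N.
Proof.
elim: n c => //= n IH c; rewrite size_allpairs_dep.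
have E s : sumn [seq size (grid_paths n c') | c' <- s] = (size s * size offsets ^ n)%N.
  by elim: s => //= x s ->; rewrite IH mulSn.
by rewrite E size_map expnS.
Qed.

Lemma path_grid_dist c p i : path grid_adj c p ->
  (`|(c 0 i - last c p 0 i)%R|%N <= size p * L)%N.
Proof.
elim: p c => [|c' p IH] c /=; first by rewrite subrr.
move=> /andP[/forallP/(_ i) H1 /IH H2]; rewrite mulSn; lia.
Qed.

End GridPaths.

Section NoPercolation.
Context (R : realType) (d : nat) (rs rp : R).
Hypotheses (rs0 : 0 < rs) (rp0 : 0 < rp).
Implicit Types (X : sconf R d).

(** One unit covers the truncation of [2 * rhat], the other the rounding in the two cube indices. *)
Let L := (Num.truncn (2 * rhat rs rp)).+2.

Lemma close_grid_adj (u v : pt R d) : edist u v < 2 * rhat rs rp ->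
  grid_adj L (cubeidx 0 u) (cubeidx 0 v).
Proof.
move=> uv; have absz_le (m n : int) (k : nat) : m - n < k%:Z -> n - m < k%:Z ->
    (`|(m - n)%R|%N <= k)%N by lia.
apply/forallP => i; rewrite !mxE.
have H := le_lt_trans (coord_le_edist u v i) uv; move: H.
rewrite ltr_norml => /andP[a b].
have T := truncnS_gt (2 * rhat rs rp).
have := @floor_itv R (u 0 i * 1%:R); have := @floor_itv R (v 0 i * 1%:R).
rewrite !mulr1 !intrD => /andP[p q] /andP[p' q'].
set m := Num.floor _; set n := Num.floor _ => /=.
have H1 : m - n < L%:Z.
  rewrite -(ltr_int R) intrD mulrNz /L -pmulrn -natr1.
  by move: p q p' q' a b T; rewrite -/m -/n; lra.
have H2 : n - m < L%:Z.
  rewrite -(ltr_int R) intrD mulrNz /L -pmulrn -natr1.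
  by move: p q p' q' a b T; rewrite -/m -/n; lra.
exact: absz_le.
Qed.

(* An infinite cluster of a locally finite configuration visits cubes arbitrarily
   far from its starting point, hence contains long self-avoiding paths of cubes. *)
Lemma percolates_long_path X : locfinS X -> percolates rs rp X ->
  exists c, forall n, exists p, [/\ size p = n, path (grid_adj L) c p,
    uniq (c :: p) & occupied (c :: p) X].
Proof.
move=> lX [a [Xa infC]]; exists (cubeidx 0 a) => n; apply: contrapT => H.
apply: infC.
have bB : ebounded [set x : pt R d | forall i,
    (`|(cubeidx 0 a 0 i - cubeidx 0 x 0 i)%R|%N <= n * L)%N].
  apply: (@ebounded_coord _ _ _ (\sum_i `|a 0 i| + (n * L).+2%:R)) => x i /(_ i) /=.
  have H1 : `|a 0 i| <= \sum_i `|a 0 i| by rewrite (bigD1 i)//= lerDl sumr_ge0.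
  rewrite !mxE !mulr1; have := @floor_itv R (a 0 i); have := @floor_itv R (x 0 i).
  rewrite !intrD; set u := Num.floor _; set v := Num.floor _ => /andP[p q] /andP[p' q'] uv.
  have uv1 : v - u <= (n * L)%:Z by lia.
  have uv2 : u - v <= (n * L)%:Z by lia.
  move: uv1 uv2; rewrite -!(ler_int R) !intrD !mulrNz -!pmulrn => uv1 uv2.
  rewrite (le_trans _ (lerD H1 (lexx _)))//.
  have := ler_norm (a 0 i); have := ler_norm (- a 0 i); rewrite normrN => n1 n2.
  by rewrite ler_norml -!natr1; apply/andP; split; lra.
apply: sub_finite_set (lX _ bB) => b [Xb [s [sX [ps ls]]]]; split=> // i.
have pm : path (grid_adj L) (cubeidx 0 a) (map (cubeidx 0) s).
  by apply: homo_path ps => u v; exact: close_grid_adj.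
have := last_map (@cubeidx R d 0) s a; rewrite ls.
case/shortenP: pm => p pp up psub lp.
have occ : occupied (cubeidx 0 a :: p) X.
  move=> c; rewrite in_cons => /orP[/eqP->|/psub/mapP[x xs ->]].
    by exists a.
  by exists x; split=> //; exact: sX.
have [np|pn] := leqP n (size p).
  exfalso; apply: H; exists (take n p); split.
  - by rewrite size_takel.
  - exact: take_path.
  - by move: up; rewrite -{1}(cat_take_drop n p) -cat_cons cat_uniq => /andP[].
  - move=> c; rewrite in_cons => /orP[/eqP->|/mem_take cp]; apply: occ.
      exact: mem_head.
    by rewrite in_cons cp orbT.
rewrite -lp; apply: leq_trans (path_grid_dist i pp) _.
by rewrite leq_mul2r ltnW ?orbT.
Qed.

Theorem low_activity_no_percolation : exists zc : R, 0 < zc /\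
  forall zs zp : R, 0 < zs -> zs < zc -> 0 < zp ->
  forall nu : probability (SConf R d) R, gibbsS rs rp zs zp nu ->
  {ae nu, forall X : SConf R d, ~ percolates rs rp X}.
Proof.
(* The successor makes [K] visibly positive. With [zs < 1/K], the number of paths times the
   probability of each is at most [zs * (K * zs) ^ n], which tends to 0. *)
pose K := (size (offsets d L)).+1.
exists K%:R^-1; split; first by rewrite invr_gt0 ltr0n.
move=> zs zp zs0 zsK zp0 nu gnu.
have q1 : K%:R * zs < 1 by rewrite mulrC -ltr_pdivlMr ?ltr0n// mul1r.
(* Paths with a repeated cube get the empty event: the occupation bound holds for distinct cubes
   only, and the extracted paths are self-avoiding. *)
pose Q (p : seq 'rV[int]_d) : set (SConf R d) := if uniq p then occupied p else set0.
have mQ p : measurable (Q p).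
  by rewrite /Q; case: ifP => // _; exact: measurable_occupied.
have nuQ p : (nu (Q p) <= (zs ^+ size p)%:E)%E.
  rewrite /Q; case: ifP => [up|_]; first exact: (gibbs_occupied zs0 zp0 gnu up).
  by rewrite measure0 lee_fin exprn_ge0// ltW.
pose P n c : set (SConf R d) := \bigcup_(p in [set` grid_paths L n c]) Q (c :: p).
have mP n c : measurable (P n c).
  by apply: fin_bigcup_measurable; [exact: finite_seq|move=> p _; exact: mQ].
have nuU (s : seq (seq 'rV[int]_d)) n c : (forall p, p \in s -> size p = n) ->
    (nu (\bigcup_(p in [set` s]) Q (c :: p)) <= ((size s)%:R * zs ^+ n.+1)%:E)%E.
  elim: s => [|p s IH] Hs.
    by rewrite set_seq_nil bigcup_set0 measure0 mul0r.
  have ms : measurable (\bigcup_(p in [set` s]) Q (c :: p)).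
    by apply: fin_bigcup_measurable; [exact: finite_seq|move=> p' _; exact: mQ].
  rewrite set_seq_cons bigcup_setU1; apply: (le_trans (measureU2 nu (mQ _) ms)).
  have -> : ((size (p :: s))%:R * zs ^+ n.+1)%:E =
      ((zs ^+ n.+1)%:E + ((size s)%:R * zs ^+ n.+1)%:E)%E.
    by rewrite -EFinD /= -natr1; congr EFin; ring.
  apply: leeD; first by have := nuQ (c :: p); rewrite /= (Hs p (mem_head _ _)).
  by apply: IH => p' p's; apply: Hs; rewrite in_cons p's orbT.
have szp n (c : 'rV[int]_d) p : p \in grid_paths L n c -> size p = n.
  elim: n c p => [|n IH] c p /=; first by rewrite inE => /eqP ->.
  by move=> /allpairsPdep[c' [p' [_ /IH <- ->]]].
have nuP n c : (nu (P n c) <= (zs * (K%:R * zs) ^+ n)%:E)%E.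
  apply: (le_trans (nuU (grid_paths L n c) n c (szp n c))); rewrite lee_fin size_grid_paths.
  rewrite exprMn exprS mulrCA ler_pM2l// ler_wpM2r ?exprn_ge0 ?(ltW zs0)//.
  by rewrite natrX lerXn2r ?nnegrE// ler_nat.
have nuI c : nu (\bigcap_n P n c) = 0%E.
  apply/eqP; rewrite eq_le measure_ge0 andbT; apply/lee_addgt0Pr => e e0.
  rewrite add0e; have qK : `|K%:R * zs| < 1 by rewrite ger0_norm// mulr_ge0// ltW.
  have /cvgrPdist_lt/(_ _ (divr_gt0 e0 zs0))[n _ /(_ n (leqnn n))] := cvg_expr qK.
  rewrite sub0r normrN ger0_norm ?exprn_ge0 ?mulr_ge0 ?(ltW zs0)// => Hn.
  apply: (@le_trans _ _ (nu (P n c))).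
    apply: le_measure; rewrite ?inE//; first exact: bigcapT_measurable.
    by move=> X; exact.
  by apply: le_trans (nuP n c) _; rewrite lee_fin mulrC -ler_pdivlMr// ltW.
(* The exceptional set: configurations that are not locally finite, and those with long occupied
   paths of every length from one of the countably many starting cubes. *)
pose N := ~` [set X | locfinS X] `|` \bigcup_(c : 'rV[int]_d) \bigcap_n P n c.
have mI c : measurable (\bigcap_n P n c) by exact: bigcapT_measurable.
exists N; split.
- apply: measurableU; first by apply: measurableC; exact: measurable_locfinS.
  exact: countable_bigcupT_measurable.
- have mS := @measurable_locfinS R d; have mSC := measurableC mS.
  have nl : nu (~` [set X | locfinS X]) = 0%E.
    by rewrite (probability_setC nu mS) gnu.1 subee.
  apply: measure_negligible.
    by apply: measurableU => //; exact: countable_bigcupT_measurable.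
  apply: negligibleU; first by apply/(negligibleP nu mSC).
  pose f n := if unpickle n is Some c then \bigcap_n P n c else set0.
  rewrite (_ : \bigcup_c _ = \bigcup_n f n); last first.
    apply/seteqP; split=> X; first by move=> [c _ H]; exists (pickle c); rewrite // /f pickleK.
    by move=> [n _]; rewrite /f; case: unpickle => // c H; exists c.
  apply: negligible_bigcup => n; rewrite /f.
  case: unpickle => [c|]; last exact: negligible_set0.
  by apply/(negligibleP nu (mI c)); exact: nuI.
- move=> X /= /contrapT perc; have [lX|nlX] := pselect (locfinS X); last by left.
  right; have [c Hc] := percolates_long_path lX perc; exists c => // n _.
  have [p [sp pp up oX]] := Hc n; exists p => /=; first exact: mem_grid_paths.
  by rewrite /Q up.
Qed.

End NoPercolation.

Lemma absz_le_bound (z : int) (k : nat) : z < k%:Z -> - k%:Z - 1 < z -> (`|z|%N <= k)%N.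
Proof. lia. Qed.

(** * Packing density *)

Section Packing.
Context (R : realType) (d : nat) (rs : R).
Hypotheses (d0 : (0 < d)%N) (rs0 : 0 < rs).

Lemma edist_scale (x y u v : pt R d) (c : R) : 0 <= c ->
  (forall i, x 0 i - y 0 i = c * (u 0 i - v 0 i)) -> edist x y = c * edist u v.
Proof.
move=> c0 H; rewrite /edist.
under eq_bigr do rewrite H exprMn.
by rewrite -mulr_sumr sqrtrM ?sqr_ge0// sqrtr_sqr ger0_norm.
Qed.

(** Centres that are too close share their midpoint; the balls being open, tangent ones are still
    disjoint. *)
Lemma eball_disjoint (p q : pt R d) :
  eball p rs `&` eball q rs = set0 <-> 2 * rs <= edist p q.
Proof.
split=> [H|H]; last first.
  apply/seteqP; split=> // x [px qx]; rewrite /eball/= in px qx.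
  have := edist_triangle p x q; rewrite (edistC x q) => T.
  by move: H; rewrite leNgt => /negP; apply; lra.
rewrite leNgt; apply/negP => pq.
pose x : pt R d := \row_i ((p 0 i + q 0 i) / 2).
have px : edist p x = 2^-1 * edist p q.
  by apply: edist_scale => [|i]; rewrite ?invr_ge0// !mxE; field.
have qx : edist q x = 2^-1 * edist q p.
  by apply: edist_scale => [|i]; rewrite ?invr_ge0// !mxE; field.
have : (eball p rs `&` eball q rs) x.
  by split; rewrite /eball/= ?px ?qx ?(edistC q p); lra.
by rewrite H.
Qed.

Lemma eball_center (p : pt R d) : eball p rs p.
Proof. by rewrite /eball/= edistxx. Qed.

Definition packs (n : nat) (s : seq (pt R d)) :=
  [/\ uniq s, forall p, p \in s -> eball p rs `<=` @box R d n & sallowed rs [set` s]].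

Lemma packing_seqP n k : (exists s : seq (pt R d),
    size s = k /\ (forall i, (i < k)%N -> eball (nth 0 s i) rs `<=` @box R d n) /\
    (forall i j, (i < j < k)%N -> eball (nth 0 s i) rs `&` eball (nth 0 s j) rs = set0)) <->
  exists s, size s = k /\ packs n s.
Proof.
split=> -[s [sk]].
  move=> [H1 H2]; exists s; split=> //.
  have sep i j : (i < j < k)%N -> 2 * rs <= edist (nth 0 s i) (nth 0 s j).
    by move=> ij; apply/eball_disjoint; exact: H2.
  split.
  - apply/(uniqP 0) => i j; rewrite !inE sk => ik jk E; apply/eqP; case: ltngtP => // ij.
      by have := @sep i j; rewrite ij jk E edistxx => /(_ isT) H3; move: H3; rewrite pmulr_rle0 ?ltr0n// leNgt rs0.
    by have := @sep j i; rewrite ij ik E edistxx => /(_ isT) H3; move: H3; rewrite pmulr_rle0 ?ltr0n// leNgt rs0.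
  - by move=> p ps; rewrite -(nth_index 0 ps); apply: H1; rewrite -sk index_mem.
  - move=> p q /= ps qs pq; rewrite -(nth_index 0 ps) -(nth_index 0 qs).
    have [ij|ij|ij] := ltngtP (index p s) (index q s).
    + by apply: sep; rewrite ij -sk index_mem.
    + by rewrite edistC; apply: sep; rewrite ij -sk index_mem.
    + by case: pq; rewrite -(nth_index 0 ps) -(nth_index 0 qs) ij.
move=> [us H1 H2]; exists s; split=> //; split.
  by move=> i ik; apply: H1; rewrite mem_nth// sk.
move=> i j /andP[ij jk]; apply/eball_disjoint; have ik := ltn_trans ij jk.
apply: H2; rewrite /= ?mem_nth ?sk//.
by move/eqP; rewrite nth_uniq ?sk// => /eqP E; rewrite E ltnn in ij.
Qed.

Lemma size_offsets L : size (offsets d L) = ((L + L).+1 ^ d)%N.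
Proof. by rewrite size_map -cardE card_ffun !card_ord. Qed.

(** A grid cube of diameter below [2 * rs] holds at most one centre, so a packing is no larger than
    the number of cubes available. This makes the supremum [rho_star] finite. *)
Lemma pack_bound : exists C : R, 0 <= C /\ forall n s, (0 < n)%N -> packs n s ->
  (size s)%:R <= C * box_vol R d n.
Proof.
have rs2 : 0 < 2 * rs by rewrite mulr_gt0.
have [k _ /(_ k (leqnn k)) Hk] := near_cube_edist d rs2.
(* The indices range over [2 * n * (k+1) + 1] values per axis, at most [(k+2) * (2 * n)] since [n]
   is positive. *)
exists ((k.+2)%:R ^+ d); split; first by rewrite exprn_ge0.
move=> n s n0 [us H1 H2]; pose M := (n * k.+1)%N.
have inj : {in s &, injective (@cubeidx R d k)}.
  move=> p q ps qs E; apply/eqP/negPn/negP => /eqP pq.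
  have := H2 p q ps qs pq; rewrite leNgt => /negP; apply.
  exact: Hk (cubeidx k p) p q erefl (esym E).
have sub : {subset map (@cubeidx R d k) s <= offsets d M}.
  move=> _ /mapP[p ps ->]; have pb := H1 p ps p (eball_center p).
  have -> : cubeidx k p = 0 + cubeidx k p by rewrite add0r.
  have : grid_adj M 0 (cubeidx k p).
    apply/forallP => i; rewrite !mxE sub0r abszN; have [a b] := pb i.
    set z := Num.floor _; have := @floor_itv R (p 0 i * k.+1%:R); rewrite -/z intrD => /andP[e f].
    have Mk : M%:R = n%:R * k.+1%:R :> R by rewrite natrM.
    have k1 : 0 < k.+1%:R :> R by rewrite ltr0n.
    have a' : - M%:R <= p 0 i * k.+1%:R by rewrite Mk -mulNr ler_wpM2r// ltW.
    have b' : p 0 i * k.+1%:R < M%:R by rewrite Mk ltr_pM2r.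
    have z1 : z < M%:Z by rewrite -(ltr_int R) -pmulrn; lra.
    have z2 : - M%:Z - 1 < z by rewrite -(ltr_int R) intrD !mulrNz -pmulrn; lra.
    exact: absz_le_bound.
  by move=> /mem_grid_nbrs/mapP[e eo ->]; rewrite !add0r.
have : (size s <= (M + M).+1 ^ d)%N.
  rewrite -size_offsets -(size_map (@cubeidx R d k)).
  by apply: uniq_leq_size => //; rewrite map_inj_in_uniq.
rewrite -(ler_nat R) natrX => /le_trans; apply.
rewrite /box_vol -exprMn lerXn2r ?nnegrE ?mulr_ge0//.
rewrite -natrM -natrM ler_nat /M; nia.
Qed.

(** The [q ^ d] translates of the box of half-width [m] that tile the box of half-width [q * m];
    half-open sides make them disjoint. *)
Definition cell (q m : nat) (j : {ffun 'I_d -> 'I_q}) : set (pt R d) :=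
  [set x | forall i, - (q * m)%:R + (2 * m * j i)%:R <= x 0 i <
                     - (q * m)%:R + (2 * m * (j i).+1)%:R].

Lemma cell_sub_box q m n (j : {ffun 'I_d -> 'I_q}) : (q * m <= n)%N -> cell m j `<=` @box R d n.
Proof.
clear d0 rs0.
move=> qmn x H i; have /andP[a b] := H i.
have h1 : (q * m)%:R <= n%:R :> R by rewrite ler_nat.
have h2 : (2 * m * (j i).+1)%:R <= (q * m + q * m)%:R :> R.
  rewrite ler_nat; have := ltn_ord (j i); nia.
have h3 : 0 <= (2 * m * j i)%:R :> R by [].
by move: a b h2; rewrite natrD; split; lra.
Qed.

Lemma cell_disjoint q m (j j' : {ffun 'I_d -> 'I_q}) : j <> j' ->
  cell m j `&` cell m j' = set0.
Proof.
clear d0 rs0.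
move=> jj'; apply/seteqP; split=> // x [H H'].
have [i ji] : exists i, (j i : nat) <> j' i.
  apply: contrapT => /forallNP E; apply: jj'; apply/ffunP => i; apply/val_inj.
  by have := E i; move/contrapT.
have /andP[a b] := H i; have /andP[a' b'] := H' i.
have [lt|lt|E] := ltngtP (j i) (j' i); last by [].
  have : (2 * m * (j i).+1)%:R <= (2 * m * j' i)%:R :> R by rewrite ler_nat; nia.
  by move: b a'; lra.
have : (2 * m * (j' i).+1)%:R <= (2 * m * j i)%:R :> R by rewrite ler_nat; nia.
by move: b' a; lra.
Qed.

(** A copy of the packing goes into each cell. Balls from different copies are disjoint because each
    stays inside its own cell. *)
Lemma pack_tile q m n s : (q * m <= n)%N -> packs m s ->
  exists s', size s' = (q ^ d * size s)%N /\ packs n s'.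
Proof.
move=> qmn [us H1 H2].
pose t (j : {ffun 'I_d -> 'I_q}) : pt R d :=
  \row_i (- (q * m)%:R + (2 * m * j i)%:R + m%:R).
have ball_cell j p : p \in s -> eball (t j + p) rs `<=` cell m j.
  move=> ps x px i; have : @box R d m (x - t j).
    apply: (H1 p ps); rewrite /eball/=.
    rewrite (@edist_scale p (x - t j) (t j + p) x 1)// ?mul1r// => k.
    by rewrite !mxE; ring.
  by move=> /(_ i); rewrite !mxE mulnS natrD natrM => -[a b]; apply/andP; split; lra.
have sep (a b : {ffun 'I_d -> 'I_q} * pt R d) : a.2 \in s -> b.2 \in s -> a <> b ->
    2 * rs <= edist (t a.1 + a.2) (t b.1 + b.2).
  case: a b => [j p] [j' p'] /= ps ps' ab; have [E|/eqP jj'] := eqVneq j j'.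
    rewrite -E (@edist_scale (t j + p) (t j + p') p p' 1)// ?mul1r; last first.
      by move=> k; rewrite !mxE; ring.
    by apply: H2 => //= pp'; apply: ab; rewrite E pp'.
  apply/eball_disjoint; apply/seteqP; split=> // x [/(ball_cell j p ps) H /(ball_cell j' p' ps') H'].
  by have : (cell m j `&` cell m j') x by []; rewrite cell_disjoint.
exists [seq t j + p | j <- enum {ffun 'I_d -> 'I_q}, p <- s]; split.
  by rewrite size_allpairs -cardE card_ffun !card_ord.
split.
- apply: allpairs_uniq => //; first exact: enum_uniq.
  move=> a b /allpairsP[[j p] [_ /= ps ->]] /allpairsP[[j' p'] [_ /= ps' ->]] /= E.
  apply: contrapT => ab; have := sep (j, p) (j', p') ps ps' ab.
  by rewrite /= E edistxx => H3; move: H3; rewrite pmulr_rle0 ?ltr0n// leNgt rs0.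
- move=> _ /allpairsP[[j p] [_ ps ->]] x /(ball_cell j p ps); exact: cell_sub_box.
- move=> _ _ /= /allpairsP[[j p] [_ /= ps ->]] /allpairsP[[j' p'] [_ /= ps' ->]] ne.
  by apply: (sep (j, p) (j', p')) => // -[E1 E2]; apply: ne; rewrite E1 E2.
Qed.

(** The closest-packing density is introduced as a supremum over all boxes, in the manner of
    Fekete's lemma: this bounds every packing at once, and [packing_density_cvg] recovers the
    limit. *)
Definition densities : set R := [set a | exists n s, [/\ (0 < n)%N, packs n s &
  a = (size s)%:R / box_vol R d n]].

Definition rho_star := sup densities.

Lemma box_vol_gt0 n : (0 < n)%N -> 0 < box_vol R d n.
Proof. by move=> n0; rewrite exprn_gt0// mulr_gt0// ltr0n. Qed.

Lemma packs_nil n : packs n [::].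
Proof. by split=> // p q. Qed.

Lemma has_sup_densities : has_sup densities.
Proof.
split; first by exists (0 / box_vol R d 1), 1%N, [::]; split; [|exact: packs_nil|].
have [C [C0 HC]] := pack_bound; exists C => _ [n [s [n0 ps ->]]].
by rewrite ler_pdivrMr ?box_vol_gt0// HC.
Qed.

Lemma rho_star_ge0 : 0 <= rho_star.
Proof.
apply: (sup_upper_bound has_sup_densities); exists 1%N, [::].
by split; [|exact: packs_nil|rewrite mul0r].
Qed.

Lemma pack_rho n s : (0 < n)%N -> packs n s -> (size s)%:R <= rho_star * box_vol R d n.
Proof.
move=> n0 ps; rewrite -ler_pdivrMr ?box_vol_gt0//.
by apply: (sup_upper_bound has_sup_densities); exists n, s.
Qed.

Lemma bernoulli (x : R) n : 0 <= x <= 1 -> 1 - n%:R * x <= (1 - x) ^+ n.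
Proof.
move=> /andP[x0 x1]; elim: n => [|n IH]; first by rewrite expr0; lra.
rewrite exprS; apply: le_trans (ler_wpM2l _ IH); last by lra.
have : 0 <= n%:R * x ^+ 2 by rewrite mulr_ge0 ?sqr_ge0.
by rewrite -natr1 => ?; nra.
Qed.

(** A boundary layer of fixed width [c] is negligible in volume, by Bernoulli's inequality. The free
    variable [x] lets it serve both for enlarged boxes and for the multiple of a cell size just
    below [n]. *)
Lemma near_ratio_pow (c e : R) : 0 <= c -> 0 < e -> \forall n \near \oo,
  forall x, 0 <= x -> n%:R - c <= x -> 1 - e <= (x / n%:R) ^+ d.
Proof.
move=> c0 e0; near=> n => x x0 ncx.
have n0 : 0 < n%:R :> R by near: n; exact: nbhs_infty_gtr.
have cn : c <= n%:R by near: n; exact: nbhs_infty_ger.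
have dn : d%:R * c / e <= n%:R by near: n; exact: nbhs_infty_ger.
have y0 : 0 <= c / n%:R <= 1 by rewrite divr_ge0 ?(ltW n0)//= ler_pdivrMr// mul1r.
apply: (@le_trans _ _ ((1 - c / n%:R) ^+ d)).
  apply: le_trans (bernoulli d y0); rewrite lerB// mulrA ler_pdivrMr//.
  by rewrite [leRHS]mulrC -ler_pdivrMr.
have le1 : 1 - c / n%:R <= x / n%:R.
  by rewrite ler_pdivlMr// mulrBl mul1r divfK ?gt_eqF.
by rewrite lerXn2r ?nnegrE ?divr_ge0 ?(ltW n0)//; lra.
Unshelve. all: end_near. Qed.

Lemma box_volD n c : (0 < n)%N ->
  box_vol R d (n + c) = box_vol R d n * ((n + c)%:R / n%:R) ^+ d.
Proof.
move=> n0; have n0' : n%:R != 0 :> R by rewrite pnatr_eq0 -lt0n.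
by rewrite /box_vol -exprMn -mulrA (mulrC n%:R) divfK.
Qed.

(** The extra margin [c] would spoil the density of a fixed packing, so a near-optimal one is first
    repeated until its box is large compared with [c]. *)
Lemma packs_near_rho (c : nat) (e : R) : 0 < e -> exists m s,
  [/\ (0 < m)%N, packs m s & rho_star - e <= (size s)%:R / box_vol R d (m + c)].
Proof.
move=> e0; have e2 : 0 < e / 2 by rewrite divr_gt0.
have [_ [m [s [m0 ps ->]]] Ha] := sup_adherent e2 has_sup_densities.
set a := _ / _ in Ha; have a0 : 0 <= a by rewrite divr_ge0// ltW// box_vol_gt0.
(* Chosen so that [a * del <= e / 2]; the added 1 covers [a = 0]. *)
pose del := e / 2 / (a + 1); have del0 : 0 < del by rewrite divr_gt0// ltr_wpDl.
have [N _ HN] := near_ratio_pow (ler0n R c) del0.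
pose q := N.+1; have qm0 : (0 < q * m)%N by rewrite muln_gt0.
have [s' [ss' ps']] := pack_tile (leqnn (q * m)) ps.
exists (q * m)%N, s'; split=> //.
have Nq : (N <= q * m + c)%N by rewrite /q; nia.
have := HN _ Nq (q * m)%:R (ler0n _ _); rewrite natrD addrK => /(_ (lexx _)) H.
have -> : (size s')%:R / box_vol R d (q * m + c) =
    a * ((q * m)%:R / ((q * m)%:R + c%:R)) ^+ d.
  rewrite ss' natrM natrX /a /box_vol -natrD (natrM _ q m).
  rewrite [in RHS]expr_div_n !exprMn.
  have b0 : (q * m + c)%:R ^+ d != 0 :> R by rewrite expf_neq0// pnatr_eq0; lia.
  have m0' : m%:R ^+ d != 0 :> R by rewrite expf_neq0// pnatr_eq0; lia.
  have t0 : 2 ^+ d != 0 :> R by rewrite expf_neq0.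
  by field; rewrite t0 m0' b0.
apply: le_trans (ler_wpM2l a0 H); rewrite mulrBr mulr1.
have : a * del <= e / 2.
  rewrite /del mulrCA ger_pMr// ler_pdivrMr ?mul1r ?ltr_wpDl//; lra.
by move: Ha; rewrite -/rho_star; lra.
Qed.

Lemma packing_number_le n : (0 < n)%N ->
  (packing_number d rs n <= (rho_star * box_vol R d n)%:E)%E.
Proof.
move=> n0; apply: ge_ereal_sup => _ [k /= /packing_seqP[s [<- ps]] <-].
by rewrite lee_fin pack_rho.
Qed.

Lemma packing_number_ge n s : packs n s ->
  ((size s)%:R%:E <= packing_number d rs n)%E.
Proof.
by move=> ps; apply: ereal_sup_ubound; exists (size s) => //=; apply/packing_seqP; exists s.
Qed.

Lemma near_cells_volume (m : nat) (a e : R) : (0 < m)%N -> 0 <= a -> 0 < e ->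
  \forall n \near \oo, a - e <= ((n %/ m) ^ d)%:R * (a * box_vol R d m) / box_vol R d n.
Proof.
clear d0 rs0.
move=> m0 a0 e0; have del0 : 0 < e / (a + 1) by rewrite divr_gt0// ltr_wpDl.
have := near_ratio_pow (ler0n R m) del0; apply: filter_app; near=> n => H.
have n0 : (0 < n)%N by near: n; exact: nbhs_infty_gt.
have := H (n %/ m * m)%:R (ler0n _ _).
have -> : n%:R - m%:R <= (n %/ m * m)%:R :> R.
  rewrite lerBlDr -natrD ler_nat; have := divn_eq n m; have := ltn_pmod n m0; lia.
move=> /(_ isT) {}H.
have -> : ((n %/ m) ^ d)%:R * (a * box_vol R d m) / box_vol R d n =
    a * ((n %/ m * m)%:R / n%:R) ^+ d.
  rewrite natrX natrM /box_vol expr_div_n !exprMn.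
  have b0 : n%:R ^+ d != 0 :> R by rewrite expf_neq0// pnatr_eq0; lia.
  have t0 : 2 ^+ d != 0 :> R by rewrite expf_neq0.
  by field; rewrite t0 b0.
apply: le_trans (ler_wpM2l a0 H); rewrite mulrBr mulr1 lerB//.
by rewrite mulrCA ger_pMr// ler_pdivrMr ?mul1r ?ltr_wpDl//; lra.
Unshelve. all: end_near. Qed.

(** The supremum bounds every density from above; from below, one near-optimal packing is copied
    into all the whole cells that fit in the box. *)
Lemma packing_density_cvg :
  ((packing_number d rs n * ((box_vol R d n)^-1)%:E)%E @[n --> \oo] --> rho_star%:E).
Proof.
have fin n : (0 < n)%N -> packing_number d rs n \is a fin_num.
  move=> n0; rewrite fin_numElt (lt_le_trans _ (packing_number_ge (packs_nil n)))/= ?ltNyr//.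
  by rewrite (le_lt_trans (packing_number_le n0)) ?ltry.
apply/fine_cvgP; split.
  by exists 1%N => // n n0; rewrite fin_numM// fin.
apply/cvgrPdist_le => e e0; have e2 : 0 < e / 2 by rewrite divr_gt0.
have [m [s [m0 ps]]] := packs_near_rho 0 e2; rewrite addn0 => Hs.
set a := _ / _ in Hs.
have a0 : 0 <= a by rewrite divr_ge0// ltW// box_vol_gt0.
have := near_cells_volume m0 a0 e2; apply: filter_app; near=> n => H.
have n0 : (0 < n)%N by near: n; exact: nbhs_infty_gt.
rewrite /= fineM ?fin//=; set N := fine _.
have NE : N%:E = packing_number d rs n by rewrite fineK ?fin.
have up : N <= rho_star * box_vol R d n.
  by rewrite -lee_fin NE packing_number_le.
have lo : ((n %/ m) ^ d)%:R * (a * box_vol R d m) <= N.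
  have [s' [ss' ps']] := pack_tile (leq_divM n m) ps.
  rewrite -lee_fin NE; apply: le_trans (packing_number_ge ps').
  rewrite lee_fin ss' natrM /a divfK// gt_eqF// box_vol_gt0//.
have b0 := box_vol_gt0 n0.
have up' : N / box_vol R d n <= rho_star by rewrite ler_pdivrMr.
have lo' : rho_star - e <= N / box_vol R d n.
  apply: le_trans (ler_wpM2r _ lo); last by rewrite invr_ge0 ltW.
  by apply: le_trans H; lra.
by rewrite ler_norml; apply/andP; split; lra.
Unshelve. all: end_near. Qed.

End Packing.

Section LimExtra.
Context (R : realType).
Local Open Scope ereal_scope.

Lemma limn_esup_le (u : nat -> \bar R) (B : \bar R) :
  (\forall n \near \oo, u n <= B) -> limn_esup u <= B.
Proof.
move=> H; apply: (@le_trans _ _ (ereal_sup [set u n | n in [set n | u n <= B]])).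
  by apply: ereal_inf_lbound; exists [set n | u n <= B].
by apply: ge_ereal_sup => _ [n /= un <-].
Qed.

Lemma limn_einf_ge (u : nat -> \bar R) (B : \bar R) :
  (\forall n \near \oo, B <= u n) -> B <= limn_einf u.
Proof.
move=> H; rewrite /limn_einf leeNr; apply: limn_esup_le.
by apply: filterS H => n; rewrite leeN2.
Qed.

End LimExtra.

(** * Density at high activity *)

Section CellEstimate.
Context (R : realType) (d : nat) (rs rp zp : R).
Hypotheses (d0 : (0 < d)%N) (rs0 : 0 < rs) (rp0 : 0 < rp) (zp0 : 0 < zp).

Definition cube_at (t : pt R d) (M : nat) : set (pt R d) :=
  [set x | forall i, t 0 i <= x 0 i < t 0 i + (2 * M)%:R].

Lemma vol_rect_le (t : pt R d) (l : R) : 0 <= l ->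
  vol [set x : pt R d | forall i, t 0 i <= x 0 i < t 0 i + l] = (l ^+ d)%:E.
Proof.
move=> l0; rewrite (vol_rect (a := fun i => t 0 i) (b := fun i => t 0 i + l)).
  rewrite (eq_bigr (fun=> l)); last by move=> i _; rewrite addrC addKr.
  by rewrite prodr_const card_ord.
by move=> i; rewrite lerDl.
Qed.

Lemma borel_rect (t : pt R d) (l : R) :
  measurable ([set x : pt R d | forall i, t 0 i <= x 0 i < t 0 i + l] : set (Bpt R d)).
Proof.
exact: (borel_coord (A := fun i => `[t 0 i, t 0 i + l[%classic)).
Qed.

Lemma bounded_rect (t : pt R d) (l : R) :
  ebounded [set x : pt R d | forall i, t 0 i <= x 0 i < t 0 i + l].
Proof.
apply: (@ebounded_coord _ _ _ (\sum_i `|t 0 i| + `|l|)) => x i /(_ i)/andP[a b].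
have H1 : `|t 0 i| <= \sum_i `|t 0 i| by rewrite (bigD1 i)//= lerDl sumr_ge0.
have := ler_norm (t 0 i); have := ler_norm (- t 0 i); rewrite normrN.
have := ler_norm l; have := normr_ge0 l.
by rewrite ler_norml => ? ? ? ?; apply/andP; split; lra.
Qed.

(** At least [1 + 3 * rs]: per coordinate the dilation moves a centre by at most 1, the slack by at
    most [rs], and [2 * rs] must remain between it and the outside of the cell. *)
Definition margin : nat := (Num.truncn (3 * rs)).+2.

(** Moving each coordinate by this much displaces a centre by at most [rs / m]. Dilation by
    [1 + 1/m] adds at least [2 * rs / m] to every mutual distance, exactly what two such
    displacements can consume. *)
Definition slack (m : nat) : R := rs / (m * d)%:R.

(* The packing [s] of the box of half-width [m], dilated by [1 + 1/m] about the centre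
   of the cell; the dilation leaves room to move every centre by [slack m]. *)
Definition dilated_center (t : pt R d) (m : nat) (p : pt R d) : pt R d :=
  \row_i (t 0 i + (m + margin)%:R + (1 + m%:R^-1) * p 0 i).

Definition slack_cube (t : pt R d) (m : nat) (p : pt R d) : set (pt R d) :=
  [set x | forall i, dilated_center t m p 0 i <= x 0 i < dilated_center t m p 0 i + slack m].

Lemma slack_gt0 m : (0 < m)%N -> 0 < slack m.
Proof. by move=> m0; rewrite divr_gt0// ltr0n muln_gt0 m0. Qed.

Lemma margin_ge : 1 + 3 * rs <= margin%:R.
Proof.
by have := truncnS_gt (3 * rs); rewrite /margin -[leRHS]natr1 => ?; lra.
Qed.

Lemma slack_cube_inner t m s p x i : (0 < m)%N -> packs rs m s -> p \in s ->
  slack_cube t m p x ->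
  t 0 i + 2 * rs <= x 0 i <= t 0 i + (2 * (m + margin))%:R - 2 * rs.
Proof.
move=> m0 [_ H _] ps /(_ i)/andP[]; rewrite !mxE => a b.
have [p1 p2] := H p ps p (eball_center rs0 p) i.
have m0' : 0 < m%:R :> R by rewrite ltr0n.
have mi : m%:R^-1 * m%:R = 1 :> R by rewrite mulVf ?gt_eqF.
have mi0 : 0 < m%:R^-1 :> R by rewrite invr_gt0.
have h1 : slack m <= rs.
  by rewrite /slack ler_pdivrMr ?ltr0n ?muln_gt0 ?m0// ler_peMr ?(ltW rs0)// ler1n muln_gt0 m0.
have q1 : m%:R^-1 * p 0 i <= 1 by rewrite -[leRHS]mi ler_pM2l// ltW.
have q2 : -1 <= m%:R^-1 * p 0 i by rewrite -[X in - X <= _]mi -mulrN ler_pM2l.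
have := margin_ge; move: a b; rewrite mulrDl mul1r natrM natrD => a b c.
by apply/andP; split; lra.
Qed.

Lemma slack_cube_sub t m s p : (0 < m)%N -> packs rs m s -> p \in s ->
  slack_cube t m p `<=` cube_at t (m + margin).
Proof.
move=> m0 ps sp x xp i; have /andP[] := slack_cube_inner i m0 ps sp xp.
set w := (2 * _)%:R => a b; have r0 := rs0.
by apply/andP; rewrite -/w; split; lra.
Qed.

Lemma slack_cube_far t m s p x v : (0 < m)%N -> packs rs m s -> p \in s ->
  slack_cube t m p x -> ~ cube_at t (m + margin) v -> 2 * rs <= edist x v.
Proof.
move=> m0 ps sp xp /existsNP[i nv]; apply: le_trans (coord_le_edist x v i).
have /andP[a b] := slack_cube_inner i m0 ps sp xp.
rewrite leNgt ltr_norml; apply/negP => /andP[c e]; apply: nv.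
move: a b c e; set w := (2 * _)%:R => a b c e; have r0 := rs0.
by apply/andP; rewrite -/w; split; lra.
Qed.

Lemma slack_cube_sep t m s p q x y : (0 < m)%N -> packs rs m s ->
  p \in s -> q \in s -> p <> q ->
  slack_cube t m p x -> slack_cube t m q y -> 2 * rs <= edist x y.
Proof.
move=> m0 [_ _ H] ps qs pq xp yq; have pq2 := H p q ps qs pq.
have m0' : 0 < m%:R :> R by rewrite ltr0n.
have mi0 : 0 < m%:R^-1 :> R by rewrite invr_gt0.
have cc : edist (dilated_center t m p) (dilated_center t m q) = (1 + m%:R^-1) * edist p q.
  by apply: edist_scale; [lra|move=> i; rewrite !mxE; ring].
have near_center r z : slack_cube t m r z -> edist (dilated_center t m r) z <= rs / m%:R.
  move=> zr; have -> : rs / m%:R = d%:R * slack m.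
    by rewrite /slack natrM; field; rewrite !pnatr_eq0 -!lt0n m0 d0.
  apply: edist_le => i; have /andP[a b] := zr i.
  by rewrite ler_norml; apply/andP; split; have := slack_gt0 m0; lra.
have t1 := edist_triangle (dilated_center t m p) x (dilated_center t m q).
have t2 := edist_triangle x y (dilated_center t m q).
have n1 := near_center p x xp; have n2 := near_center q y yq.
rewrite (edistC _ y) in n2.
have : (1 + m%:R^-1) * (2 * rs) <= (1 + m%:R^-1) * edist p q by rewrite ler_pM2l//; lra.
move: t1; rewrite cc mulrDl mul1r => t1 t3.
have -> : 2 * rs = (2 * rs + m%:R^-1 * (2 * rs)) - rs / m%:R - rs / m%:R by field; rewrite gt_eqF.
by lra.
Qed.

Local Open Scope ereal_scope.

Lemma sallowed_slack t m s (xs : seq (pt R d)) (V : set (pt R d)) : (0 < m)%N ->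
  packs rs m s -> sallowed rs V -> V `&` cube_at t (m + margin) = set0 ->
  size xs = size s ->
  (forall i, (i < size s)%N -> slack_cube t m (nth 0%R s i) (nth 0%R xs i)) ->
  sallowed rs ([set` xs] `|` V).
Proof.
move=> m0 ps aV VL sxs Hxs.
have nV v : V v -> ~ cube_at t (m + margin) v.
  by move=> Vv Lv; have : (V `&` cube_at t (m + margin)) v by []; rewrite VL.
have [us _ _] := ps.
have idx x : x \in xs -> exists i, [/\ (i < size s)%N, x = nth 0%R xs i & nth 0%R s i \in s].
  move=> xx; exists (index x xs); have ix : (index x xs < size s)%N by rewrite -sxs index_mem.
  by split; rewrite ?nth_index ?mem_nth.
move=> p q [/= /idx[i [ik -> si]]|Vp] [/= /idx[j [jk -> sj]]|Vq] pq.
- apply: (slack_cube_sep m0 ps si sj _ (Hxs i ik) (Hxs j jk)) => /eqP.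
  by rewrite nth_uniq// => /eqP ij; apply: pq; rewrite ij.
- exact: slack_cube_far m0 ps si (Hxs i ik) (nV q Vq).
- by rewrite edistC; exact: slack_cube_far m0 ps sj (Hxs j jk) (nV p Vp).
- exact: aV.
Qed.

Lemma energy_cube_at t M (U : sconf R d) :
  energy rs rp (cube_at t M) U <= (((2 * M)%:R + 2 * rhat rs rp) ^+ d)%:E.
Proof.
have r0 : (0 < rhat rs rp)%R by rewrite addr_gt0.
pose t' : pt R d := (\row_i (t 0 i - rhat rs rp))%R.
rewrite -(vol_rect_le t'); last by rewrite addr_ge0// mulr_ge0// ltW.
apply: vol_mono => x [[p [Up Lp] px] _] i; have /andP[a b] := Lp i.
have := le_lt_trans (coord_le_edist p x i) px; rewrite ltr_norml !mxE => /andP[e f].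
by apply/andP; split; lra.
Qed.

Lemma bounded_borel_cube_at t M : bounded_borel (cube_at t M).
Proof. by split; [exact: borel_rect|exact: bounded_rect]. Qed.

Lemma vol_cube_at t M : vol (cube_at t M) = ((2 * M)%:R ^+ d)%:E :> \bar R.
Proof. exact: vol_rect_le. Qed.

(** Worst case over all boundaries: the balls of spheres in the cell stay within the cell enlarged
    by [rhat] on each side. *)
Definition min_weight M : R := expR (- (zp * ((2 * M)%:R + 2 * rhat rs rp) ^+ d)).

Lemma weight_cube_at t M U : sallowed rs U ->
  (min_weight M)%:E <= weight rs rp zp (cube_at t M) U.
Proof.
move=> aU; have [_ bL] := bounded_borel_cube_at t M.
rewrite weightE// indicE mem_set// mule1 lee_fin ler_expR lerN2 ler_pM2l//.
by rewrite -lee_fin energy_fin// energy_cube_at.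
Qed.

(** Only the term with exactly [size s] points is kept, each point confined to its own slack cube.
    The margin makes such configurations compatible with any allowed boundary. *)
Lemma Zsph_lower zs t m (s : seq (pt R d)) (Y : sconf R d) : (0 < zs)%R -> (0 < m)%N -> packs rs m s ->
  let Lam := cube_at t (m + margin) in
  sallowed rs (restrS Y (~` Lam)) ->
  (expR (- zs * fine (vol Lam)) * (zs ^+ size s / ((size s)`!)%:R *
    (min_weight (m + margin) * (slack m ^+ d) ^+ size s)))%:E <=
  Zsph rs rp zs zp Lam Y.
Proof.
move=> zs0 m0 ps Lam aV; have bL := bounded_borel_cube_at t (m + margin).
rewrite ZsphE /poisson EFinM; apply: lee_wpmul2l; first by rewrite lee_fin expR_ge0.
have w0 n : (0 <= zs ^+ n / (n`!)%:R)%R by apply: poisson_weight_ge0; exact: ltW.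
have I0 n : 0 <= intn Lam n (fun X => weight rs rp zp Lam ([set` X] `|` restrS Y (~` Lam))).
  by apply: intn_ge0 => X; exact: weight_ge0.
rewrite (@nneseriesD1 _ _ (size s) xpredT)//; last by move=> n _; rewrite mule_ge0// lee_fin.
rewrite -[leLHS]adde0; apply: leeD; last first.
  by apply: nneseries_ge0 => n _ _; rewrite mule_ge0// lee_fin.
rewrite EFinM; apply: lee_wpmul2l; first by rewrite lee_fin.
have prodE : \prod_(A <- map (slack_cube t m) s) vol A = ((slack m ^+ d) ^+ size s)%:E.
  elim: (s) => [|p s' IH]; first by rewrite big_nil expr0.
  rewrite big_cons IH exprS EFinM; congr (_ * _).
  by apply: vol_rect_le; apply: ltW; exact: slack_gt0.
rewrite EFinM -prodE -[size s](size_map (slack_cube t m)).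
have nthE i : (i < size s)%N -> nth set0 (map (slack_cube t m) s) i = slack_cube t m (nth 0%R s i).
  by move=> ik; rewrite (nth_map 0%R).
apply: intn_cubes; first by exact: expR_ge0.
- by move=> X; exact: weight_ge0.
- move=> i; rewrite size_map => ik; rewrite nthE//; split; first exact: borel_rect.
  by apply: (slack_cube_sub m0 ps); exact: mem_nth.
move=> xs; rewrite size_map => sxs Hxs; apply: weight_cube_at.
apply: (sallowed_slack m0 ps aV _ sxs).
  by apply/seteqP; split=> [v [[_ nv] Lv]|v []]; exact: nv.
by move=> i ik; rewrite -nthE//; exact: Hxs.
Qed.

(** Terms with at least [k] sampled points vanish because repetitions are null; the finitely many
    others are bounded by powers of the volume. *)
Lemma poisson_underfull zs Lam k : (0 < zs)%R -> bounded_borel Lam ->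
  poisson zs Lam (fun X => (\1_[set X : set (pt R d) | ~ atleast k (X `&` Lam)] X)%:E) <=
  (expR (- zs * fine (vol Lam)) *
    \sum_(j < k) (zs ^+ j / (j`!)%:R * fine (vol Lam) ^+ j))%:E.
Proof.
move=> zs0 bL; rewrite /poisson EFinM; apply: lee_wpmul2l; first by rewrite lee_fin expR_ge0.
have w0 n : (0 <= zs ^+ n / (n`!)%:R)%R by apply: poisson_weight_ge0; exact: ltW.
set G := fun s : seq (pt R d) => _.
have G0 s : 0 <= G s by rewrite lee_fin.
have I0 n : 0 <= (zs ^+ n / (n`!)%:R)%:E * intn Lam n G by rewrite mule_ge0 ?intn_ge0// lee_fin.
rewrite (nneseries_split 0 k)// add0n [X in _ + X]eseries0 ?adde0; last first.
  move=> n kn _; rewrite (_ : intn Lam n G = 0) ?mule0//.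
  apply/eqP; rewrite eq_le; apply/andP; split; last exact: intn_ge0.
  rewrite -(intn_repeat n d0 bL); apply: intn_mono => // X _ _.
  rewrite lee_fin !indicE; have [|_] := boolP ([set` X] \in _); last by [].
  by rewrite inE /= => H; rewrite mem_set// => H'; apply: H; exact: atleast_le H'.
rewrite big_mkord -sumEFin; apply: lee_sum => j _.
rewrite [leRHS]EFinM; apply: lee_wpmul2l; first by rewrite lee_fin.
rewrite -intn_cst//; apply: intn_mono => // X _ _.
by rewrite lee_fin indicE; case: (_ \in _).
Qed.

(** Ratio of the two preceding bounds; the Poisson prefactor, which is exponentially small in [zs],
    is common to both and cancels. The constant is fixed before [zs], [nu] and the corner [t]. *)
Lemma rare_underfull m (s : seq (pt R d)) : (0 < m)%N -> packs rs m s -> exists C : R, (0 <= C)%R /\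
  forall zs (nu : probability (SConf R d) R) t, (1 <= zs)%R -> gibbsS rs rp zs zp nu ->
  nu [set X | ~ atleast (size s) (X `&` cube_at t (m + margin))] <= (C / zs)%:E.
Proof.
move=> m0 ps; set M := (m + margin)%N; set k := size s.
pose v : R := ((2 * M)%:R ^+ d)%R.
pose S : R := (\sum_(j < k) (v ^+ j / (j`!)%:R))%R.
(* [b] is the coefficient of [zs ^ k] in the lower bound of [Zsph]; [S] dominates the numerator
   after division by [zs ^ (k - 1)]. *)
pose b : R := (min_weight M * (slack m ^+ d) ^+ k / (k`!)%:R)%R.
have b0 : (0 < b)%R.
  rewrite /b divr_gt0 ?ltr0n ?fact_gt0// mulr_gt0 ?expR_gt0//.
  by rewrite !exprn_gt0// slack_gt0.
have S0 : (0 <= S)%R.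
  by apply: sumr_ge0 => j _; rewrite divr_ge0// exprn_ge0// exprn_ge0.
exists (S / b)%R; split; first by rewrite divr_ge0// ltW.
move=> zs nu t zs1 gnu; have zs0 : (0 < zs)%R by apply: lt_le_trans zs1.
have C0 : (0 <= S / b / zs)%R by apply: divr_ge0; [apply: divr_ge0; [|exact: ltW]|exact: ltW].
set Lam := cube_at t M; have bL : bounded_borel Lam := bounded_borel_cube_at t M.
have mA : measurable ([set X | ~ atleast k (X `&` Lam)] : set (SConf R d)).
  exact: (measurableC (measurable_atleast k bL)).
set A := [set X | _] in mA *.
have mF : measurable_fun [set: SConf R d] (fun X : SConf R d => (\1_A X)%:E : \bar R).
  exact: measurable_eindic.
have -> : nu A = \int[nu]_X (\1_A X)%:E by rewrite integral_indic// setIT.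
rewrite (gibbsS_int gnu bL mF); last by move=> X; rewrite lee_fin.
apply: (@le_trans _ _ (\int[nu]_X (S / b / zs)%:E)); last first.
  rewrite integral_cst// [X in _ * X](_ : _ = 1) ?mule1//.
  exact: probability_setT.
apply: integral_mono => Y.
  by rewrite mule_ge0 ?inv_Zsph_ge0 ?gibbs_int_ge0// => X; rewrite lee_fin.
set V := restrS Y (~` Lam).
(* With a forbidden boundary the numerator of the kernel is already zero. *)
have [aV|naV] := pselect (sallowed rs V); last first.
  rewrite (_ : gibbs_int _ _ _ _ _ _ _ = 0); first by rewrite mule0 lee_fin.
  rewrite /gibbs_int -/V (_ : (fun X => _) = (fun X : SConf R d => 0 * 1)).
    by rewrite poissonZl ?mul0e// ltW.
  apply/funext => X; rewrite mul0e /weight [X in _ * (_ * X%:E)]indicE memNset ?mule0//.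
  by move=> aU; apply: naV; apply: sallowed_sub aU => x; right.
pose e := expR (- zs * fine (vol Lam)); have e0 : (0 < e)%R by exact: expR_gt0.
have vE : fine (vol Lam) = v by rewrite vol_cube_at.
have num : gibbs_int rs rp zs zp Lam (fun X => (\1_A X)%:E) Y <=
    (e * \sum_(j < k) (zs ^+ j / (j`!)%:R * v ^+ j))%:E.
  rewrite -vE; apply: le_trans (poisson_underfull k zs0 bL); apply: poisson_mono.
  - exact: ltW.
  - by move=> X; rewrite mule_ge0 ?weight_ge0// lee_fin.
  move=> X _ _; have -> : \1_A (X `|` V) = \1_A X :> R.
    rewrite !indicE; have -> : (X `|` V \in A) = (X \in A); last by [].
    rewrite /A; apply/idP/idP => /set_mem/= H; apply/mem_set => /= H'; apply: H;
      apply: atleast_sub H' => x; first by move=> [Xx Lx]; split=> //; left.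
    by move=> [[//|[_ nLx]] Lx].
  rewrite -[leRHS]mule1; apply: lee_wpmul2l; first by rewrite lee_fin.
  by apply: weight_le1; [exact: ltW|exact: bL.2].
have den := Zsph_lower zs0 m0 ps aV; rewrite -/Lam -/k -/M in den.
rewrite -(Zsph_fin rs rp zs0 zp0 Y bL) lee_fin in den.
set Z := fine (Zsph _ _ _ _ _ _) in den *.
have den' : (e * (zs ^+ k * b) <= Z)%R.
  apply: le_trans den; rewrite -/e le_eqVlt; apply/orP; left; apply/eqP.
  by congr (_ * _)%R; rewrite /b; ring.
have zb0 : (0 < zs ^+ k * b)%R by rewrite mulr_gt0// exprn_gt0.
have Z0 : (0 < Z)%R by apply: lt_le_trans den'; rewrite mulr_gt0.
apply: (le_trans (lee_wpmul2l _ num)); first by rewrite lee_fin invr_ge0 ltW.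
rewrite -EFinM lee_fin mulrC ler_pdivrMr//.
(* Since [zs >= 1], every [zs ^ (j + 1)] with [j < k] is at most [zs ^ k]. *)
have S1 : ((\sum_(j < k) (zs ^+ j / (j`!)%:R * v ^+ j)) * zs <= zs ^+ k * S)%R.
  rewrite mulr_suml mulr_sumr; apply: ler_sum => j _.
  have -> : (zs ^+ j / (j`!)%:R * v ^+ j * zs = zs ^+ j.+1 * (v ^+ j / (j`!)%:R))%R.
    by rewrite exprSr; ring.
  apply: ler_wpM2r; first by rewrite divr_ge0// !exprn_ge0.
  by rewrite ler_weXn2l.
apply: le_trans (_ : (S / b / zs * (e * (zs ^+ k * b)) <= _)%R); last first.
  by apply: ler_wpM2l.
have -> : (S / b / zs * (e * (zs ^+ k * b)) = e * (zs ^+ k * S / zs))%R.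
  by field; rewrite !gt_eqF.
by rewrite ler_pM2l// ler_pdivlMr.
Qed.

End CellEstimate.

Lemma atleast_disjoint (T : choiceType) (I : eqType) (l : seq I) (n : I -> nat)
    (C : I -> set T) (Z : set T) : uniq l ->
  (forall i j, i \in l -> j \in l -> i <> j -> C i `&` C j = set0) ->
  (forall i, i \in l -> atleast (n i) (Z `&` C i)) ->
  atleast (\sum_(i <- l) n i) (Z `&` \bigcup_(i in [set` l]) C i).
Proof.
elim: l => [|i l IH] ul dl Hl; first by rewrite big_nil; exists [::]; split.
have /andP[il ul'] := ul.
have [s [us ss sC]] : atleast (n i) (Z `&` C i) by apply: Hl; rewrite mem_head.
have lP j : j \in l -> j \in i :: l by move=> jl; rewrite inE jl orbT.
have [s' [us' ss' sC']] : atleast (\sum_(j <- l) n j) (Z `&` \bigcup_(j in [set` l]) C j).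
  by apply: IH => // [j k /lP jl /lP kl|j /lP jl]; [exact: dl|exact: Hl].
exists (s ++ s'); split.
- rewrite cat_uniq us us' andbT/=; apply/hasPn => x xs'; apply/negP => xs.
  have [_ xC] := sC x xs; have [_ [j /= jl xCj]] := sC' x xs'.
  suff : (C i `&` C j) x by rewrite dl ?mem_head ?lP// => E; rewrite E jl in il.
  by split.
- by rewrite size_cat ss ss' big_cons.
move=> x /=; rewrite mem_cat => /orP[/sC|/sC'] [Zx]; first by move=> xC; split=> //; exists i; rewrite //= mem_head.
by move=> [j /= jl xC]; split=> //; exists j => //=; exact: lP.
Qed.

Lemma counting_ge0 (R : realType) (T : choiceType) (Z : set T) : (0 <= counting Z :> \bar R)%E.
Proof. by apply: (proj2 (@counting_ge R T Z 0)); exists [::]; split. Qed.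

(** * From cells and packings to the density *)

Section Density.
Context (R : realType) (d : nat) (rs rp : R).
Hypotheses (d0 : (0 < d)%N) (rs0 : 0 < rs) (rp0 : 0 < rp).

(** Balls centred in the box may stick out by [rs], so they form a packing of a box enlarged by
    [c >= rs]. *)
Lemma sallowed_packs (X : sconf R d) n (c : nat) s : rs <= c%:R -> sallowed rs X ->
  uniq s -> [set` s] `<=` X `&` box n -> packs rs (n + c) s.
Proof.
move=> rc aX us sX; split=> //; last by apply: sallowed_sub aX => p /sX[].
move=> p ps x px i; have [_ /(_ i)[a b]] := sX p ps.
have := le_lt_trans (coord_le_edist p x i) px; rewrite ltr_norml natrD => /andP[e f].
by split; lra.
Qed.

Local Open Scope ereal_scope.

Lemma counting_sallowed (X : sconf R d) n (c : nat) : (0 < n)%N -> (rs <= c%:R)%R ->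
  sallowed rs X ->
  counting (X `&` box n) <= (rho_star d rs * box_vol R d (n + c))%:E :> \bar R.
Proof.
move=> n0 rc aX; set B := (_ * _)%R.
have bound k : atleast k (X `&` @box R d n) -> (k%:R <= B)%R.
  move=> [s [us <- sX]]; apply: (pack_rho d0 rs0); first by rewrite addn_gt0 n0.
  exact: sallowed_packs sX.
have [E|[k E]] := counting_nat R (X `&` @box R d n); last first.
  by rewrite E lee_fin; apply: bound; apply/(counting_ge R); rewrite E.
(* An infinite count would provide more than [B] points. *)
have /bound : atleast (Num.truncn B).+1 (X `&` @box R d n).
  by apply/(counting_ge R); rewrite E leey.
by rewrite leNgt truncnS_gt.
Qed.

Section Gibbs.
Context (zs zp : R).
Hypotheses (zs0 : (0 < zs)%R) (zp0 : (0 < zp)%R).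
Context (nu : probability (SConf R d) R).
Hypothesis gnu : gibbsS rs rp zs zp nu.

Lemma box_bounded_borel n : bounded_borel (@box R d n).
Proof. by rewrite -[box n]setTI; exact: bounded_borel_box. Qed.

(** The hard core reaches [nu] through the weight in its Gibbs equation: overlapping configurations
    have weight zero, and all others obey the packing bound. *)
Lemma mean_count_le n (c : nat) : (0 < n)%N -> (rs <= c%:R)%R ->
  \int[nu]_X counting (restrS X (box n)) <= (rho_star d rs * box_vol R d (n + c))%:E.
Proof.
move=> n0 rc; set B := (_ * _)%R; have bL := box_bounded_borel n.
have B0 : (0 <= B)%R by rewrite mulr_ge0 ?rho_star_ge0// ltW// box_vol_gt0// addn_gt0 n0.
have mF : measurable_fun [set: SConf R d] (fun X : SConf R d => counting (X `&` box n) : \bar R).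
  exact: measurable_counting.
rewrite (gibbsS_int gnu bL mF); last by move=> X; exact: counting_ge0.
apply: (@le_trans _ _ (\int[nu]_X B%:E)); last first.
  rewrite integral_cst// [X in _ * X](_ : _ = 1) ?mule1//.
  exact: probability_setT.
have I0 Y : 0 <= gibbs_int rs rp zs zp (box n) (fun X => counting (X `&` box n)) Y.
  by apply: gibbs_int_ge0 => // X; exact: counting_ge0.
apply: integral_mono => Y; first by rewrite mule_ge0// inv_Zsph_ge0.
have le : gibbs_int rs rp zs zp (box n) (fun X => counting (X `&` box n)) Y <=
    B%:E * Zsph rs rp zs zp (box n) Y.
  have w0 (X : SConf R d) : 0 <= weight rs rp zp (box n) (X `|` restrS Y (~` box n)).
    exact: weight_ge0.
  rewrite ZsphE -(poissonZl (ltW zs0) bL (_ : 0 <= B%:E) _ w0)//; last first.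
    exact: (measurable_comp_setU2 _ (measurable_weight rs rp zp bL)).
  apply: poisson_mono; first exact: ltW.
    by move=> X; rewrite mule_ge0 ?weight_ge0//; exact: counting_ge0.
  move=> X _ _; have [aX|naX] := pselect (sallowed rs (X `|` restrS Y (~` box n))).
    by apply: lee_wpmul2r; [exact: weight_ge0|exact: counting_sallowed].
  by rewrite /weight indicE memNset// !mule0.
apply: le_trans (lee_wpmul2l _ le) _; first exact: inv_Zsph_ge0.
by rewrite muleCA -[leRHS]mule1; apply: lee_wpmul2l; rewrite ?lee_fin//; exact: inv_Zsph_mul_le1.
Qed.

Lemma cell_cube q m (j : {ffun 'I_d -> 'I_q}) :
  cell m j = cube_at (\row_i (- (q * m)%:R + (2 * m * j i)%:R)%R : pt R d) m.
Proof.
have E i : ((2 * m * (j i).+1)%:R = (2 * m * j i)%:R + (2 * m)%:R :> R)%R.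
  by rewrite mulnS natrD addrC.
by apply/seteqP; split=> x H i; have := H i; rewrite !mxE E addrA.
Qed.

End Gibbs.

(** Each disjoint cell contributes [size s] points times the probability that it is full;
    expectations add up without any independence between cells. *)
Lemma mean_count_ge (zp : R) m (s : seq (pt R d)) : (0 < zp)%R -> (0 < m)%N -> packs rs m s ->
  exists C : R, (0 <= C)%R /\
  forall zs (nu : probability (SConf R d) R) n, (1 <= zs)%R -> gibbsS rs rp zs zp nu ->
  (((n %/ (m + margin rs)) ^ d)%:R * ((size s)%:R * (1 - C / zs)))%:E <=
  \int[nu]_X counting (restrS X (box n)).
Proof.
move=> zp0 m0 ps; have [C [C0 HC]] := rare_underfull d0 rs0 rp0 zp0 m0 ps.
exists C; split=> // zs nu n zs1 gnu; set M := (m + margin rs)%N in HC *.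
set q := (n %/ M)%N; set k := size s in HC *.
have bC j : bounded_borel (cell M j : set (pt R d)).
  by move: j => j; rewrite cell_cube; exact: bounded_borel_cube_at.
pose A (j : {ffun 'I_d -> 'I_q}) := [set X : SConf R d | atleast k (X `&` cell M j)].
have mA j : measurable (A j) by exact: measurable_atleast.
have le X : \sum_(j : {ffun 'I_d -> 'I_q}) (k%:R%:E * (\1_(A j) X)%:E) <=
    counting (restrS X (box n)) :> \bar R.
  pose nj j := (k * (X \in A j))%N.
  have : atleast (\sum_(j <- enum {ffun 'I_d -> 'I_q}) nj j)
      (X `&` \bigcup_(j in [set` enum {ffun 'I_d -> 'I_q}]) cell M j).
    apply: atleast_disjoint; first exact: enum_uniq.
      by move=> i j _ _; exact: cell_disjoint.
    move=> j _; rewrite /nj; case: (boolP (X \in A j)) => [/set_mem|_].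
      by rewrite muln1.
    by rewrite muln0; exists [::]; split.
  move/(@atleast_sub _ _ _ (X `&` box n)) => /(_ _)/(counting_ge R)H.
  apply: le_trans (H _); last first.
    move=> x [Xx [j _ jx]]; split=> //; apply: cell_sub_box jx => //.
    exact: leq_trunc_div.
  rewrite big_enum/= natr_sum -sumEFin; apply: lee_sum => j _.
  by rewrite -EFinM lee_fin /nj natrM indicE.
apply: (@le_trans _ _ (\int[nu]_X \sum_(j : {ffun 'I_d -> 'I_q}) (k%:R%:E * (\1_(A j) X)%:E))); last first.
  apply: integral_mono => // X; apply: sume_ge0 => j _.
  by rewrite -EFinM lee_fin mulr_ge0.
rewrite ge0_integral_sum//; last first.
  by move=> j; apply: emeasurable_funM => //; exact: measurable_eindic.
have EA j : \int[nu]_X (k%:R%:E * (\1_(A j) X)%:E) = k%:R%:E * nu (A j).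
  rewrite ge0_integralZl//; last exact: measurable_eindic.
  by rewrite integral_indic// setIT.
rewrite (eq_bigr (fun j => k%:R%:E * nu (A j)))//.
apply: (@le_trans _ _ (\sum_(j : {ffun 'I_d -> 'I_q}) (k%:R * (1 - C / zs))%:E)).
  rewrite sumEFin lee_fin sumr_const card_ffun !card_ord -[leRHS]mulr_natl.
  by rewrite le_refl.
apply: lee_sum => j _; rewrite EFinM; apply: lee_wpmul2l => //.
have := HC zs nu (\row_i (- (q * M)%:R + (2 * M * j i)%:R)%R) zs1 gnu.
rewrite -cell_cube (_ : [set X | ~ _] = ~` A j)// probability_setC//.
have : nu (A j) \is a fin_num by exact: fin_num_measure.
case: (nu (A j)) => // r _; rewrite -EFinB !lee_fin => H; lra.
Qed.

End Density.

Section DensityLimits.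
Context (R : realType) (d : nat) (rs rp zp : R).
Hypotheses (d0 : (0 < d)%N) (rs0 : 0 < rs) (rp0 : 0 < rp) (zp0 : 0 < zp).
Local Notation rho := (rho_star d rs).
Local Open Scope ereal_scope.

Lemma dens_sup_le zs (nu : probability (SConf R d) R) : (0 < zs)%R ->
  gibbsS rs rp zs zp nu -> dens_sup nu <= rho%:E.
Proof.
move=> zs0 gnu; apply/lee_addgt0Pr => e e0; apply: limn_esup_le.
pose c := (Num.truncn rs).+1; have rc : (rs <= c%:R)%R by rewrite ltW// truncnS_gt.
have r0 := rho_star_ge0 d0 rs0; have re0 : (0 < rho + e)%R by rewrite ltr_wpDl.
(* The tolerance [e / (rho + e)] is the one for which [(rho + e) * (1 - e / (rho + e)) = rho]. *)
have [N _ HN] := near_ratio_pow d (ler0n R c) (divr_gt0 e0 re0).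
near=> n; have n0 : (0 < n)%N by near: n; exact: nbhs_infty_gt.
have Nn : (N <= n + c)%N by rewrite (leq_trans _ (leq_addr _ _))//; near: n; exact: nbhs_infty_ge.
have n0' : (0 < n%:R :> R)%R by rewrite ltr0n.
have nc0 : (0 < (n + c)%:R :> R)%R by rewrite ltr0n addn_gt0 n0.
have /(_ n%:R (ler0n _ _)) := HN (n + c)%N Nn.
rewrite natrD addrK lexx -natrD => /(_ isT) H.
set v := box_vol R d n; have v0 : (0 < v)%R by exact: box_vol_gt0.
rewrite /dens_n; apply: (@le_trans _ _ ((v^-1)%:E * (rho * box_vol R d (n + c))%:E)).
  by apply: lee_wpmul2l; rewrite ?lee_fin ?invr_ge0 ?(ltW v0)//; exact: (mean_count_le d0 rs0 zs0 zp0 gnu n0 rc).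
rewrite -EFinM -EFinD lee_fin box_volD// -/v mulrCA mulKf ?gt_eqF//.
have y0 : (0 <= ((n + c)%:R / n%:R) ^+ d :> R)%R by rewrite exprn_ge0// divr_ge0// ltW.
rewrite -(ler_pM2l re0) in H.
have := ler_wpM2r y0 H; rewrite -[(_ * _ ^+ d * _ ^+ d)%R]mulrA -exprMn.
have -> : (n%:R / (n + c)%:R * ((n + c)%:R / n%:R) = 1 :> R)%R by rewrite mulrA divfK ?gt_eqF// divff ?gt_eqF.
rewrite expr1n mulr1 => H'; apply: le_trans H'; rewrite le_eqVlt; apply/orP; left; apply/eqP.
by congr (_ * _)%R; field; rewrite gt_eqF.
Unshelve. all: by end_near.
Qed.

Lemma dens_inf_ge (e : R) : (0 < e)%R -> exists z0 : R,
  forall zs (nu : probability (SConf R d) R), (z0 <= zs)%R ->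
  gibbsS rs rp zs zp nu -> (rho - e)%:E <= dens_inf nu.
Proof.
move=> e0; have e2 : (0 < e / 2)%R by rewrite divr_gt0.
(* The density of the packing is measured against the whole cell, margin included. *)
have [m [s [m0 ps Hs]]] := packs_near_rho d0 rs0 (margin rs) e2.
have [C [C0 HC]] := mean_count_ge d0 rs0 rp0 zp0 m0 ps.
set M := (m + margin rs)%N in Hs HC; have M0 : (0 < M)%N by rewrite addn_gt0 m0.
set b := (_ / _)%R in Hs; have vM0 := box_vol_gt0 R d M0.
have b0 : (0 <= b)%R by rewrite divr_ge0// ltW.
(* The three terms ensure in turn [1 <= zs], [C / zs <= 1] and [b * C / zs <= e / 2]. *)
exists (1 + C + 2 * b * C / e)%R => zs nu zsE gnu.
have q0 : (0 <= 2 * b * C / e)%R by apply: divr_ge0; [apply: mulr_ge0 => //; exact: mulr_ge0|exact: ltW].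
have zs1 : (1 <= zs)%R by lra.
have zs0 : (0 < zs)%R by lra.
have Cz : (C / zs <= 1)%R by rewrite ler_pdivrMr//; lra.
have bC : (b * (C / zs) <= e / 2)%R.
  rewrite mulrA ler_pdivrMr//; have : (2 * b * C / e <= zs)%R by lra.
  by rewrite ler_pdivrMr//; lra.
pose a := (b * (1 - C / zs))%R; have a0 : (0 <= a)%R by rewrite mulr_ge0// subr_ge0.
apply: (@le_trans _ _ a%:E); first by rewrite lee_fin /a; lra.
apply/lee_addgt0Pr => e' e'0; rewrite -leeBlDr// -EFinB; apply: limn_einf_ge.
have := near_cells_volume d M0 a0 e'0; apply: filter_app; near=> n => H.
have n0 : (0 < n)%N by near: n; exact: nbhs_infty_gt.
have v0 := box_vol_gt0 R d n0.
have vi0 : (0 <= (box_vol R d n)^-1)%R by rewrite invr_ge0 ltW.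
apply: (@le_trans _ _ ((box_vol R d n)^-1%:E *
    (((n %/ M) ^ d)%:R * ((size s)%:R * (1 - C / zs)))%:E)); last first.
  by apply: lee_wpmul2l; rewrite ?lee_fin//; exact: HC.
rewrite -EFinM lee_fin; apply: le_trans H _; rewrite mulrC le_eqVlt; apply/orP; left.
apply/eqP; congr (_ * (_ * _))%R.
by rewrite /a mulrAC divfK ?gt_eqF.
Unshelve. all: by end_near.
Qed.

Lemma cvge_pinfty (f : R -> \bar R) (l : R) :
  (forall zs, (0 < zs)%R -> f zs <= l%:E) ->
  (forall e, (0 < e)%R -> exists z0 : R, forall zs, (z0 <= zs)%R -> (0 < zs)%R ->
     (l - e)%:E <= f zs) ->
  f zs @[zs --> +oo%R] --> l%:E.
Proof.
move=> up low.
have near_low e : (0 < e)%R -> \forall zs \near +oo%R, (l - e)%:E <= f zs <= l%:E.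
  move=> e0; have [z0 Hz] := low e e0; near=> zs.
  have zs0 : (0 < zs)%R by near: zs; exact: nbhs_pinfty_gt.
  rewrite up// andbT Hz//; near: zs; exact: nbhs_pinfty_ge.
apply/fine_cvgP; split.
  apply: filterS (near_low 1%R ltr01) => zs /andP[].
  by case: (f zs).
apply/cvgrPdist_le => e e0; apply: filterS (near_low e e0) => zs /andP[].
case E : (f zs) => [r| |] //; rewrite /comp E !lee_fin/= => a b.
by rewrite ler_norml; apply/andP; split; lra.
Unshelve. all: by end_near.
Qed.

(** The upper and the lower density at fixed activity are squeezed together: [dens_sup] is at most
    [rho] at every activity, and [dens_inf] exceeds [rho - e] once [zs] is large. *)
Lemma dens_cvg (nu : R -> probability (SConf R d) R) :
  (forall zs, (0 < zs)%R -> gibbsS rs rp zs zp (nu zs)) ->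
  (dens_sup (nu zs) @[zs --> +oo%R] --> rho%:E) /\
  (dens_inf (nu zs) @[zs --> +oo%R] --> rho%:E).
Proof.
move=> gnu; have le zs : dens_inf (nu zs) <= dens_sup (nu zs) by exact: limn_einf_sup.
have up zs : (0 < zs)%R -> dens_sup (nu zs) <= rho%:E.
  by move=> zs0; exact: dens_sup_le (gnu zs zs0).
have low e : (0 < e)%R -> exists z0 : R, forall zs, (z0 <= zs)%R -> (0 < zs)%R ->
    (rho - e)%:E <= dens_inf (nu zs).
  move=> e0; have [z0 Hz] := dens_inf_ge e0.
  by exists z0 => zs z0s zs0; exact: Hz z0s (gnu zs zs0).
split; apply: cvge_pinfty => //.
- move=> e e0; have [z0 Hz] := low e e0.
  by exists z0 => zs z0s zs0; apply: le_trans (le zs); exact: Hz.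
- by move=> zs zs0; apply: le_trans (le zs) _; exact: up.
Qed.

End DensityLimits.

Theorem theorem1p2 (R : realType) (d : nat) (rs rp : R) :
  (2 <= d)%N -> 0 < rp -> rp < rs ->
  (* the sphere marginal of any mu in G_{zs,zp} lies in G_{zs}(zp E) *)
  (forall zs zp : R, 0 < zs -> 0 < zp ->
     forall mu : probability (MConf R d) R, gibbsM rs rp zs zp mu ->
     exists nu : probability (SConf R d) R,
       marginal mu nu /\ gibbsS rs rp zs zp nu) /\
  (* low activity: no percolation *)
  (exists zc : R, 0 < zc /\
     forall zs zp : R, 0 < zs -> zs < zc -> 0 < zp ->
     forall (mu : probability (MConf R d) R) (nu : probability (SConf R d) R),
       gibbsM rs rp zs zp mu -> marginal mu nu ->
       {ae nu, forall X : SConf R d, ~ percolates rs rp X}) /\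
  (* high activity: closest-packing density *)
  (forall zp : R, 0 < zp ->
     forall nu : R -> probability (SConf R d) R,
       (forall zs : R, 0 < zs -> gibbsS rs rp zs zp (nu zs)) ->
       exists rho_star : R,
         ((packing_number d rs n * ((box_vol R d n)^-1)%:E)%E @[n --> \oo] --> rho_star%:E) /\
         (dens_sup (nu zs) @[zs --> +oo] --> rho_star%:E) /\
         (dens_inf (nu zs) @[zs --> +oo] --> rho_star%:E)).
Proof.
move=> d2 rp0 rps; have rs0 : 0 < rs := lt_trans rp0 rps.
have d0 : (0 < d)%N := ltnW d2.
split.
  move=> zs zp zs0 zp0 mu gmu; have [nu mnu] := marginal_exists mu.
  by exists nu; split=> //; exact: marginal_gibbs gmu mnu.
split.
  have [zc [zc0 H]] := low_activity_no_percolation d rs0 rp0.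
  exists zc; split=> // zs zp zs0 zsc zp0 mu nu gmu mnu.
  by apply: (H zs zp) => //; exact: marginal_gibbs gmu mnu.
move=> zp zp0 nu gnu; exists (rho_star d rs); split; first exact: packing_density_cvg.
exact: dens_cvg gnu.
Qed.
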